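(* Let $\Sigma$ be a finite alphabet and let $L \subseteq \Sigma^*$ be a language. Then $L$ is inductive (i.e. $\Pi^1_1$) if and only if there is an alternating Turing machine $M$ over $\Sigma$ with $L = \mathcal{L}(M)$, where acceptance is understood in the global sense defined in the context.
   Context: **Alternating Turing machines.** Let $\Sigma$ be a finite alphabet. The symbols $\sqcup$ (blank), $+$ (cursor forward) and $-$ (cursor backward) are reserved (in particular they are not in $\Sigma$). An *alternating Turing machine (ATM) over $\Sigma$* is a device $M$ consisting of: disjoint finite sets $E$ (existential states) and $U$ (universal states), with $Q = E\cup U$ the set of states; a start state $s_0\in Q$; a finite alphabet $\Gamma \supseteq \Sigma\cup\{\sqcup\}$; and a relation $\delta\subseteq (Q\times\Gamma)\times(A\times Q)$, where $A=\Gamma\cup\{-,+\}$ is the set of actions. There are no designated accepting or rejecting states. A *configuration* is a tuple $(q,u,\gamma,v)$ with $q\in Q$, $u,v\in\Gamma^*$, $\gamma\in\Gamma$ ($\gamma$ is the scanned symbol). It is existential or universal according to whether $q\in E$ or $q \in U$. The yield relation $\Rightarrow$ is the least relation such that ($\varepsilon$ is the empty string): if $(q,\gamma,+,q')\in\delta$ then $(q,u,\gamma,\tau v)\Rightarrow(q',u\gamma,\tau,v)$ and $(q,u,\gamma,\varepsilon)\Rightarrow(q',u\gamma,\sqcup,\varepsilon)$; if $(q,\gamma,-,q')\in\delta$ then $(q,u\tau,\gamma,v)\Rightarrow(q',u,\tau,\gamma v)$ and $(q,\varepsilon,\gamma,v)\Rightarrow(q',\varepsilon,\gamma,v)$; if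 $(q,\gamma,\tau,q')\in\delta$ with $\tau\in\Gamma$ then $(q,u,\gamma,v)\Rightarrow(q',u,\tau,v)$. **Global acceptance.** Write $c\to_\exists c'$ when $c\Rightarrow c'$ and $c$ is existential, and $c\twoheadrightarrow_\exists c'$ when $c\to_\exists^* c'$ (reflexive-transitive closure) and $c'$ is universal. Dually, $c\to_\forall c'$ when $c\Rightarrow c'$ and $c$ is universal, and $c\twoheadrightarrow_\forall c'$ when $c\to_\forall^* c'$ and $c'$ is existential. The set $AC$ of *accepted configurations* is the least set of configurations such that: (1) if $c$ is existential and $c'\in AC$ for some $c'$ with $c\twoheadrightarrow_\exists c'$, then $c\in AC$; (2) if $c$ is universal and $c'\in AC$ for all $c'$ with $c\twoheadrightarrow_\forall c'$, then $c\in AC$. The initial configuration for input $w\in\Sigma^*$ is $(s_0,\varepsilon,\sqcup,w)$. $M$ *accepts* $w$ if this configuration is in $AC$, and $\mathcal{L}(M)=\{w\in\Sigma^*\mid M\text{ accepts }w\}$. **Inductive languages.** Consider formulas over the vocabulary with a constant for each letter of $\Sigma$ and for the empty string, a binary function symbol for concatenation, and a binary relation symbol for the substring relation, interpreted in $\Sigma^*$. A language $L\subseteq\Sigma^*$ is *inductive* ($\Pi^1_1$) if $L=\{w\in\Sigma^*\mid \forall f\,\varphi[w,f]\}$ for some first-order formula $\varphi$ (over this vocabulary extended with the function variable $f$), where $f$ ranges over all functions $\Sigma^*\to\Sigma^*$. *)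

(* Defs.v *)
From Stdlib Require Import Relation_Operators.
From mathcomp Require Import all_boot.

Set Implicit Arguments.
Unset Strict Implicit.
Unset Printing Implicit Defensive.

Definition language (Sigma : finType) := seq Sigma -> Prop.

Variant action (Gamma : Type) : Type :=
  | Write of Gamma
  | Forward
  | Backward.

Arguments Forward {Gamma}.
Arguments Backward {Gamma}.

(* The inclusion of Sigma plus the blank in Gamma is rendered by an injective
   map [glyph], where [None] stands for the blank symbol. *)
Record ATM (Sigma : finType) := MkATM {
  exist_state : finType;
  univ_state : finType;
  start : exist_state + univ_state;
  alphabet : finType;
  glyph : option Sigma -> alphabet;
  glyph_inj : injective glyph;
  delta : pred (((exist_state + univ_state) * alphabet) *
                (action alphabet * (exist_state + univ_state)))
}.

Section Machine.

Variables (Sigma : finType) (M : ATM Sigma).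

Definition state : Type := (exist_state M + univ_state M)%type.

Definition blank : alphabet M := glyph M None.

Record config := Config {
  cstate : state;
  cleft : seq (alphabet M);
  cscanned : alphabet M;
  cright : seq (alphabet M)
}.

Definition existential (c : config) : bool :=
  if cstate c is inl _ then true else false.

Definition universal (c : config) : bool :=
  if cstate c is inr _ then true else false.

Inductive yield : config -> config -> Prop :=
  | YForward q q' u g t v :
      delta ((q, g), (Forward, q')) ->
      yield (Config q u g (t :: v)) (Config q' (rcons u g) t v)
  | YForwardEnd q q' u g :
      delta ((q, g), (Forward, q')) ->
      yield (Config q u g [::]) (Config q' (rcons u g) blank [::])
  | YBackward q q' u t g v :
      delta ((q, g), (Backward, q')) ->
      yield (Config q (rcons u t) g v) (Config q' u t (g :: v))
  | YBackwardEnd q q' g v :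
      delta ((q, g), (Backward, q')) ->
      yield (Config q [::] g v) (Config q' [::] g v)
  | YWrite q q' u g t v :
      delta ((q, g), (Write t, q')) ->
      yield (Config q u g v) (Config q' u t v).

Definition estep (c c' : config) : Prop := yield c c' /\ existential c.

Definition ustep (c c' : config) : Prop := yield c c' /\ universal c.

Definition ephase (c c' : config) : Prop :=
  clos_refl_trans config estep c c' /\ universal c'.

Definition uphase (c c' : config) : Prop :=
  clos_refl_trans config ustep c c' /\ existential c'.

Inductive accepted : config -> Prop :=
  | AccE c c' : existential c -> ephase c c' -> accepted c' -> accepted c
  | AccU c : universal c -> (forall c', uphase c c' -> accepted c') ->
      accepted c.

Definition initial (w : seq Sigma) : config :=
  Config (start M) [::] blank [seq glyph M (Some a) | a <- w].

Definition atm_language : language Sigma := fun w => accepted (initial w).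

End Machine.

(* Well-scoped de Bruijn syntax: [term Sigma n] and [formula Sigma n] have
   their free variables in ['I_n]; a quantifier binds index 0. *)
Inductive term (Sigma : finType) (n : nat) : Type :=
  | TVar of 'I_n
  | TEmpty
  | TLetter of Sigma
  | TCat of term Sigma n & term Sigma n
  | TFun of term Sigma n.

Arguments TEmpty {Sigma n}.

Inductive formula (Sigma : finType) : nat -> Type :=
  | FFalse n : formula Sigma n
  | FEq n of term Sigma n & term Sigma n : formula Sigma n
  | FSubstring n of term Sigma n & term Sigma n : formula Sigma n
  | FNot n of formula Sigma n : formula Sigma n
  | FAnd n of formula Sigma n & formula Sigma n : formula Sigma n
  | FOr n of formula Sigma n & formula Sigma n : formula Sigma n
  | FImp n of formula Sigma n & formula Sigma n : formula Sigma n
  | FForall n of formula Sigma n.+1 : formula Sigma n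
  | FExists n of formula Sigma n.+1 : formula Sigma n.

Arguments FFalse {Sigma n}.

Section Semantics.

Variables (Sigma : finType) (f : seq Sigma -> seq Sigma).

Definition extend n (x : seq Sigma) (e : 'I_n -> seq Sigma) :
    'I_n.+1 -> seq Sigma :=
  fun i => if unlift ord0 i is Some j then e j else x.

Fixpoint eval n (e : 'I_n -> seq Sigma) (t : term Sigma n) : seq Sigma :=
  match t with
  | TVar i => e i
  | TEmpty => [::]
  | TLetter a => [:: a]
  | TCat t1 t2 => eval e t1 ++ eval e t2
  | TFun t1 => f (eval e t1)
  end.

Fixpoint holds n (phi : formula Sigma n) : ('I_n -> seq Sigma) -> Prop :=
  match phi with
  | FFalse _ => fun=> False
  | FEq _ t1 t2 => fun e => eval e t1 = eval e t2
  | FSubstring _ t1 t2 => fun e => infix (eval e t1) (eval e t2)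
  | FNot _ p => fun e => ~ holds p e
  | FAnd _ p q => fun e => holds p e /\ holds q e
  | FOr _ p q => fun e => holds p e \/ holds q e
  | FImp _ p q => fun e => holds p e -> holds q e
  | FForall _ p => fun e => forall x, holds p (extend x e)
  | FExists _ p => fun e => exists x, holds p (extend x e)
  end.

End Semantics.

Definition inductive_language (Sigma : finType) (L : language Sigma) : Prop :=
  exists phi : formula Sigma 1,
    forall w, L w <-> forall f : seq Sigma -> seq Sigma, holds f phi (fun=> w).

(* Main.v *)
Require Import Defs.
From HB Require Import structures.
From Stdlib Require Import Relation_Operators Operators_Properties Setoid.
From Stdlib Require Import Classical ClassicalEpsilon FunctionalExtensionality.
From mathcomp Require Import all_boot zify.

(* From machines to formulas: a configuration is rejected iff it lies in a set Y
   such that every successor of an existential member of Y is in Y, and every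
   universal member of Y has a computation path through universal configurations
   of Y to an existential one in Y.  The path is witnessed by a rank that decreases
   along it, so no computation has to be coded: one function f: Sigma* -> Sigma*,
   giving each configuration of Y a nonempty rank, is enough, and "w is rejected"
   becomes a first-order property of some f.

   From formulas to machines: "some f refutes phi" says that there is a function G
   giving f together with the truth values and the witnesses of all subformulas of
   phi in all environments, subject to local conditions, each of which concerns
   finitely many values of G.  The machine plays a game in which the existential
   player asks for the value of G at a key and the universal player answers; the
   existential player wins by exhibiting a violated local condition in the record
   of the play.  If G exists, answering according to it never loses; otherwise
   asking for all keys in turn wins, since an infinite play would define G.  A
   universal player who never finishes writing an answer does no harm, by the
   definition of global acceptance.  A violated condition is the occurrence in the
   record of an instance of one of finitely many lists of patterns, and this can be
   checked with two pointers into the tape. *)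

(** The first direction is shaped by how little arithmetic the vocabulary offers: on powers of one
    letter, concatenation gives addition and multiplication by constants, but no pairing. So [f]
    itself must supply, besides the ranks, the triangular numbers for Cantor pairing and the numeral
    of the input. A finite rank is enough because a universal configuration is rejected only through
    a finite universal path.

    In the second direction a violated condition has to be recognized positively, by occurrences in
    the record, so even the inequality of two words must be expressed by finitely many patterns.
    Nothing forces the universal player to answer a repeated key consistently; this does no harm,
    since [G] is read off from one designated stage for each key. Sweeping machines shield the
    constructions from the global definition: no universal sweep directly follows another, so a
    universal phase contains at most one of them, and a sweep that never ends has no result. *)

Set Implicit Arguments.
Unset Strict Implicit.
Unset Printing Implicit Defensive.

(** * One-step unfolding of acceptance *)

Section Acceptance.

Variables (Sigma : finType) (M : ATM Sigma).
Implicit Types c : config M.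

Lemma existentialN c : existential c = ~~ universal c.
Proof. by rewrite /existential /universal; case: (cstate c). Qed.

(** A nonempty existential phase splits off its first step; if that step reaches a universal
    configuration, the phase ends there. Conversely, a step either extends a phase or is one by
    itself. *)
Lemma accepted_E c : existential c ->
  accepted c <-> exists2 c', yield c c' & accepted c'.
Proof.
move=> Ec; split=> [acc_c | [c' c_c' acc_c']]; last first.
  have [Ec'|] := boolP (existential c').
    case: acc_c' Ec' c_c' => [c0 c1 _ [p Uc1] acc_c1|c0 U0 _] Ec0 c_c0; last first.
      by move: Ec0; rewrite existentialN U0.
    by apply: (AccE Ec _ acc_c1); split=> //; apply: rt_trans p; apply: rt_step.
  rewrite existentialN negbK => Uc'.
  by apply: (AccE Ec _ acc_c'); split=> //; apply: rt_step.
case: acc_c Ec => [c0 c1 _ [p Uc1] acc_c1|c0 U0 _] Ec0; last first.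
  by move: Ec0; rewrite existentialN U0.
have {}p := clos_rt_rt1n _ _ _ _ p.
case: p Uc1 acc_c1 => [|c2 c3 [c0_c2 _] p] Uc3 acc_c3.
  by move: Ec0; rewrite existentialN Uc3.
exists c2 => //; have [Ec2|] := boolP (existential c2).
  by apply: (AccE Ec2 _ acc_c3); split=> //; apply: clos_rt1n_rt.
rewrite existentialN negbK => Uc2; case: p Uc3 acc_c3 => // x y [_].
by rewrite existentialN Uc2.
Qed.

(** With [accepted_E] this makes [accepted] a fixpoint of the one-step rules, though not the least
    one: a configuration from which all runs stay universal forever is accepted. *)
Lemma accepted_U c : universal c ->
  accepted c <-> forall c', yield c c' -> accepted c'.
Proof.
move=> Uc; split=> [acc_c c' c_c' | acc_succ]; last first.
  apply: AccU => // c' [p Ec']; have {}p := clos_rt_rt1n _ _ _ _ p.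
  case: p Ec' => [|c1 c2 [c_c1 _] p] Ec2; first by rewrite existentialN Uc in Ec2.
  have acc_c1 := acc_succ _ c_c1.
  have [Ec1|] := boolP (existential c1).
    case: p Ec2 => // x y [_ Uc1].
    by move: Ec1; rewrite existentialN Uc1.
  rewrite existentialN negbK => Uc1.
  case: acc_c1 Uc1 p {c_c1} => [c0 c3 Ec0 _ _|c0 _ acc0] Uc0 p.
    by move: Ec0; rewrite existentialN Uc0.
  by apply: acc0; split=> //; apply: clos_rt1n_rt.
case: acc_c Uc c_c' => [c0 c1 Ec0 _ _|c0 _ acc0] Uc c_c'.
  by move: Ec0; rewrite existentialN Uc.
have [Ec'|] := boolP (existential c').
  by apply: acc0; split=> //; apply: rt_step.
rewrite existentialN negbK => Uc'; apply: AccU => // c1 [p Ec1].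
by apply: acc0; split=> //; apply: rt_trans p; apply: rt_step.
Qed.

End Acceptance.

(** * Derived first-order syntax *)

Section Syntax.

Variable Sigma : finType.
Implicit Types (f : seq Sigma -> seq Sigma).

Lemma extend0 n x (e : 'I_n -> seq Sigma) : extend x e ord0 = x.
Proof. by rewrite /extend unlift_none. Qed.

Lemma extendS n x (e : 'I_n -> seq Sigma) i : extend x e (lift ord0 i) = e i.
Proof. by rewrite /extend liftK. Qed.

Fixpoint tshift n (t : term Sigma n) : term Sigma n.+1 :=
  match t with
  | TVar i => TVar Sigma (lift ord0 i)
  | TEmpty => TEmpty
  | TLetter a => TLetter _ a
  | TCat t1 t2 => TCat (tshift t1) (tshift t2)
  | TFun t1 => TFun (tshift t1)
  end.

Lemma eval_tshift f n (e : 'I_n -> seq Sigma) x t :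
  eval f (extend x e) (tshift t) = eval f e t.
Proof.
elim: t => //= [i|t1 -> t2 -> //|t ->//]; exact: extendS.
Qed.

Lemma evalC f n (e : 'I_n -> seq Sigma) t1 t2 :
  eval f e (TCat t1 t2) = eval f e t1 ++ eval f e t2.
Proof. by []. Qed.

Lemma evalF f n (e : 'I_n -> seq Sigma) t : eval f e (TFun t) = f (eval f e t).
Proof. by []. Qed.

Lemma evalL f n (e : 'I_n -> seq Sigma) b : eval f e (TLetter n b) = [:: b].
Proof. by []. Qed.

Lemma eval_nil f n (e : 'I_n -> seq Sigma) : eval f e TEmpty = [::].
Proof. by []. Qed.

Lemma holds_eq f n t1 t2 (e : 'I_n -> seq Sigma) :
  holds f (FEq t1 t2) e = (eval f e t1 = eval f e t2).
Proof. by []. Qed.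

Lemma holds_and f n p1 p2 (e : 'I_n -> seq Sigma) :
  holds f (FAnd p1 p2) e = (holds f p1 e /\ holds f p2 e).
Proof. by []. Qed.

Lemma holds_or f n p1 p2 (e : 'I_n -> seq Sigma) :
  holds f (FOr p1 p2) e = (holds f p1 e \/ holds f p2 e).
Proof. by []. Qed.

Lemma holds_imp f n p1 p2 (e : 'I_n -> seq Sigma) :
  holds f (FImp p1 p2) e = (holds f p1 e -> holds f p2 e).
Proof. by []. Qed.

Lemma holds_all f n (p : formula Sigma n.+1) e :
  holds f (FForall p) e = (forall x, holds f p (extend x e)).
Proof. by []. Qed.

Lemma holds_ex f n (p : formula Sigma n.+1) e :
  holds f (FExists p) e = (exists x, holds f p (extend x e)).
Proof. by []. Qed.

Definition evalE := (evalC, evalF, evalL, eval_nil, eval_tshift).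

Definition holdsE := (holds_eq, holds_and, holds_or, holds_imp).

Definition t0 n : term Sigma n.+1 := TVar Sigma ord0.

Lemma eval_t0 f n (e : 'I_n -> seq Sigma) x : eval f (extend x e) (t0 n) = x.
Proof. exact: extend0. Qed.

Definition FTrue n : formula Sigma n := FNot FFalse.

Definition FBool n (b : bool) : formula Sigma n := if b then FTrue n else FFalse.

Definition FAll_fin (T : finType) n (F : T -> formula Sigma n) :=
  foldr (fun x => FAnd (F x)) (FTrue n) (enum T).

Definition FEx_fin (T : finType) n (F : T -> formula Sigma n) :=
  foldr (fun x => FOr (F x)) FFalse (enum T).

Lemma holds_bool f n b (e : 'I_n -> seq Sigma) : holds f (FBool n b) e <-> b.
Proof. by case: b => /=; split=> // _ []. Qed.

Lemma holds_all_fin f (T : finType) n (F : T -> formula Sigma n) e :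
  holds f (FAll_fin F) e <-> forall x, holds f (F x) e.
Proof.
rewrite /FAll_fin.
have -> : (forall x, holds f (F x) e) <->
          (forall x, x \in enum T -> holds f (F x) e).
  by split=> H x; [move=> _|]; apply: H; rewrite ?mem_enum.
elim: (enum T) => [|x s IH] /=; first by split=> // _ [].
rewrite IH; split=> [[Hx Hs] y|H].
  by rewrite inE => /orP[/eqP->|/Hs].
by split=> [|y ys]; apply: H; rewrite inE ?eqxx ?ys ?orbT.
Qed.

Lemma holds_ex_fin f (T : finType) n (F : T -> formula Sigma n) e :
  holds f (FEx_fin F) e <-> exists x, holds f (F x) e.
Proof.
rewrite /FEx_fin.
have -> : (exists x, holds f (F x) e) <->
          (exists2 x, x \in enum T & holds f (F x) e).
  by split=> [[x]|[x _]]; exists x; rewrite ?mem_enum.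
elim: (enum T) => [|x s IH] /=; first by split=> // -[].
rewrite IH; split=> [[Hx|[y ys Hy]]|[y]].
- by exists x; rewrite ?mem_head.
- by exists y; rewrite // inE ys orbT.
by rewrite inE => /orP[/eqP->|ys]; [left|right; exists y].
Qed.

(** * Natural numbers as powers of one letter *)

Section Unary.

Variable a : Sigma.

Definition unary k : seq Sigma := nseq k a.

(** Being a power of [a] is thus an equation between terms, which lets quantifiers be relativized to
    numbers. *)
Lemma unaryP x : [:: a] ++ x = x ++ [:: a] <-> x = unary (size x).
Proof.
split=> [|->]; last by rewrite -[[:: a]]/(nseq 1 a) /unary -!nseqD addnC.
elim: x => //= b x IH [<- /IH] e; congr (_ :: _); exact: e.
Qed.

Lemma unary_inj : injective unary.
Proof. by move=> m k /(congr1 size); rewrite !size_nseq. Qed.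

Lemma unaryD m k : unary (m + k) = unary m ++ unary k.
Proof. exact: nseqD. Qed.

(* Opaque, lest unification unfold these terms into concatenations. *)
Lemma tunary_subproof n k :
  {t : term Sigma n | forall f e, eval f e t = unary k}.
Proof.
by exists (iter k (TCat (TLetter n a)) TEmpty) => f e; elim: k => //= k ->.
Qed.

Lemma trep_subproof n k (t : term Sigma n) :
  {t' : term Sigma n | forall f e, eval f e t' = flatten (nseq k (eval f e t))}.
Proof. by exists (iter k (TCat t) TEmpty) => f e; elim: k => //= k ->. Qed.

Definition tunary n k := sval (tunary_subproof n k).

Definition trep n k (t : term Sigma n) := sval (trep_subproof k t).

Lemma eval_tunary f n (e : 'I_n -> seq Sigma) k : eval f e (tunary n k) = unary k.
Proof. exact: (svalP (tunary_subproof n k)). Qed.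

Lemma eval_trep f n (e : 'I_n -> seq Sigma) k t :
  eval f e (trep k t) = flatten (nseq k (eval f e t)).
Proof. exact: (svalP (trep_subproof k t)). Qed.

Lemma flatten_unary k m : flatten (nseq k (unary m)) = unary (k * m).
Proof. by elim: k => //= k ->; rewrite -unaryD mulSn. Qed.

Lemma eval_trepU f n (e : 'I_n -> seq Sigma) k t m :
  eval f e t = unary m -> eval f e (trep k t) = unary (k * m).
Proof. by move=> et; rewrite eval_trep et flatten_unary. Qed.

Definition Funary n (t : term Sigma n) :=
  FEq (TCat (TLetter n a) t) (TCat t (TLetter n a)).

Definition FAllU n (F : formula Sigma n.+1) := FForall (FImp (Funary (t0 n)) F).

Definition FExU n (F : formula Sigma n.+1) := FExists (FAnd (Funary (t0 n)) F).

Lemma holds_allU f n (F : formula Sigma n.+1) e :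
  holds f (FAllU F) e <-> forall k, holds f F (extend (unary k) e).
Proof.
rewrite /=; setoid_rewrite extend0; split=> H k; first by apply/H/unaryP; rewrite size_nseq.
by move/unaryP->.
Qed.

Lemma holds_exU f n (F : formula Sigma n.+1) e :
  holds f (FExU F) e <-> exists k, holds f F (extend (unary k) e).
Proof.
rewrite /=; setoid_rewrite extend0; split=> [[x [/unaryP-> H]]|[k H]].
  by exists (size x).
by exists (unary k); split=> //; apply/unaryP; rewrite size_nseq.
Qed.

End Unary.

End Syntax.

(** * Machines to formulas *)

(** Given by its recurrence, which needs only addition and can therefore be imposed on [f] by a
    formula. *)
Fixpoint triangle k := if k is k'.+1 then triangle k' + k'.+1 else 0.

Definition cantor x y := triangle (x + y) + y.

Lemma triangleS k : triangle k.+1 = triangle k + k.+1. Proof. by []. Qed.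

Lemma cantor_inj x y x' y' : cantor x y = cantor x' y' -> x = x' /\ y = y'.
Proof.
(* The codes of the pairs with sum [m] all lie below [triangle k], so a code determines the sum. *)
have tri_lt m k : m < k -> triangle m + m < triangle k.
  elim: k => // k IH; rewrite ltnS leq_eqVlt triangleS => /orP[/eqP->|/IH]; lia.
rewrite /cantor; case: (ltngtP (x + y) (x' + y')) => [/tri_lt|/tri_lt|e]; try lia.
by rewrite e; lia.
Qed.

Section MachineToFormula.

Variables (Sigma : finType) (a : Sigma) (M : ATM Sigma).

Notation G := (alphabet M).
Notation Q := (exist_state M + univ_state M)%type.
Implicit Types (q : Q) (g : G) (u v : seq G) (c : config M).

Notation U := (unary a).

(** Digits start at 1: without a zero digit, [numeral] is injective on words of all lengths and 0
    stands for the empty word only. *)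
Definition base := #|G|.+1.
Definition digit g := (enum_rank g).+1.

Definition numeral v := foldr (fun g k => digit g + base * k) 0 v.

Lemma digit_lt g : digit g < base.
Proof. by rewrite /base /digit ltnS. Qed.

Lemma digit_inj g g' x x' :
  digit g + base * x = digit g' + base * x' -> g = g' /\ x = x'.
Proof.
move=> e; have e1 := congr1 (modn^~ base) e; have e2 := congr1 (divn^~ base) e.
move: e1 e2; rewrite /= ![digit _ + _]addnC ![base * _]mulnC.
rewrite !modnMDl !divnMDl // !modn_small ?digit_lt // !divn_small ?digit_lt //.
by rewrite !addn0 => -[/ord_inj/enum_rank_inj].
Qed.

Lemma numeral_inj : injective numeral.
Proof.
elim=> [|g v IH] [|g' v'] //=; try by rewrite /digit addSn.
by move/digit_inj => [-> /IH->].
Qed.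

Definition nstates := #|{: Q * G}|.

Definition cell_index q g x y := nstates * cantor x y + enum_rank (q, g).

Lemma cell_index_inj q g x y q' g' x' y' :
  cell_index q g x y = cell_index q' g' x' y' -> (q, g, x, y) = (q', g', x', y').
Proof.
rewrite /cell_index => e.
have Npos : 0 < nstates by apply: leq_ltn_trans (ltn_ord (enum_rank (q, g))).
have e1 := congr1 (modn^~ nstates) e; have e2 := congr1 (divn^~ nstates) e.
move: e1 e2; rewrite /= ![nstates * _]mulnC.
rewrite !modnMDl !divnMDl // !modn_small ?ltn_ord // !divn_small ?ltn_ord //.
by rewrite !addn0 => /ord_inj/enum_rank_inj[-> ->] /cantor_inj[-> ->].
Qed.

Definition nstep q g x y q' g' x' y' : Prop :=
  [\/ delta ((q, g), (Write g', q')) /\ (x' = x /\ y' = y),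
      delta ((q, g), (Forward, q')) /\ (x' = digit g + base * x /\
        ((y = 0 /\ g' = blank M /\ y' = 0) \/ y = digit g' + base * y')) |
      delta ((q, g), (Backward, q')) /\
        ((x = 0 /\ g' = g /\ x' = 0 /\ y' = y) \/
         (x = digit g' + base * x' /\ y' = digit g + base * y))].

Definition is_exist q : bool := if q is inl _ then true else false.

(** The left half is reversed so that the cell next to the head is the lowest digit on both
    sides. *)
Definition cnum c : nat * nat := (numeral (rev (cleft c)), numeral (cright c)).

Lemma yield_nstep c c' : yield c c' ->
  nstep (cstate c) (cscanned c) (cnum c).1 (cnum c).2
        (cstate c') (cscanned c') (cnum c').1 (cnum c').2.
Proof.
case=> *; rewrite /cnum /= ?rev_rcons /=.
- by constructor 2; split=> //; split=> //; right.
- by constructor 2; split=> //; split=> //; left.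
- by constructor 3; split=> //; right.
- by constructor 3; split=> //; left.
- by constructor 1.
Qed.

(** Numbers that are not numerals need not be excluded by a formula: a numerical step out of a coded
    configuration ends in a coded one. *)
Lemma nstep_yield c q g x y :
  nstep (cstate c) (cscanned c) (cnum c).1 (cnum c).2 q g x y ->
  exists2 c', yield c c' &
    [/\ cstate c' = q, cscanned c' = g & cnum c' = (x, y)].
Proof.
case: c => q0 u g0 v; rewrite /cnum /= => -[].
- move=> [d [-> ->]]; exists (Config q u g v); [exact: YWrite | by []].
- move=> [d [-> [[v0 [-> ->]]|]]].
    have -> : v = [::] by apply: numeral_inj.
    exists (Config q (rcons u g0) (blank M) [::]); first exact: YForwardEnd.
    by rewrite /cnum /= rev_rcons.
  case: v => [|t v] /=; first by rewrite /digit addSn.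
  move=> /digit_inj[-> <-]; exists (Config q (rcons u g0) g v); first exact: YForward.
  by rewrite /cnum /= rev_rcons.
- move=> [d [[u0 [-> [-> ->]]]|]].
    have -> : u = [::] by rewrite -[u]revK (_ : rev u = [::]) //; apply: numeral_inj.
    by exists (Config q [::] g0 v); first exact: YBackwardEnd.
  case/lastP: u => [|u t] /=; first by rewrite /digit addSn => -[].
  rewrite rev_rcons /= => -[/digit_inj[-> <-] ->].
  by exists (Config q u g (g0 :: v)); first exact: YBackward.
Qed.

(* The layout of the function [f]: it sends [x x] to the numeral of [x], the
   unary numbers congruent to 1 mod 4 to triangular numbers, and those congruent
   to 3 mod 4, which code the cells, to ranks; a rank is nonempty exactly for
   cells of rejected configurations. *)
Definition coding (f : seq Sigma -> seq Sigma) : Prop :=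
  [/\ f [::] = [::],
      forall b x, f ((b :: x) ++ (b :: x)) =
        U (digit (glyph M (Some b))) ++ flatten (nseq base (f (x ++ x))),
      f (U 1) = [::] &
      forall k, f (U (4 * k.+1 + 1)) = f (U (4 * k + 1)) ++ U k.+1].

Definition rank_at (f : seq Sigma -> seq Sigma) q g x y :=
  f (U (4 * cell_index q g x y + 3)).

Definition rejection (f : seq Sigma -> seq Sigma) (w : seq Sigma) : Prop :=
  [/\ forall q g x y q' g' x' y', is_exist q -> nstep q g x y q' g' x' y' ->
        rank_at f q g x y <> [::] -> rank_at f q' g' x' y' <> [::],
      forall q g x y, ~~ is_exist q -> rank_at f q g x y <> [::] ->
        exists q' g' x' y', [/\ nstep q g x y q' g' x' y',
          rank_at f q' g' x' y' <> [::] &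
          is_exist q' \/ exists2 d, d <> [::] &
            rank_at f q g x y = rank_at f q' g' x' y' ++ d] &
      rank_at f (start M) (blank M) 0
        (numeral [seq glyph M (Some b) | b <- w]) <> [::]].

Lemma coding_numeral f w : coding f ->
  f (w ++ w) = U (numeral [seq glyph M (Some b) | b <- w]).
Proof.
case=> f0 fS _ _; elim: w => [|b w IH]; first exact: f0.
by rewrite /= fS IH unaryD flatten_unary.
Qed.

Lemma coding_triangle f k : coding f -> f (U (4 * k + 1)) = U (triangle k).
Proof.
by case=> _ _ f1 fS; elim: k => [|k IH]; [exact: f1|rewrite fS IH -unaryD].
Qed.

(** * Terms and formulas for one step of the machine *)

Section Formula.

Variables (n : nat).
Implicit Types (X Y : term Sigma n).

Definition tpush g X := TCat (tunary a n (digit g)) (trep base X).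

(** The inner application of [f] fetches the triangular number of the Cantor pairing, the outer one
    the rank. *)
Definition trank q g X Y : term Sigma n :=
  TFun (TCat (trep 4 (TCat (trep nstates
    (TCat (TFun (TCat (trep 4 (TCat X Y)) (tunary a n 1))) Y))
    (tunary a n (enum_rank (q, g))))) (tunary a n 3)).

Definition Fstep q g X Y q' g' X' Y' : formula Sigma n :=
  FOr (FAnd (FBool _ n (delta ((q, g), (Write g', q'))))
            (FAnd (FEq X' X) (FEq Y' Y)))
 (FOr (FAnd (FBool _ n (delta ((q, g), (Forward, q'))))
        (FAnd (FEq X' (tpush g X))
          (FOr (FAnd (FEq Y TEmpty)
                 (FAnd (FBool _ n (g' == blank M)) (FEq Y' TEmpty)))
               (FEq Y (tpush g' Y')))))
      (FAnd (FBool _ n (delta ((q, g), (Backward, q'))))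
          (FOr (FAnd (FEq X TEmpty)
                 (FAnd (FBool _ n (g' == g)) (FAnd (FEq X' TEmpty) (FEq Y' Y))))
               (FAnd (FEq X (tpush g' X')) (FEq Y' (tpush g Y)))))).

Variables (f : seq Sigma -> seq Sigma) (e : 'I_n -> seq Sigma).
Hypothesis f_coding : coding f.

Lemma eval_tpush g X x : eval f e X = U x ->
  eval f e (tpush g X) = U (digit g + base * x).
Proof.
by move=> ex; rewrite evalE eval_tunary (eval_trepU _ ex) -unaryD.
Qed.

Lemma eval_trank q g X Y x y : eval f e X = U x -> eval f e Y = U y ->
  eval f e (trank q g X Y) = rank_at f q g x y.
Proof.
move=> ex ey; have exy : eval f e (TCat X Y) = U (x + y).
  by rewrite evalE ex ey -unaryD.
set T := TFun (TCat (trep 4 (TCat X Y)) (tunary a n 1)).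
have eT : eval f e (TCat T Y) = U (cantor x y).
  by rewrite !evalE eval_tunary (eval_trepU _ exy) -unaryD coding_triangle // ey -unaryD.
set T2 := TCat (trep nstates (TCat T Y)) (tunary a n (enum_rank (q, g))).
have eT2 : eval f e T2 = U (cell_index q g x y).
  by rewrite !evalE (eval_trepU _ eT) eval_tunary -unaryD.
by rewrite !evalE (eval_trepU 4 eT2) eval_tunary -unaryD.
Qed.

Lemma eqU x y : (U x = U y) <-> (x = y).
Proof. by split=> [/unary_inj|->]. Qed.

Lemma holds_step q g X Y q' g' X' Y' x y x' y' :
  eval f e X = U x -> eval f e Y = U y ->
  eval f e X' = U x' -> eval f e Y' = U y' ->
  holds f (Fstep q g X Y q' g' X' Y') e <-> nstep q g x y q' g' x' y'.
Proof.
move=> ex ey ex' ey'; rewrite /Fstep.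
set p1 := tpush g X; set p2 := tpush g' Y'; set p3 := tpush g' X'; set p4 := tpush g Y.
have e1 : eval f e p1 = _ := eval_tpush g ex.
have e2 : eval f e p2 = _ := eval_tpush g' ey'.
have e3 : eval f e p3 = _ := eval_tpush g' ex'.
have e4 : eval f e p4 = _ := eval_tpush g ey.
rewrite !holdsE eval_nil e1 e2 e3 e4 ex ey ex' ey' !holds_bool -[[::]]/(U 0) !eqU.
split.
  case=> [?|[[d [ex1 [[? [/eqP? ?]]|?]]]|[d [[? [/eqP? ?]]|?]]]].
  - by constructor 1.
  - by constructor 2; split=> //; split=> //; left.
  - by constructor 2; split=> //; split=> //; right.
  - by constructor 3; split=> //; left.
  - by constructor 3; split=> //; right.
case=> [?|[d [ex1 [[? [/eqP? ?]]|?]]]|[d [[? [/eqP? ?]]|?]]]; first by left.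
- by right; left; split=> //; split=> //; left.
- by right; left; split=> //; split=> //; right.
- by right; right; split=> //; left.
- by right; right; split=> //; right.
Qed.

End Formula.

Definition Fne n (t1 t2 : term Sigma n) := FNot (FEq t1 t2).

Definition Fcoding n : formula Sigma n :=
  FAnd (FEq (TFun TEmpty) TEmpty)
 (FAnd (FAll_fin (fun b : Sigma =>
          let bx := TCat (TLetter n.+1 b) (t0 Sigma n) in
          FForall (FEq (TFun (TCat bx bx))
            (TCat (tunary a _ (digit (glyph M (Some b))))
                  (trep base (TFun (TCat (t0 Sigma n) (t0 Sigma n))))))))
 (FAnd (FEq (TFun (tunary a n 1)) TEmpty)
       (FAllU a (let x := t0 Sigma n in let Sx := TCat x (tunary a _ 1) in
          FEq (TFun (TCat (trep 4 Sx) (tunary a _ 1)))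
              (TCat (TFun (TCat (trep 4 x) (tunary a _ 1))) Sx))))).

Lemma holds_coding f n e : holds f (Fcoding n) e <-> coding f.
Proof.
rewrite /Fcoding !holdsE holds_all_fin.
have eS k (e' := extend (U k) e) :
    eval f e' (TCat (t0 Sigma n) (tunary a n.+1 1)) = U k.+1.
  by rewrite evalE eval_t0 eval_tunary -[in RHS]addn1 unaryD.
have e0 k : eval f (extend (U k) e) (t0 Sigma n) = U k by rewrite eval_t0.
split.
  move=> [H1 [H2 [H3 H4]]]; split=> // [b x||k].
  - move: (H2 b); cbv zeta; rewrite holds_all => /(_ x).
    by rewrite holds_eq !evalE eval_tunary eval_trep !evalE !eval_t0.
  - by move: H3; rewrite !evalE eval_tunary.
  move/(holds_allU a f _ e): H4 => /(_ k); cbv zeta; rewrite holds_eq.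
  by rewrite !evalE !eval_tunary !(eval_trepU 4 (eS k)) !(eval_trepU 4 (e0 k)) !eval_t0
    -!unaryD (addn1 k).
move=> [H1 H2 H3 H4]; split=> //; split; last split.
- move=> b; cbv zeta; rewrite holds_all => x.
  rewrite holds_eq !evalE eval_tunary eval_trep !evalE !eval_t0; exact: H2.
- by rewrite !evalE eval_tunary.
apply/(holds_allU a f _ e) => k; cbv zeta; rewrite holds_eq.
by rewrite !evalE !eval_tunary !(eval_trepU 4 (eS k)) !(eval_trepU 4 (e0 k)) !eval_t0
    -!unaryD (addn1 k).
Qed.

Lemma forall_iff T (P P' : T -> Prop) :
  (forall x, P x <-> P' x) -> (forall x, P x) <-> (forall x, P' x).
Proof. by move=> eP; split=> H x; apply/eP/H. Qed.

Lemma exists_iff T (P P' : T -> Prop) :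
  (forall x, P x <-> P' x) -> (exists x, P x) <-> (exists x, P' x).
Proof. by move=> eP; split=> -[x /eP H]; exists x. Qed.

Lemma imp_iff (A B C D : Prop) : (A <-> B) -> (C <-> D) -> (A -> C) <-> (B -> D).
Proof. by tauto. Qed.

Lemma and3_iff (A A' B B' C C' : Prop) : (A <-> A') -> (B <-> B') -> (C <-> C') ->
  (A /\ B /\ C) <-> [/\ A', B' & C'].
Proof. by move=> -> -> ->; split=> [[? []]|[]]. Qed.

Lemma ex2_iff T (P P' Q' : T -> Prop) : (forall x, P x <-> P' x /\ Q' x) ->
  (exists x, P x) <-> exists2 x, P' x & Q' x.
Proof. by move=> eP; split=> [[x /eP[]]|[x ? ?]]; exists x => //; apply/eP. Qed.

Lemma holds_ne f n (t1 t2 : term Sigma n) e :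
  holds f (Fne t1 t2) e = (eval f e t1 <> eval f e t2).
Proof. by []. Qed.

Lemma holds_rank_ne f n (e : 'I_n -> seq Sigma) q g X Y x y : coding f ->
  eval f e X = U x -> eval f e Y = U y ->
  holds f (Fne (trank q g X Y) TEmpty) e <-> rank_at f q g x y <> [::].
Proof. by move=> cf eX eY; rewrite holds_ne (eval_trank cf _ _ eX eY). Qed.

(** The numbers x, y, x', y' are bound in this order; each is [t0] in the context where it is
    introduced, shifted once per later quantifier. *)
Definition Fexist_rejected : formula Sigma 1 :=
  FAll_fin (fun q : Q => FAll_fin (fun g : G => FAllU a (FAllU a
    (FAll_fin (fun q' : Q => FAll_fin (fun g' : G => FAllU a (FAllU a
      (FImp (FBool _ _ (is_exist q))
      (FImp (Fstep q g (tshift (tshift (tshift (t0 _ 1)))) (tshift (tshift (t0 _ 2)))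
                   q' g' (tshift (t0 _ 3)) (t0 _ 4))
      (FImp (Fne (trank q g (tshift (tshift (tshift (t0 _ 1)))) (tshift (tshift (t0 _ 2))))
                 TEmpty)
            (Fne (trank q' g' (tshift (t0 _ 3)) (t0 _ 4)) TEmpty))))))))))).

Definition Funiv_rejected : formula Sigma 1 :=
  FAll_fin (fun q : Q => FAll_fin (fun g : G => FAllU a (FAllU a
    (FImp (FBool _ _ (~~ is_exist q))
    (FImp (Fne (trank q g (tshift (t0 _ 1)) (t0 _ 2)) TEmpty)
    (FEx_fin (fun q' : Q => FEx_fin (fun g' : G => FExU a (FExU a
      (FAnd (Fstep q g (tshift (tshift (tshift (t0 _ 1)))) (tshift (tshift (t0 _ 2)))
                   q' g' (tshift (t0 _ 3)) (t0 _ 4))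
      (FAnd (Fne (trank q' g' (tshift (t0 _ 3)) (t0 _ 4)) TEmpty)
      (FOr (FBool _ _ (is_exist q'))
        (FExists (FAnd (Fne (t0 _ 5) TEmpty)
          (FEq (tshift (trank q g (tshift (tshift (tshift (t0 _ 1))))
                                  (tshift (tshift (t0 _ 2)))))
               (TCat (tshift (trank q' g' (tshift (t0 _ 3)) (t0 _ 4))) (t0 _ 5))))))))))))))))).

Definition Frejection : formula Sigma 1 :=
  FAnd Fexist_rejected (FAnd Funiv_rejected
    (Fne (trank (start M) (blank M) TEmpty (TFun (TCat (t0 _ 0) (t0 _ 0)))) TEmpty)).

Lemma holds_rejection f w : coding f ->
  holds f Frejection (fun=> w) <-> rejection f w.
Proof.
move=> cf; set e : 'I_1 -> _ := fun=> w.
rewrite !holdsE holds_ne (@eval_trank _ _ _ cf _ _ _ _ 0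
  (numeral [seq glyph M (Some b) | b <- w])) //; last first.
  by rewrite !evalE coding_numeral.
rewrite /rejection eval_nil.
suff [-> ->] : (holds f Fexist_rejected e <->
    forall q g x y q' g' x' y', is_exist q -> nstep q g x y q' g' x' y' ->
        rank_at f q g x y <> [::] -> rank_at f q' g' x' y' <> [::]) /\
  (holds f Funiv_rejected e <->
    forall q g x y, ~~ is_exist q -> rank_at f q g x y <> [::] ->
        exists q' g' x' y', [/\ nstep q g x y q' g' x' y',
          rank_at f q' g' x' y' <> [::] &
          is_exist q' \/ exists2 d, d <> [::] &
            rank_at f q g x y = rank_at f q' g' x' y' ++ d]).
  by split=> [[? []]|[]].
split.
  rewrite /Fexist_rejected; do 2 (rewrite holds_all_fin; apply: forall_iff=> ?).
  do 2 (rewrite holds_allU; apply: forall_iff=> ?).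
  do 2 (rewrite holds_all_fin; apply: forall_iff=> ?).
  do 2 (rewrite holds_allU; apply: forall_iff=> ?).
  rewrite !holdsE holds_bool.
  apply: imp_iff => //; apply: imp_iff.
    by apply: holds_step; rewrite !(eval_tshift, eval_t0).
  by apply: imp_iff; apply: (@holds_rank_ne _ _ _ _ _ _ _ _ _ cf); rewrite !(eval_tshift, eval_t0).
rewrite /Funiv_rejected; rewrite holds_all_fin; apply: forall_iff=> q.
rewrite holds_all_fin; apply: forall_iff=> g.
rewrite holds_allU; apply: forall_iff=> x; rewrite holds_allU; apply: forall_iff=> y.
rewrite !holdsE holds_bool.
apply: imp_iff => //; apply: imp_iff.
  by apply: (@holds_rank_ne _ _ _ _ _ _ _ _ _ cf); rewrite !(eval_tshift, eval_t0).
rewrite holds_ex_fin; apply: exists_iff=> q'.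
rewrite holds_ex_fin; apply: exists_iff=> g'.
rewrite holds_exU; apply: exists_iff=> x'; rewrite holds_exU; apply: exists_iff=> y'.
rewrite holds_and holds_and holds_or holds_bool holds_ex.
apply: and3_iff.
- by apply: holds_step; rewrite !(eval_tshift, eval_t0).
- by apply: (@holds_rank_ne _ _ _ _ _ _ _ _ _ cf); rewrite !(eval_tshift, eval_t0).
apply: or_iff_compat_l; apply: ex2_iff => d.
rewrite !holdsE holds_ne evalC eval_nil eval_t0 !eval_tshift.
by rewrite (@eval_trank _ _ _ cf q g _ _ x y) ?(@eval_trank _ _ _ cf q' g' _ _ x' y')
  // !(eval_tshift, eval_t0).
Qed.

Definition cell_of c : nat :=
  cell_index (cstate c) (cscanned c) (cnum c).1 (cnum c).2.

Definition rank_of (f : seq Sigma -> seq Sigma) c := f (U (4 * cell_of c + 3)).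

Lemma cell_of_inj : injective cell_of.
Proof.
move=> [q u g v] [q' u' g' v'] /cell_index_inj[-> ->].
by move=> /numeral_inj/(congr1 rev) + /numeral_inj->; rewrite !revK => ->.
Qed.

(** By induction on acceptance. A nonempty rank would propagate forward along an existential phase;
    from a universal configuration, decreasing ranks lead to an existential one of nonempty rank. *)
Lemma rejection_rank f w c : rejection f w -> accepted c -> rank_of f c = [::].
Proof.
move=> [rejE rejU _]; elim=> {c} [c c' _ [p _] _ /eqP rc'|c Uc _ IH]; apply/eqP.
  move: rc'; have {}p := clos_rt_rt1n _ _ _ _ p.
  elim: p => // c1 c2 c3 [c1_c2 Ec1] _ IH /IH; apply: contraTT => /eqP rc1.
  by apply/eqP; apply: rejE rc1; [exact: Ec1 | exact: yield_nstep].
apply/negPn/negP => rc.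
suff [c' [p rc']] : exists c', uphase c c' /\ rank_of f c' <> [::].
  by apply: rc'; apply: IH.
(* Induction on a bound for the length of the rank. *)
move: {2}(size _) (leqnn (size (rank_of f c))) => n.
elim: n c Uc rc {IH} => [|n IH] c Uc rc sz.
  by case: (rank_of f c) sz rc.
have nEc : ~~ is_exist (cstate c) by rewrite -[is_exist _]/(existential c) existentialN Uc.
have [q' [g' [x' [y' [st rc' fin]]]]] := rejU _ _ _ _ nEc (elimN eqP rc).
have [c' c_c' [eq' eg' ec']] := nstep_yield st.
have {}rc' : rank_of f c' <> [::] by rewrite /rank_of /cell_of eq' eg' ec'.
have [Ec'|] := boolP (existential c').
  by exists c'; split=> //; split=> //; apply: rt_step.
move=> nEc'; case: fin => [Eq'|[d d0 ed]].
  by rewrite -[existential _]/(is_exist _) eq' Eq' in nEc'.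
have Uc' : universal c' by move: nEc'; rewrite existentialN negbK.
have [||c2 [[p E2] r2]] := IH c' Uc'; first exact/eqP.
  have -> : rank_of f c' = rank_at f q' g' x' y'.
    by rewrite /rank_of /cell_of eq' eg' ec'.
  move: sz; rewrite -[rank_of f c]/(rank_at f _ _ _ _) ed size_cat.
  by case: d d0 {ed} => //= b d _; rewrite addnS ltnS; apply: leq_trans (leq_addr _ _).
exists c2; split=> //; split=> //; apply: rt_trans p; exact: rt_step.
Qed.

Inductive rejected_in : nat -> config M -> Prop :=
  | Rejected0 c : existential c -> ~ accepted c -> rejected_in 0 c
  | RejectedS n c c' : universal c -> yield c c' -> rejected_in n c' ->
      rejected_in n.+1 c.

(** If every universal phase from [c] ended in an accepted configuration, [AccU] would accept [c];
    the index is the length of a phase that does not. *)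
Lemma rejected_inP c : ~ accepted c <-> exists n, rejected_in n c.
Proof.
split=> [rej|[n]]; last first.
  elim: n c / => // n c c' Uc c_c' _ rej acc_c; apply: rej.
  by apply: (proj1 (accepted_U Uc)) c_c'.
have [Ec|] := boolP (existential c); first by exists 0; constructor.
rewrite existentialN negbK => Uc.
have [c' [p Ec'] rej'] : exists2 c', uphase c c' & ~ accepted c'.
  apply: NNPP => H; apply: rej; apply: AccU => // c' p.
  by apply: NNPP => rej; apply: H; exists c'.
have {}p := clos_rt_rt1n _ _ _ _ p.
elim: p Ec' rej' {rej Uc} => [c1 ? ?|c1 c2 c3 [st Uc1] _ IH Ec3 rej3].
  by exists 0; constructor.
by have [n rn] := IH Ec3 rej3; exists n.+1; apply: RejectedS rn.
Qed.

Definition rejected_inb c n : bool :=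
  if excluded_middle_informative (rejected_in n c) then true else false.

Lemma rejected_inbP c n : reflect (rejected_in n c) (rejected_inb c n).
Proof. by rewrite /rejected_inb; case: excluded_middle_informative; constructor. Qed.

(** The successor reserves 0 for accepted configurations; minimality of the index makes the rank
    drop along a shortest path. *)
Definition config_rank c : nat :=
  if excluded_middle_informative (exists n, rejected_inb c n) is left rej
  then (ex_minn rej).+1 else 0.

Lemma config_rank_gt0 c : (0 < config_rank c) <-> ~ accepted c.
Proof.
rewrite /config_rank rejected_inP; case: excluded_middle_informative => h; split=> //.
  by move=> _; have [n /rejected_inbP] := h; exists n.
by move=> [n /rejected_inbP rn]; case: h; exists n.
Qed.

Lemma config_rank_step c : universal c -> 0 < config_rank c ->
  exists2 c', yield c c' & 0 < config_rank c' < config_rank c.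
Proof.
rewrite [config_rank c]/config_rank; case: excluded_middle_informative => // h Uc _.
case: ex_minnP => n /rejected_inbP rn _ {h}.
case: n c / rn Uc => [c Ec _|n {}c c' _ st rn] Uc.
  by move: Ec; rewrite existentialN Uc.
exists c' => //; apply/andP; split.
  by apply/config_rank_gt0/rejected_inP; exists n.
rewrite /config_rank; case: excluded_middle_informative => // h.
by case: ex_minnP => k _ min_k; rewrite !ltnS; apply/min_k/rejected_inbP.
Qed.

Definition cell_rank j : nat :=
  if excluded_middle_informative (exists c, cell_of c = j) is left h
  then config_rank (proj1_sig (constructive_indefinite_description _ h)) else 0.

Lemma cell_rank_of c : cell_rank (cell_of c) = config_rank c.
Proof.
rewrite /cell_rank; case: excluded_middle_informative => [h|[]]; last by exists c.
by case: constructive_indefinite_description => c' /= /cell_of_inj->.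
Qed.

Lemma cell_rank_gt0 j : 0 < cell_rank j -> exists c, cell_of c = j.
Proof. by rewrite /cell_rank; case: excluded_middle_informative. Qed.

(** The uses of [f] cannot collide: a word of the form x x has even length, while triangular numbers
    and ranks sit at odd lengths. *)
Definition rejection_code (x : seq Sigma) : seq Sigma :=
  let k := size x in
  if ~~ odd k then U (numeral [seq glyph M (Some b) | b <- take k./2 x])
  else if k %% 4 == 1 then U (triangle (k %/ 4)) else U (cell_rank (k %/ 4)).

Lemma rejection_code_coding : coding rejection_code.
Proof.
have fxx x : rejection_code (x ++ x) = U (numeral [seq glyph M (Some b) | b <- x]).
  rewrite /rejection_code size_cat addnn odd_double doubleK take_size_cat //.
have f1 k : rejection_code (U (4 * k + 1)) = U (triangle k).
  rewrite /rejection_code size_nseq oddD oddM /= mulnC modnMDl divnMDl //=.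
  by rewrite addn0.
split=> [//|b x||k]; first by rewrite !fxx flatten_unary -unaryD.
  by rewrite -[1]/(4 * 0 + 1) f1.
by rewrite !f1 -unaryD.
Qed.

Lemma rejection_code_rank q g x y :
  rank_at rejection_code q g x y = U (cell_rank (cell_index q g x y)).
Proof.
rewrite /rank_at /rejection_code size_nseq oddD oddM /= mulnC modnMDl divnMDl //=.
by rewrite addn0.
Qed.

Lemma rejection_code_rejection w :
  ~ atm_language M w -> rejection rejection_code w.
Proof.
have U0 k : U k <> [::] <-> 0 < k by case: k; split.
(* Indices coding no configuration have rank 0 by default, so the conditions, stated for all
   numbers, only concern configurations. *)
have of_cell q g x y : 0 < cell_rank (cell_index q g x y) ->
    exists c, [/\ cstate c = q, cscanned c = g, (cnum c).1 = x & (cnum c).2 = y].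
  by move/cell_rank_gt0=> [c /cell_index_inj[<- <- <- <-]]; exists c.
move=> rej; split=> [q g x y q' g' x' y'|q g x y|]; rewrite ?rejection_code_rank !U0.
- move=> Eq st rk; have [c ec] := of_cell _ _ _ _ rk.
  case: ec Eq st rk => <- <- <- <- Eq /nstep_yield[c' c_c' [<- <- ec']].
  have [-> ->] : x' = (cnum c').1 /\ y' = (cnum c').2 by rewrite ec'.
  rewrite -!/(cell_of _) !cell_rank_of => /config_rank_gt0 rejc.
  apply/config_rank_gt0 => acc_c'; apply: rejc.
  by apply/accepted_E => //; exists c'.
- move=> nEq rk; have [c ec] := of_cell _ _ _ _ rk.
  case: ec nEq rk => <- <- <- <-; rewrite -[is_exist _]/(existential c) existentialN negbK => Uc.
  rewrite -/(cell_of c) cell_rank_of => /(config_rank_step Uc)[c' st /andP[rk' lt']].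
  exists (cstate c'), (cscanned c'), (cnum c').1, (cnum c').2; split.
  + exact: yield_nstep.
  + by rewrite rejection_code_rank U0 -/(cell_of c') cell_rank_of.
  right; exists (U (config_rank c - config_rank c')); first by apply/U0; rewrite subn_gt0.
  rewrite !rejection_code_rank -/(cell_of c') -/(cell_of c) !cell_rank_of -unaryD.
  by rewrite subnKC // ltnW.
rewrite -[cell_index _ _ _ _]/(cell_of (initial M w)) cell_rank_of.
exact/config_rank_gt0.
Qed.

Lemma atm_inductive : inductive_language (atm_language M).
Proof.
exists (FNot (FAnd (Fcoding 1) Frejection)) => w.
split=> [acc_w f [/holds_coding cf /(holds_rejection _ cf) rej]|H].
  have [_ _] := rej; apply; exact: (rejection_rank rej acc_w).
apply: NNPP => /rejection_code_rejection rej; case: (H rejection_code).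
have cf := rejection_code_coding.
by split; [apply/holds_coding | apply/(holds_rejection _ cf)].
Qed.

End MachineToFormula.

(** * Sweeping machines *)

Section Sweeping.

Variables (A Mem : finType) (m0 : Mem).

(* A sweep reads a word from left to right with finite memory, replacing each
   letter, and may extend the word once its end is reached. *)
Record sweeper := Sweeper {
  trans : Mem -> A -> A -> Mem -> bool;
  app : Mem -> A -> Mem -> bool;
  fin : Mem -> bool
}.

Inductive sweep (T : sweeper) : Mem -> seq A -> seq A -> Prop :=
  | SweepEnd m : fin T m -> sweep T m [::] [::]
  | SweepApp m y m' t' : app T m y m' -> sweep T m' [::] t' ->
      sweep T m [::] (y :: t')
  | SweepTrans m x y m' t t' : trans T m x y m' -> sweep T m' t t' ->
      sweep T m (x :: t) (y :: t').

(** By [snext_univ] a universal phase completes at most one sweep. This is why [sacc], a least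
    fixpoint of rules about single sweeps, can agree with global acceptance. *)
Record smachine := SMachine {
  sstate : finType;
  suniv : pred sstate;
  stool : sstate -> sweeper;
  snext : rel sstate;
  snext_univ : forall s s', suniv s -> snext s s' -> ~~ suniv s'
}.

Inductive sacc (S : smachine) : sstate S -> seq A -> Prop :=
  | SaccE s t s' t' : ~~ suniv s -> sweep (stool s) m0 t t' -> snext s s' ->
      sacc s' t' -> sacc s t
  | SaccU s t : suniv s ->
      (forall s' t', sweep (stool s) m0 t t' -> snext s s' -> sacc s' t') ->
      sacc s t.

End Sweeping.

Section Determinism.

Variables (Sigma : finType) (M : ATM Sigma).
Implicit Types c : config M.

Definition act_on (x : action (alphabet M)) (q : state M) c : config M :=
  match x with
  | Write t => Config q (cleft c) t (cright c)
  | Forward => Config q (rcons (cleft c) (cscanned c))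
                 (head (blank M) (cright c)) (behead (cright c))
  | Backward => if rev (cleft c) is t :: u
                then Config q (rev u) t (cscanned c :: cright c)
                else Config q [::] (cscanned c) (cright c)
  end.

Lemma yieldP c c' : yield c c' <-> exists x q,
  delta ((cstate c, cscanned c), (x, q)) /\ c' = act_on x q c.
Proof.
split.
  case=> [q q' u g t v d|q q' u g d|q q' u t g v d|q q' g v d|q q' u g t v d] /=.
  - by exists Forward, q'.
  - by exists Forward, q'.
  - by exists Backward, q'; rewrite /= rev_rcons revK.
  - by exists Backward, q'.
  - by exists (Write t), q'.
case: c => q u g v [[t||] [q' [/= d ->]]] /=.
- exact: YWrite.
- by case: v => [|t v]; [apply: YForwardEnd | apply: YForward].
case/lastP: u => [|u t]; first exact: YBackwardEnd.
by rewrite rev_rcons /= revK; apply: YBackward.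
Qed.

Lemma accepted_det c c1 : (forall c', yield c c' <-> c' = c1) ->
  accepted c <-> accepted c1.
Proof.
move=> det; have [Ec|] := boolP (existential c).
  rewrite (accepted_E Ec); split=> [[c' /det->]//|acc1].
  by exists c1 => //; apply/det.
rewrite existentialN negbK => Uc; rewrite (accepted_U Uc).
by split=> [H|acc1 c' /det->//]; apply/H/det.
Qed.

End Determinism.

(** * Simulation of sweeping machines *)

Section Simulation.

Variables (A Mem : finType) (m0 : Mem) (S : smachine A Mem) (s0 : sstate S).
Variables (Sigma : finType) (iota : Sigma -> A).

Inductive symbol := Raw of option Sigma | LeftEnd | RightEnd | Cell of A.

Definition symbol_code (x : symbol) : option Sigma + (bool + A) :=
  match x with
  | Raw o => inl o | LeftEnd => inr (inl true) | RightEnd => inr (inl false)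
  | Cell y => inr (inr y)
  end.

Definition symbol_decode (x : option Sigma + (bool + A)) : symbol :=
  match x with
  | inl o => Raw o | inr (inl b) => if b then LeftEnd else RightEnd
  | inr (inr y) => Cell y
  end.

Lemma symbol_codeK : cancel symbol_code symbol_decode. Proof. by case. Qed.

HB.instance Definition _ := Finite.copy symbol (can_type symbol_codeK).

(** Replacing a letter takes a write ([Sweep]) and a move ([Next]). Extending the word overwrites
    the right marker, which [Grow] and [Close] restore one cell further. [Rewind] already carries
    the state of the coming sweep, and its polarity. *)
Inductive control :=
  | Init0 | Init1 | Init2
  | Sweep of sstate S & Mem
  | Next of sstate S & Mem
  | Grow of sstate S & Mem
  | Close of sstate S & Mem
  | Rewind of sstate S.

Definition control_code (q : control) :
    option bool + (bool * bool * sstate S * Mem + sstate S) :=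
  match q with
  | Init0 => inl None | Init1 => inl (Some true) | Init2 => inl (Some false)
  | Sweep s m => inr (inl (false, false, s, m))
  | Next s m => inr (inl (false, true, s, m))
  | Grow s m => inr (inl (true, false, s, m))
  | Close s m => inr (inl (true, true, s, m))
  | Rewind s => inr (inr s)
  end.

Definition control_decode (q : option bool + (bool * bool * sstate S * Mem + sstate S)) :=
  match q with
  | inl None => Init0 | inl (Some b) => if b then Init1 else Init2
  | inr (inl (b, b', s, m)) => if b then if b' then Close s m else Grow s m
                               else if b' then Next s m else Sweep s m
  | inr (inr s) => Rewind s
  end.

Lemma control_codeK : cancel control_code control_decode. Proof. by case. Qed.

HB.instance Definition _ := Finite.copy control (can_type control_codeK).

Definition control_univ (q : control) : bool :=
  match q with
  | Init0 | Init1 | Init2 => false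
  | Sweep s _ | Next s _ | Grow s _ | Close s _ | Rewind s => suniv s
  end.

(** The machine wants its states split into a disjoint sum: each control state lives in one summand,
    and its copy in the other has no transitions. *)
Definition polarize (q : control) : control + control :=
  if control_univ q then inr q else inl q.

Definition unpolarize (q : control + control) : control :=
  match q with inl q | inr q => q end.

Lemma polarizeK : cancel polarize unpolarize.
Proof. by move=> q; rewrite /polarize; case: control_univ. Qed.

Definition control_step (q : control) (g : symbol) (x : action symbol) (q' : control) :
    bool :=
  match q, x, q' with
  | Init0, Write LeftEnd, Init1 => true
  | Init1, Forward, Init2 => true
  | Init2, Write (Cell y), Init1 => if g is Raw (Some b) then y == iota b else false
  | Init2, Write RightEnd, Rewind s => if g is Raw None then s == s0 else false
  | Sweep s m, Write (Cell y), Next s' m' =>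
      if g is Cell x then (s' == s) && trans (stool s) m x y m' else false
  | Next s m, Forward, Sweep s' m' => (s' == s) && (m' == m)
  | Sweep s m, Write (Cell y), Grow s' m' =>
      if g is RightEnd then (s' == s) && app (stool s) m y m' else false
  | Grow s m, Forward, Close s' m' => (s' == s) && (m' == m)
  | Close s m, Write RightEnd, Sweep s' m' => (s' == s) && (m' == m)
  | Sweep s m, Write RightEnd, Rewind s' =>
      if g is RightEnd then fin (stool s) m && snext s s' else false
  | Rewind s, Forward, Sweep s' m' =>
      if g is LeftEnd then (s' == s) && (m' == m0) else false
  | Rewind s, Backward, Rewind s' => if g is LeftEnd then false else s' == s
  | _, _, _ => false
  end.

Definition sim_delta : pred (((control + control) * symbol) *
                             (action symbol * (control + control))) :=
  fun d => let: ((q, g), (x, q')) := d in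
    [&& q == polarize (unpolarize q), q' == polarize (unpolarize q') &
        control_step (unpolarize q) g x (unpolarize q')].

Lemma Raw_inj : injective Raw. Proof. by move=> x y []. Qed.

Definition simulator : ATM Sigma := MkATM (polarize Init0) Raw_inj sim_delta.

Notation config := (config simulator).

Definition conf (q : control) (u v : seq symbol) : config :=
  @Config _ simulator (polarize q) u (head (Raw None) v) (behead v).

Lemma sim_yieldP q u v (c : config) : yield (conf q u v) c <->
  exists x q', control_step q (head (Raw None) v) x q' /\
    c = act_on (M := simulator) x (polarize q') (conf q u v).
Proof.
rewrite yieldP; split=> [[x [q' [/and3P[/= _ /eqP-> st] ->]]]|[x [q' [st ->]]]].
  by exists x, (unpolarize q'); rewrite !polarizeK in st.
by exists x, (polarize q'); split=> //; apply/and3P; rewrite !polarizeK.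
Qed.

Lemma conf_univ q u v : universal (conf q u v) = control_univ q.
Proof. by rewrite /universal /= /polarize; case: control_univ. Qed.

Inductive phase :=
  | PSweep of sstate S & Mem & seq A & seq A
  | PNext of sstate S & Mem & seq A & A & seq A
  | PGrow of sstate S & Mem & seq A & A
  | PClose of sstate S & Mem & seq A
  | PRewind of sstate S & seq A & seq A
  | PHome of sstate S & seq A.

Definition cells (v : seq A) := [seq Cell x | x <- v].

Definition phase_conf (r : phase) : config :=
  match r with
  | PSweep s m u v => conf (Sweep s m) (LeftEnd :: cells u) (rcons (cells v) RightEnd)
  | PNext s m u y v =>
      conf (Next s m) (LeftEnd :: cells u) (Cell y :: rcons (cells v) RightEnd)
  | PGrow s m u y => conf (Grow s m) (LeftEnd :: cells u) [:: Cell y]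
  | PClose s m u => conf (Close s m) (LeftEnd :: cells u) [:: Raw None]
  | PRewind s u v => conf (Rewind s) (LeftEnd :: cells u) (rcons (cells v) RightEnd)
  | PHome s v => conf (Rewind s) [::] (LeftEnd :: rcons (cells v) RightEnd)
  end.

Inductive phase_step : phase -> phase -> Prop :=
  | StepTrans s m u x v y m' : trans (stool s) m x y m' ->
      phase_step (PSweep s m u (x :: v)) (PNext s m' u y v)
  | StepNext s m u y v : phase_step (PNext s m u y v) (PSweep s m (rcons u y) v)
  | StepApp s m u y m' : app (stool s) m y m' ->
      phase_step (PSweep s m u [::]) (PGrow s m' u y)
  | StepGrow s m u y : phase_step (PGrow s m u y) (PClose s m (rcons u y))
  | StepClose s m u : phase_step (PClose s m u) (PSweep s m u [::])
  | StepFin s m u s' : fin (stool s) m -> snext s s' ->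
      phase_step (PSweep s m u [::]) (PRewind s' u [::])
  | StepRewind s u x v : phase_step (PRewind s (rcons u x) v) (PRewind s u (x :: v))
  | StepLeft s v : phase_step (PRewind s [::] v) (PHome s v)
  | StepHome s v : phase_step (PHome s v) (PSweep s m0 [::] v).

(** An exact description of the successors, since universal acceptance quantifies over all of
    them. *)
Lemma phase_yield r c :
  yield (phase_conf r) c <-> exists2 r', phase_step r r' & c = phase_conf r'.
Proof.
have headE v : head (Raw None) (rcons (cells v) RightEnd) =
    if v is x :: _ then Cell x else RightEnd by case: v.
have cells_rcons u y : cells (rcons u y) = rcons (cells u) (Cell y) by apply: map_rcons.
split.
  case: r => [s m u v|s m u y v|s m u y|s m u|s u v|s v] /sim_yieldP [x [q' [st ->]]].
  - move: st; rewrite headE; case: v => [|y v].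
      case: x => [[|||z]||] //=; case: q' => //=.
        by move=> s' /andP[f n]; exists (PRewind s' u [::]) => //; constructor.
      by move=> s' m' /andP[/eqP-> a]; exists (PGrow s m' u z) => //; constructor.
    case: x => [[|||z]||] //=; case: q' => //=.
    by move=> s' m' /andP[/eqP-> a]; exists (PNext s m' u z v) => //; constructor.
  - case: x st => //=; case: q' => //= s' m' /andP[/eqP-> /eqP->].
    by exists (PSweep s m (rcons u y) v); [constructor | rewrite /= cells_rcons].
  - case: x st => //=; case: q' => //= s' m' /andP[/eqP-> /eqP->].
    by exists (PClose s m (rcons u y)); [constructor | rewrite /= cells_rcons].
  - case: x st => [[]||] //=; case: q' => //= s' m' /andP[/eqP-> /eqP->].
    by exists (PSweep s m u [::]); [constructor | ].
  - have {}st : x = Backward /\ q' = Rewind s.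
      move: st; rewrite headE.
      by case: v => [|y v]; case: x => [g||]; case: q' => //= s' /eqP->.
    case: st => -> ->; case/lastP: u => [|u y].
      by exists (PHome s v); [constructor | case: v].
    exists (PRewind s u (y :: v)); first by constructor.
    rewrite /= cells_rcons -[LeftEnd :: rcons _ _]rcons_cons rev_rcons /= revK.
    by case: v.
  case: x st => //=; case: q' => //= s' m' /andP[/eqP-> /eqP->].
  by exists (PSweep s m0 [::] v); [constructor | ].
case=> r' st ->; case: st => {r r'}
  [s m u x v y m' t|s m u y v|s m u y m' a|s m u y|s m u|s m u s' f n|s u x v|s v|s v]; apply/sim_yieldP.
- by exists (Write (Cell y)), (Next s m'); rewrite /= eqxx.
- by exists Forward, (Sweep s m); rewrite /= !eqxx cells_rcons.
- by exists (Write (Cell y)), (Grow s m'); rewrite /= eqxx.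
- by exists Forward, (Close s m); rewrite /= !eqxx cells_rcons.
- by exists (Write RightEnd), (Sweep s m); rewrite /= !eqxx.
- by exists (Write RightEnd), (Rewind s'); rewrite /= f n.
- exists Backward, (Rewind s); split; first by rewrite headE; case: v => /=.
  rewrite /= cells_rcons -[LeftEnd :: rcons _ _]rcons_cons rev_rcons /= revK.
  by case: v.
- by exists Backward, (Rewind s); split; [rewrite headE; case: v => /= | case: v].
- by exists Forward, (Sweep s m0); rewrite /= !eqxx.
Qed.

Definition phase_univ (r : phase) : bool :=
  match r with
  | PSweep s _ _ _ | PNext s _ _ _ _ | PGrow s _ _ _ | PClose s _ _
  | PRewind s _ _ | PHome s _ => suniv s
  end.

Lemma phase_conf_univ r : universal (phase_conf r) = phase_univ r.
Proof. by case: r => *; apply: conf_univ. Qed.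

Lemma phase_conf_exist r : existential (phase_conf r) = ~~ phase_univ r.
Proof. by rewrite existentialN phase_conf_univ. Qed.

Definition univ_step r r' := phase_step r r' /\ phase_univ r.

Definition exist_step r r' := phase_step r r' /\ ~~ phase_univ r.

Lemma univ_path r r' : clos_refl_trans_1n phase univ_step r r' ->
  clos_refl_trans config (@ustep Sigma simulator) (phase_conf r) (phase_conf r').
Proof.
elim=> {r r'} [r|r1 r2 r3 [st U1] _ IH]; first exact: rt_refl.
apply: rt_trans IH; apply: rt_step; split; first by apply/phase_yield; exists r2.
by rewrite phase_conf_univ.
Qed.

Lemma exist_path r r' : clos_refl_trans_1n phase exist_step r r' ->
  accepted (phase_conf r') -> accepted (phase_conf r).
Proof.
elim=> {r r'} [//|r1 r2 r3 [st E1] _ IH] acc3.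
apply/accepted_E; first by rewrite phase_conf_exist.
by exists (phase_conf r2); [apply/phase_yield; exists r2 | apply: IH].
Qed.

Definition rt1n_cons := Relation_Operators.rt1n_trans phase.
Arguments rt1n_cons {R x y z} _ _.
Definition rt1n_nil := rt1n_refl phase.
Arguments rt1n_nil {R x}.

(** [P] stands for [univ_step] or [exist_step]: all steps on this path belong to [s], so the
    polarity of [s] decides which one applies. *)
Lemma sweep_path (P : phase -> phase -> Prop) s m u v t s' :
  (forall r r', phase_step r r' ->
     match r with
     | PSweep s1 _ _ _ | PNext s1 _ _ _ _ | PGrow s1 _ _ _ | PClose s1 _ _ => s1 = s
     | _ => False
     end -> P r r') ->
  sweep (stool s) m v t -> snext s s' ->
  clos_refl_trans_1n phase P (PSweep s m u v) (PRewind s' (u ++ t) [::]).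
Proof.
move=> HP swp n; elim: swp u => {m v t} [m f|m y m' t a _ IH|m x y m' v t st _ IH] u.
- rewrite cats0; apply: (rt1n_cons _ rt1n_nil).
  by apply: HP => //; constructor.
- rewrite -cat_rcons; apply: (rt1n_cons _ (rt1n_cons _ (rt1n_cons _ (IH _)))).
  + by apply: HP => //; constructor; apply: a.
  + by apply: HP => //; constructor.
  + by apply: HP => //; constructor.
rewrite -cat_rcons; apply: (rt1n_cons _ (rt1n_cons _ (IH _))).
+ by apply: HP => //; constructor; apply: st.
+ by apply: HP => //; constructor.
Qed.

Lemma rewind_path (P : phase -> phase -> Prop) s u v :
  (forall r r', phase_step r r' ->
     match r with PRewind s1 _ _ | PHome s1 _ => s1 = s | _ => False end -> P r r') ->
  clos_refl_trans_1n phase P (PRewind s u v) (PSweep s m0 [::] (u ++ v)).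
Proof.
move=> HP; elim/last_ind: u v => [|u x IH] v.
  apply: (rt1n_cons _ (rt1n_cons _ rt1n_nil)).
    by apply: HP => //; constructor.
  by apply: HP => //; constructor.
rewrite cat_rcons; apply: (rt1n_cons _ (IH _)); by apply: HP => //; constructor.
Qed.

(* The acceptance condition of the sweeping machine read off in the middle of a
   sweep, for an arbitrary predicate [K] on the configurations between sweeps. *)
Definition mid_sweep (K : sstate S -> seq A -> Prop) s m u v : Prop :=
  if suniv s then forall s' t, sweep (stool s) m v t -> snext s s' -> K s' (u ++ t)
  else exists s' t, [/\ sweep (stool s) m v t, snext s s' & K s' (u ++ t)].

Definition phase_val (K : sstate S -> seq A -> Prop) (r : phase) : Prop :=
  match r with
  | PSweep s m u v => mid_sweep K s m u v
  | PNext s m u y v => mid_sweep K s m (rcons u y) v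
  | PGrow s m u y => mid_sweep K s m (rcons u y) [::]
  | PClose s m u => mid_sweep K s m u [::]
  | PRewind s u v => K s (u ++ v)
  | PHome s v => K s v
  end.

Lemma sacc_mid s t : sacc m0 s t <-> mid_sweep (@sacc _ _ m0 S) s m0 [::] t.
Proof.
rewrite /mid_sweep; case: ifP => Us.
  split=> [|H]; last by apply: SaccU.
  move=> acc; case: acc Us => [s1 t1 s' t' nU _ _ _ Us|s1 t1 _ H _ //].
  by rewrite Us in nU.
split=> [|[s' [t' [swp n acc']]]]; last by apply: SaccE swp n acc'; rewrite Us.
move=> acc; case: acc Us => [s1 t1 s' t' _ swp n acc' _|s1 t1 U1 _]; last by rewrite U1.
by exists s', t'.
Qed.

Lemma phase_val_exist r r' : phase_step r r' -> ~~ phase_univ r ->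
  phase_val (@sacc _ _ m0 S) r' -> phase_val (@sacc _ _ m0 S) r.
Proof.
case=> {r r'}
  [s m u x v y m' t|s m u y v|s m u y m' a|s m u y|s m u|s m u s' f n|s u x v|s v|s v] //=.
- rewrite /mid_sweep; case: ifP => // Us _ [s' [t' [swp n]]]; rewrite cat_rcons => acc.
  by exists s', (y :: t'); split=> //; apply: SweepTrans swp.
- rewrite /mid_sweep; case: ifP => // Us _ [s' [t' [swp n]]]; rewrite cat_rcons => acc.
  by exists s', (y :: t'); split=> //; apply: SweepApp swp.
- rewrite /mid_sweep; case: ifP => // Us _ acc.
  by exists s', [::]; split=> //; constructor.
- by rewrite cat_rcons.
- by move=> _ /sacc_mid.
Qed.

(** Each completed sweep gives a universal path to the start of the next rewind, which is
    existential by [snext_univ]; the hypothesis there is the instance that [mid_sweep] asks for. *)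
Lemma phase_val_univ r :
  phase_univ r ->
  (forall r', clos_refl_trans_1n phase univ_step r r' -> ~~ phase_univ r' ->
     phase_val (@sacc _ _ m0 S) r') ->
  phase_val (@sacc _ _ m0 S) r.
Proof.
have mid s m u v : suniv s ->
  (forall r', clos_refl_trans_1n phase univ_step (PSweep s m u v) r' ->
     ~~ phase_univ r' -> phase_val (@sacc _ _ m0 S) r') ->
  mid_sweep (@sacc _ _ m0 S) s m u v.
  move=> Us H; rewrite /mid_sweep Us => s' t swp n.
  rewrite -[u ++ t]cats0; apply: (H (PRewind s' (u ++ t) [::])).
    apply: sweep_path swp n => r1 r2 st.
    by case: r1 st => //= *; subst; split.
  exact: snext_univ n.
have home s v : suniv s ->
  (forall r', clos_refl_trans_1n phase univ_step (PSweep s m0 [::] v) r' ->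
     ~~ phase_univ r' -> phase_val (@sacc _ _ m0 S) r') -> sacc m0 s v.
  by move=> Us H; apply/sacc_mid/mid.
case: r => [s m u v|s m u y v|s m u y|s m u|s u v|s v] /= Us H.
- exact: mid.
- apply: mid => // r' p; apply: H; apply: (rt1n_cons _ p); split=> //; constructor.
- apply: mid => // r' p; apply: H; apply: (rt1n_cons _ (rt1n_cons _ p)).
    by split=> //; constructor.
  by split=> //; constructor.
- apply: mid => // r' p; apply: H; apply: (rt1n_cons _ p); split=> //; constructor.
- apply: home => // r' p; apply: H.
  apply/clos_rt_rt1n_iff; apply: rt_trans (proj2 (clos_rt_rt1n_iff _ _ _ _) p).
  apply/clos_rt_rt1n_iff; apply: rewind_path => r1 r2 st.
  by case: r1 st => //= *; subst; split.
- apply: home => // r' p; apply: H; apply: (rt1n_cons _ p); split=> //; constructor.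
Qed.

Lemma exist_path_val r c : clos_refl_trans_1n config (@estep Sigma simulator) (phase_conf r) c ->
  exists2 r', c = phase_conf r' &
    phase_val (@sacc _ _ m0 S) r' -> phase_val (@sacc _ _ m0 S) r.
Proof.
have [c0 ec] : exists c0, c0 = phase_conf r by exists (phase_conf r).
rewrite -ec => p; elim: p r ec => {c0 c} [c|c0 c1 c [st E0] _ IH] r ec; first by exists r.
rewrite ec in st E0; have [r1 st1 ec1] := proj1 (phase_yield _ _) st.
have [r2 ec2 v2] := IH _ ec1; exists r2 => // /v2.
by apply: phase_val_exist st1 _; rewrite -phase_conf_exist.
Qed.

Lemma accepted_val r : accepted (phase_conf r) -> phase_val (@sacc _ _ m0 S) r.
Proof.
have [c ec] : exists c, c = phase_conf r by exists (phase_conf r).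
rewrite -ec => acc; elim: acc r ec => {c} [c c' Ec [p Uc'] _ IH|c Uc _ IH] r ec.
  rewrite ec in p; have [r' ec' v'] := exist_path_val (clos_rt_rt1n _ _ _ _ p).
  exact/v'/IH.
apply: phase_val_univ => [|r' p nU]; first by rewrite -phase_conf_univ -ec.
apply: IH (erefl _); split; first by rewrite ec; apply: univ_path.
by rewrite phase_conf_exist.
Qed.

Lemma phase_step_rewind r r' : phase_step r r' ->
  match r with
  | PRewind s u v =>
      r' = if rev u is x :: u' then PRewind s (rev u') (x :: v) else PHome s v
  | PHome s v => r' = PSweep s m0 [::] v
  | _ => True
  end.
Proof. by case=> // *; rewrite rev_rcons revK. Qed.

(** The rewind is deterministic, so acceptance passes backward through it whichever player owns
    it. *)
Lemma accepted_rewind s u v : accepted (phase_conf (PSweep s m0 [::] (u ++ v))) ->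
  accepted (phase_conf (PRewind s u v)).
Proof.
have det r r1 : (forall r', phase_step r r' <-> r' = r1) ->
    accepted (phase_conf r1) -> accepted (phase_conf r).
  move=> rr1; apply: (proj2 (accepted_det _)) => c.
  rewrite phase_yield; split=> [[r' /rr1-> //]|->].
  by exists r1 => //; apply/rr1.
have home s1 v1 : accepted (phase_conf (PSweep s1 m0 [::] v1)) ->
    accepted (phase_conf (PHome s1 v1)).
  by apply: det => r'; split=> [/phase_step_rewind|->]; last constructor.
elim/last_ind: u v => [|u x IH] v.
  by move/home; apply: det => r'; split=> [/phase_step_rewind|->]; last constructor.
rewrite cat_rcons => /IH; apply: det => r'; split=> [/phase_step_rewind|->].
  by rewrite rev_rcons revK.
by constructor.
Qed.

Lemma sacc_accepted s t : sacc m0 s t -> accepted (phase_conf (PSweep s m0 [::] t)).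
Proof.
elim=> {s t} [s t s' t' Es swp n _ IH|s t Us _ IH].
  apply: (@exist_path _ (PRewind s' ([::] ++ t') [::])).
    apply: sweep_path swp n => r1 r2 st.
    by case: r1 st => //= *; subst; split.
  by apply: accepted_rewind; rewrite cats0.
(* The demand on every completed sweep. The second conjunct ends the universal phase at the first
   configuration of the rewind, which is why [inv] allows only [v = [::]] there. *)
pose K s' t' := accepted (phase_conf (PRewind s' t' [::])) /\ ~~ suniv s'.
pose inv r := match r with
  | PSweep s1 _ _ _ | PNext s1 _ _ _ _ | PGrow s1 _ _ _ | PClose s1 _ _ =>
      suniv s1 /\ phase_val K r
  | PRewind s1 u v => v = [::] /\ K s1 u
  | PHome _ _ => False
  end.
have inv_step r r' : phase_step r r' -> phase_univ r -> inv r -> inv r'.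
  case=> {r r'}
    [s1 m u x v y m' st|s1 m u y v|s1 m u y m' a|s1 m u y|s1 m u|s1 m u s' f n|s1 u x v|s1 v|s1 v] //=.
  - rewrite /mid_sweep => U1; rewrite U1 => -[_ H]; split=> // s' t' swp n.
    by rewrite cat_rcons; apply: H n; apply: SweepTrans swp.
  - rewrite /mid_sweep => U1; rewrite U1 => -[_ H]; split=> // s' t' swp n.
    by rewrite cat_rcons; apply: H n; apply: SweepApp swp.
  - rewrite /mid_sweep => U1; rewrite U1 => -[_ H]; split=> //.
    by rewrite -[u]cats0; apply: H n; constructor.
  - by move=> U1 [_ [_]]; rewrite U1.
  - by move=> U1 [_ [_]]; rewrite U1.
apply: AccU => [|c [p Ec]]; first by rewrite phase_conf_univ.
have inv0 : inv (PSweep s m0 [::] t).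
  split=> //; rewrite /= /mid_sweep Us => s' t' swp n; split.
    by apply: accepted_rewind; rewrite cats0; apply: IH n.
  exact: snext_univ n.
have {}p := clos_rt_rt1n _ _ _ _ p.
move: (PSweep _ _ _ _) inv0 p => r inv0.
have [c0 ec] : exists c0, c0 = phase_conf r by exists (phase_conf r).
rewrite -ec => p; elim: p r inv0 Ec ec => {c0 c} [c|c0 c1 c [st U0] _ IHp] r inv0 Ec ec.
  rewrite ec phase_conf_exist in Ec *.
  case: r inv0 Ec {ec} => [s1 m u v|s1 m u y v|s1 m u y|s1 m u|s1 u v|s1 v] //=;
    try by move=> [->].
  by move=> [-> []].
rewrite ec in st U0; have [r1 st1 ec1] := proj1 (phase_yield _ _) st.
by apply: IHp ec1 => //; apply: inv_step st1 _ inv0; rewrite -phase_conf_univ.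
Qed.

(** The initialization, which brackets the input and recodes it cell by cell, has only one run, so
    each of its steps preserves acceptance both ways. *)
Lemma initial_accepted w : accepted (initial simulator w) <->
  accepted (phase_conf (PRewind s0 [seq iota b | b <- w] [::])).
Proof.
pose I2 u w := conf Init2 (LeftEnd :: cells u)
  (head (Raw None) [seq Raw (Some b) | b <- w] :: behead [seq Raw (Some b) | b <- w]).
have goI2 u : accepted (I2 u w) <->
    accepted (phase_conf (PRewind s0 (u ++ [seq iota b | b <- w]) [::])).
  elim: w u => [|b w IH] u.
    rewrite cats0; apply: accepted_det => c; rewrite sim_yieldP; split.
      move=> [x [q' [st ->]]]; case: x st => [[|||z]||] //=; case: q' => //=.
      by move=> s /eqP->.
    by move=> ->; exists (Write RightEnd), (Rewind s0); rewrite /= eqxx.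
  pose c1 := conf Init1 (LeftEnd :: cells u) (Cell (iota b) :: [seq Raw (Some b) | b <- w]).
  have -> : accepted (I2 u (b :: w)) <-> accepted c1.
    apply: accepted_det => c; rewrite sim_yieldP; split.
      move=> [x [q' [st ->]]]; case: x st => [[|||z]||] //=; case: q' => //=.
      by move=> /eqP->.
    by move=> ->; exists (Write (Cell (iota b))), Init1; rewrite /= eqxx.
  rewrite /= -cat_rcons -IH; apply: accepted_det => c; rewrite sim_yieldP.
  have -> : I2 (rcons u (iota b)) w =
      act_on (M := simulator) Forward (polarize Init2) c1.
    by rewrite /I2 /cells map_rcons.
  split=> [[x [q' [st ->]]]|->]; last by exists Forward, Init2.
  by case: x st => [[|||z]||] //=; case: q'.
rewrite -[X in PRewind _ X]cat0s -goI2.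
pose c1 := conf Init1 [::] (LeftEnd :: [seq Raw (Some b) | b <- w]).
have -> : accepted (initial simulator w) <-> accepted c1.
  apply: accepted_det => c.
  rewrite -[initial _ _]/(conf Init0 [::] (Raw None :: [seq Raw (Some b) | b <- w])).
  rewrite sim_yieldP; split=> [[x [q' [st ->]]]|->]; last by exists (Write LeftEnd), Init1.
  by case: x st => [[|||z]||] //=; case: q'.
apply: accepted_det => c; rewrite sim_yieldP.
split=> [[x [q' [st ->]]]|->]; last by exists Forward, Init2.
by case: x st => [[|||z]||] //=; case: q'.
Qed.

Theorem simulatorP w : atm_language simulator w <-> sacc m0 s0 [seq iota b | b <- w].
Proof.
rewrite /atm_language initial_accepted; split.
  by move/accepted_val; rewrite /= cats0.
by move=> acc; apply: accepted_rewind; rewrite cats0; apply: sacc_accepted.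
Qed.

End Simulation.

(** * Properties of words decided by sweeping machines *)

Section Decided.

Variables (A Mem : finType) (m0 : Mem).
Implicit Types (P : seq A -> Prop) (t : seq A).

Definition decided P : Prop := exists (S : smachine A Mem) (s : sstate S),
  ~~ suniv s /\ forall t, sacc m0 s t <-> P t.

Lemma decided_ext P P' : (forall t, P t <-> P' t) -> decided P -> decided P'.
Proof.
by move=> eP [S [s [Es HS]]]; exists S, s; split=> // t; rewrite HS.
Qed.

Definition id_sweeper : sweeper A Mem :=
  Sweeper (fun m x y m' => (y == x) && (m' == m)) (fun _ _ _ => false) xpredT.

Lemma sweep_id m t t' : sweep id_sweeper m t t' <-> t' = t.
Proof.
split=> [|->]; last first.
  elim: t => [|x t IH]; first by constructor.
  by apply: (@SweepTrans _ _ id_sweeper _ _ _ _ _ _ _ IH); rewrite /= !eqxx.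
by elim=> // m1 x y m' t1 t2 /andP[/eqP-> _] _ ->.
Qed.

(** The image of [i] is closed under [snext], so derivations of acceptance carry over to the larger
    machine. *)
Lemma sacc_embed (S S' : smachine A Mem) (i : sstate S -> sstate S') :
  (forall s, suniv (i s) = suniv s) -> (forall s, stool (i s) = stool s) ->
  (forall s s', snext (i s) s' <-> exists2 s1, s' = i s1 & snext s s1) ->
  forall s t, sacc m0 s t -> sacc m0 (i s) t.
Proof.
move=> iu it inx s t; elim=> {s t} [s t s' t' Es swp n _ IH|s t Us _ IH].
  by apply: (@SaccE _ _ _ _ _ _ (i s') t'); rewrite ?iu ?it //; apply/inx; exists s'.
apply: SaccU; rewrite ?iu // it => s' t' swp /inx[s1 -> n]; exact: IH.
Qed.

Lemma decided_true : decided (fun=> True).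
Proof.
(* State [true] is universal without successors, hence accepting; [false] leads to it. *)
have nx (s s' : bool) : s -> ~~ s && s' -> ~~ s' by case: s.
pose S := @SMachine A Mem bool id (fun=> id_sweeper) _ nx.
exists S, false; split=> // t; split=> // _.
apply: (@SaccE _ _ _ S false t true t) => //; first exact/sweep_id.
exact: SaccU.
Qed.

Lemma decided_or P1 P2 : decided P1 -> decided P2 ->
  decided (fun t => P1 t \/ P2 t).
Proof.
move=> [S1 [s1 [E1 H1]]] [S2 [s2 [E2 H2]]].
pose uni (s : option (sstate S1 + sstate S2)) :=
  match s with None => false | Some (inl s) => suniv s | Some (inr s) => suniv s end.
pose tool (s : option (sstate S1 + sstate S2)) :=
  match s with None => id_sweeper | Some (inl s) => stool s | Some (inr s) => stool s end.
pose nxt (s s' : option (sstate S1 + sstate S2)) := match s, s' with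
  | None, Some (inl s) => s == s1
  | None, Some (inr s) => s == s2
  | Some (inl s), Some (inl s') => snext s s'
  | Some (inr s), Some (inr s') => snext s s'
  | _, _ => false
  end.
have nx s s' : uni s -> nxt s s' -> ~~ uni s'.
  by case: s s' => [[s|s]|] [[s'|s']|] //=; apply: snext_univ.
pose S := @SMachine A Mem _ uni tool nxt nx.
have emb1 := @sacc_embed S1 S (fun s => Some (inl s)) (fun=> erefl) (fun=> erefl).
have emb2 := @sacc_embed S2 S (fun s => Some (inr s)) (fun=> erefl) (fun=> erefl).
exists S, None; split=> // t; split; last first.
  case=> [/H1 acc|/H2 acc].
    apply: (@SaccE _ _ _ S None t (Some (inl s1)) t) => //=; first exact/sweep_id.
    by apply: emb1 acc => s [[s'|s']|]; split=> [n|[s3 [->]]] //; exists s'.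
  apply: (@SaccE _ _ _ S None t (Some (inr s2)) t) => //=; first exact/sweep_id.
  by apply: emb2 acc => s [[s'|s']|]; split=> [n|[s3 [->]]] //; exists s'.
(* What acceptance means at each state, so that one induction treats all states together. *)
pose val (s : sstate S) t := match s with
  | None => P1 t \/ P2 t | Some (inl s) => sacc m0 s t | Some (inr s) => sacc m0 s t end.
suff: forall (s : sstate S) t, sacc m0 s t -> val s t by apply.
move=> {t} s t; elim=> {s t} [[[s|s]|] t [[s'|s']|] t' //= Es swp n _ IH|[[s|s]|] t //= Us _ IH].
- exact: SaccE swp n IH.
- exact: SaccE swp n IH.
- by move/sweep_id: swp IH => -> IH; left; apply/H1; rewrite -(eqP n).
- by move/sweep_id: swp IH => -> IH; right; apply/H2; rewrite -(eqP n).
- by apply: SaccU => // s' t' swp n; apply: (IH (Some (inl s'))).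
- by apply: SaccU => // s' t' swp n; apply: (IH (Some (inr s'))).
Qed.

Inductive sweep_game (T1 T2 : sweeper A Mem) P : seq A -> Prop :=
  | GameStop t : P t -> sweep_game T1 T2 P t
  | GameMove t t1 : sweep T1 m0 t t1 ->
      (forall t2, sweep T2 m0 t1 t2 -> sweep_game T1 T2 P t2) -> sweep_game T1 T2 P t.

(** A round has three sweeps: the identity at [None], after which the existential player stops or
    goes on, then [T1], then [T2] as the only universal one. *)
Lemma decided_game T1 T2 P : decided P -> decided (sweep_game T1 T2 P).
Proof.
move=> [S1 [s1 [E1 H1]]].
pose uni (s : option bool + sstate S1) :=
  match s with inl s => s == Some true | inr s => suniv s end.
pose tool (s : option bool + sstate S1) := match s with
  | inl None => id_sweeper | inl (Some false) => T1 | inl (Some true) => T2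
  | inr s => stool s end.
pose nxt (s s' : option bool + sstate S1) := match s, s' with
  | inl None, inr s => s == s1
  | inl None, inl (Some false) | inl (Some false), inl (Some true)
  | inl (Some true), inl None => true
  | inr s, inr s' => snext s s'
  | _, _ => false
  end.
have nx s s' : uni s -> nxt s s' -> ~~ uni s'.
  by case: s s' => [[[]|]|s] [[[]|]|s'] //=; apply: snext_univ.
pose S := @SMachine A Mem _ uni tool nxt nx.
have emb := @sacc_embed S1 S inr (fun=> erefl) (fun=> erefl).
exists S, (inl None); split=> // t; split; last first.
  elim=> {t} [t /H1 acc|t t1 swp _ IH].
    apply: (@SaccE _ _ _ S (inl None) t (inr s1) t) => //=; first exact/sweep_id.
    by apply: emb acc => s [s'|s']; split=> [n|[s3 [->]]] //; exists s'.
  apply: (@SaccE _ _ _ S (inl None) t (inl (Some false)) t) => //=; first exact/sweep_id.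
  apply: (@SaccE _ _ _ S (inl (Some false)) t (inl (Some true)) t1) => //=.
  by apply: SaccU => // -[[[]|]|s'] t2 //= swp2 _; apply: IH.
pose val (s : sstate S) t := match s with
  | inl None => sweep_game T1 T2 P t
  | inl (Some false) => exists2 t1, sweep T1 m0 t t1 &
      forall t2, sweep T2 m0 t1 t2 -> sweep_game T1 T2 P t2
  | inl (Some true) => forall t2, sweep T2 m0 t t2 -> sweep_game T1 T2 P t2
  | inr s => sacc m0 s t end.
suff: forall (s : sstate S) t, sacc m0 s t -> val s t by apply.
move=> {t} s t; elim=> {s t}
  [[[[]|]|s] t [[[]|]|s'] t' //= Es swp n _ IH|[[[]|]|s] t //= Us _ IH].
- by exists t'.
- by case: IH => t1 swp1; apply: GameMove; move/sweep_id: swp => <-.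
- by move/sweep_id: swp IH => -> IH; apply/GameStop/H1; rewrite -(eqP n).
- exact: SaccE swp n IH.
- by move=> t2 swp; apply: (IH (inl None)).
- by apply: SaccU => // s' t' swp n; apply: (IH (inr s')).
Qed.

Lemma decided_sweep T P : decided P ->
  decided (fun t => exists2 t', sweep T m0 t t' & P t').
Proof.
move=> [S1 [s1 [E1 H1]]].
pose uni (s : option (sstate S1)) := if s is Some s then suniv s else false.
pose tool (s : option (sstate S1)) := if s is Some s then stool s else T.
pose nxt (s s' : option (sstate S1)) := match s, s' with
  | None, Some s => s == s1
  | Some s, Some s' => snext s s'
  | _, _ => false
  end.
have nx s s' : uni s -> nxt s s' -> ~~ uni s'.
  by case: s s' => [s|] [s'|] //=; apply: snext_univ.
pose S := @SMachine A Mem _ uni tool nxt nx.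
have emb := @sacc_embed S1 S Some (fun=> erefl) (fun=> erefl).
exists S, None; split=> // t; split; last first.
  move=> [t' swp /H1 acc].
  apply: (@SaccE _ _ _ S None t (Some s1) t') => //=.
  by apply: emb acc => s [s'|]; split=> [n|[s3 [->]]] //; exists s'.
pose val (s : sstate S) t := match s with
  | None => exists2 t', sweep T m0 t t' & P t' | Some s => sacc m0 s t end.
suff: forall (s : sstate S) t, sacc m0 s t -> val s t by apply.
move=> {t} s t; elim=> {s t} [[s|] t [s'|] t' //= Es swp n _ IH|[s|] t //= Us _ IH].
- exact: SaccE swp n IH.
- by exists t' => //; apply/H1; rewrite -(eqP n).
- by apply: SaccU => // s' t' swp n; apply: (IH (Some s')).
Qed.

End Decided.

(** * Words with two pointers *)

Section Pointers.

Variable B : finType.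

(* The two bits of a cell mark the positions of two pointers c and d; only the
   first marked cell counts. *)
Notation cell := (B * (bool * bool))%type.
Notation memory := ((bool * bool) * (option B * option B))%type.
Implicit Types (t : seq cell) (s : seq B) (P : seq B -> nat -> nat -> Prop).

(** All sweepers share one memory so that they can be joined in a single machine: the bits carry
    marks or progress from cell to cell, the options hold letters found under the pointers. *)
Definition memory0 : memory := ((false, false), (None, None)).

Definition letters t : seq B := [seq x.1 | x <- t].
(** Without any mark this is the length of the word: the pointer is past the end. *)
Definition cpos t := find (fun x : cell => x.2.1) t.
Definition dpos t := find (fun x : cell => x.2.2) t.

Definition decided2 P :=
  decided memory0 (fun t => P (letters t) (cpos t) (dpos t)).

Inductive move := Keep | Reset | Shift.

Definition moved (o : move) s k : nat :=
  match o with Keep => k | Reset => 0 | Shift => minn k.+1 (size s) end.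

(** For [Shift], [pending] is the bit of the previous cell; for [Reset], it says that the first cell
    has been passed. *)
Definition move_bit (o : move) (pending b : bool) : bool :=
  match o with Keep => b | Reset => ~~ pending | Shift => pending end.

Definition move_pending (o : move) (pending b : bool) : bool :=
  match o with Keep => false | Reset => true | Shift => b end.

Definition move_sweeper (oc od : move) : sweeper cell memory :=
  Sweeper (fun m x y m' =>
      (y == (x.1, (move_bit oc m.1.1 x.2.1, move_bit od m.1.2 x.2.2))) &&
      (m' == ((move_pending oc m.1.1 x.2.1, move_pending od m.1.2 x.2.2), m.2)))
    (fun _ _ _ => false) xpredT.

Fixpoint move_track (o : move) (pending : bool) (bs : seq bool) : seq bool :=
  if bs is b :: bs' then
    move_bit o pending b :: move_track o (move_pending o pending b) bs'
  else [::].

Lemma find_move o (bs : seq bool) : find id (move_track o false bs) =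
  match o with Keep => find id bs | Reset => 0 | Shift => minn (find id bs).+1 (size bs) end.
Proof.
case: o => /=; first by elim: bs => //= b bs ->.
  by case: bs.
have shift1 bs1 : find id (move_track Shift true bs1) = 0 by case: bs1.
elim: bs => //= -[] bs IH /=; first by rewrite shift1 minnSS min0n.
by rewrite IH minnSS.
Qed.

Lemma sweep_move oc od m t : exists t', [/\
  (forall t1, sweep (move_sweeper oc od) m t t1 <-> t1 = t'),
  letters t' = letters t,
  [seq x.2.1 | x <- t'] = move_track oc m.1.1 [seq x.2.1 | x <- t] &
  [seq x.2.2 | x <- t'] = move_track od m.1.2 [seq x.2.2 | x <- t]].
Proof.
elim: t m => [|x t IH] m.
  exists [::]; split=> // t1; split=> [swp|->]; last by constructor.
  by inversion swp.
pose y : cell := (x.1, (move_bit oc m.1.1 x.2.1, move_bit od m.1.2 x.2.2)).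
pose m' : memory :=
  ((move_pending oc m.1.1 x.2.1, move_pending od m.1.2 x.2.2), m.2).
have [t' [Ht' lt' ct' dt']] := IH m'.
exists (y :: t'); split; rewrite /= ?lt' ?ct' ?dt' // => t1.
split=> [swp|->].
  inversion swp as [| |? ? y1 m1 ? t2 tr swp1]; subst.
  by move: tr => /= /andP[/eqP-> /eqP em]; rewrite em in swp1; move/Ht': swp1 => ->.
apply: (@SweepTrans _ _ (move_sweeper oc od) m x y m'); last exact/Ht'.
by rewrite /= !eqxx.
Qed.

Lemma move_spec oc od t : exists t', [/\
  (forall t1, sweep (move_sweeper oc od) memory0 t t1 <-> t1 = t'),
  letters t' = letters t,
  cpos t' = moved oc (letters t) (cpos t) &
  dpos t' = moved od (letters t) (dpos t)].
Proof.
have find_bits (f : cell -> bool) t1 : find f t1 = find id [seq f x | x <- t1].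
  by elim: t1 => //= x t1 ->.
have [t' [Ht' lt' ct' dt']] := sweep_move oc od memory0 t.
exists t'; split=> //.
  by rewrite /cpos !find_bits ct' find_move size_map /moved size_map.
by rewrite /dpos !find_bits dt' find_move size_map /moved size_map.
Qed.

(** A test is a sweep that changes nothing and can finish only if [p] holds of the two letters;
    [None] means past the end. *)
Definition test_sweeper (p : option B -> option B -> bool) : sweeper cell memory :=
  Sweeper (fun m x y m' => (y == x) &&
      (m' == (m.1, (if x.2.1 && (m.2.1 == None) then Some x.1 else m.2.1,
                    if x.2.2 && (m.2.2 == None) then Some x.1 else m.2.2))))
    (fun _ _ _ => false) (fun m => p m.2.1 m.2.2).

Lemma test_sweep p m t t' : sweep (test_sweeper p) m t t' <-> t' = t /\
  p (if m.2.1 is Some x then Some x else onth (letters t) (cpos t))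
    (if m.2.2 is Some x then Some x else onth (letters t) (dpos t)).
Proof.
elim: t m t' => [|x t IH] m t'.
  split=> [swp|[-> pm]]; last by constructor; case: m pm => ? [[?|] [?|]].
  by inversion swp as [? f| |]; subst; split=> //; case: m {swp} f => ? [[?|] [?|]].
pose m' : memory := (m.1, (if x.2.1 && (m.2.1 == None) then Some x.1 else m.2.1,
                    if x.2.2 && (m.2.2 == None) then Some x.1 else m.2.2)).
have -> : sweep (test_sweeper p) m (x :: t) t' <->
    exists2 t2, t' = x :: t2 & sweep (test_sweeper p) m' t t2.
  split=> [swp|[t2 -> swp]].
    inversion swp as [| |? ? y1 m1 ? t2 tr swp1]; subst.
    by move: tr => /= /andP[/eqP-> /eqP em]; rewrite em in swp1; exists t2.
  apply: (@SweepTrans _ _ (test_sweeper p) m x x m'); last exact: swp.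
  by rewrite /= !eqxx.
have e1 : (if m'.2.1 is Some y then Some y else onth (letters t) (cpos t)) =
    if m.2.1 is Some y then Some y else onth (letters (x :: t)) (cpos (x :: t)).
  by rewrite /m' /cpos; case: m {m'} => ? [[?|] ?]; case: x => ? [[] ?].
have e2 : (if m'.2.2 is Some y then Some y else onth (letters t) (dpos t)) =
    if m.2.2 is Some y then Some y else onth (letters (x :: t)) (dpos (x :: t)).
  by rewrite /m' /dpos; case: m {m' e1} => ? [? [?|]]; case: x => ? [? []].
rewrite -e1 -e2; split=> [[t2 ->] /IH[-> ?] //|[-> ?]].
by exists t => //; apply/IH.
Qed.

Lemma test_spec p t t' : sweep (test_sweeper p) memory0 t t' <->
  t' = t /\ p (onth (letters t) (cpos t)) (onth (letters t) (dpos t)).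
Proof. exact: test_sweep. Qed.

(** The first memory bit records that [b] has been written; until then the sweep cannot finish,
    afterwards any letters of [C] may follow. *)
Definition append_sweeper (b : B) (C : pred B) : sweeper cell memory :=
  Sweeper (fun m x y m' => [&& ~~ m.1.1, y == x & m' == m])
    (fun m y m' => (y.2 == (false, false)) && (m' == ((true, m.1.2), m.2)) &&
       (if m.1.1 then C y.1 else y.1 == b))
    (fun m => m.1.1).

Definition unmarked s : seq cell := [seq (x, (false, false)) | x <- s].

Lemma append_spec b (C : pred B) t t' :
  sweep (append_sweeper b C) memory0 t t' <->
  exists2 v, all C v & t' = t ++ unmarked (b :: v).
Proof.
pose m1 : memory := ((true, false), (None, None)).
have fwd v : all C v -> sweep (append_sweeper b C) m1 [::] (unmarked v).
  elim: v => [|x v IH] /=; first by constructor.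
  move=> /andP[Cx /IH]; apply: SweepApp.
  by rewrite /= ?eqxx.
have bwd v' : sweep (append_sweeper b C) m1 [::] v' ->
    exists2 v, all C v & v' = unmarked v.
  elim: v' => [|y v' IH] swp; first by exists [::].
  inversion swp as [|? ? m' ? a swp1|]; subst.
  move: a => /= /andP[/andP[/eqP y0 /eqP em] Cy]; rewrite em in swp1.
  have [v Cv ->] := IH swp1; exists (y.1 :: v); rewrite /= ?Cy //.
  by case: y y0 {Cy swp} => ? ? /= ->.
elim: t t' => [|x t IH] t'.
  split=> [swp|[v Cv ->]].
    inversion swp as [f|? y m' ? a swp1|]; subst; first by [].
    move: a => /= /andP[/andP[/eqP y0 /eqP em] /eqP yb]; rewrite em in swp1.
    have [v Cv ->] := bwd _ swp1; exists v => //=.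
    by case: y y0 yb {swp} => ? ? /= -> ->.
  apply: (@SweepApp _ _ (append_sweeper b C) memory0 _ m1); last exact: fwd.
  by rewrite /= ?eqxx.
split=> [swp|[v Cv ->]].
  inversion swp as [| |? ? y1 m' ? t2 tr swp1]; subst.
  move: tr => /= /andP[/eqP-> /eqP em]; rewrite em in swp1.
  by have [v Cv ->] := proj1 (IH _) swp1; exists v.
apply: (@SweepTrans _ _ (append_sweeper b C) memory0 x x memory0).
  by rewrite /= ?eqxx.
by apply/IH; exists v.
Qed.

Lemma letters_append t b v : letters (t ++ unmarked (b :: v)) = letters t ++ b :: v.
Proof.
by rewrite /letters map_cat /= -map_comp (eq_map (g := id)) ?map_id.
Qed.

Lemma decided2_ext P P' : (forall s c d, P s c d <-> P' s c d) ->
  decided2 P -> decided2 P'.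
Proof. by move=> eP; apply: decided_ext => t; apply: eP. Qed.

Lemma decided2_move oc od P : decided2 P ->
  decided2 (fun s c d => P s (moved oc s c) (moved od s d)).
Proof.
move/(decided_sweep (move_sweeper oc od)); apply: decided_ext => t.
have [t' [Ht' lt' ct' dt']] := move_spec oc od t; rewrite -ct' -dt' -lt'.
split=> [[t1 /Ht'-> //]|Pt']; exists t' => //; exact/Ht'.
Qed.

Lemma decided2_test (p : option B -> option B -> bool) P : decided2 P ->
  decided2 (fun s c d => p (onth s c) (onth s d) /\ P s c d).
Proof.
move/(decided_sweep (test_sweeper p)); apply: decided_ext => t.
split=> [[t1 /test_spec[-> ?] //]|[pt Pt]].
by exists t => //; apply/test_spec.
Qed.

Inductive loop (p : option B -> option B -> bool) (oc od : move) P s :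
    nat -> nat -> Prop :=
  | LoopStop c d : P s c d -> loop p oc od P s c d
  | LoopMove c d : p (onth s c) (onth s d) ->
      loop p oc od P s (moved oc s c) (moved od s d) -> loop p oc od P s c d.

Lemma loopE (p : option B -> option B -> bool) oc od P s c d :
  loop p oc od P s c d <->
  P s c d \/ p (onth s c) (onth s d) /\ loop p oc od P s (moved oc s c) (moved od s d).
Proof.
split=> [[{}c {}d ?|{}c {}d ? ?]|[|[]]]; first by left.
- by right.
- exact: LoopStop.
exact: LoopMove.
Qed.

(** A loop is a game whose first sweep is the test and whose universal sweep, moving the pointers,
    is deterministic and leaves no choice. *)
Lemma decided2_loop (p : option B -> option B -> bool) oc od P :
  decided2 P -> decided2 (loop p oc od P).
Proof.
move/(decided_game (test_sweeper p) (move_sweeper oc od)).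
apply: decided_ext => t; split.
  elim=> {t} [t Pt|t t1 /test_spec[-> pt] _ IH]; first exact: LoopStop.
  apply: LoopMove => //; have [t' [Ht' lt' ct' dt']] := move_spec oc od t.
  by rewrite -ct' -dt' -lt'; apply/IH/Ht'.
suff H s c d : loop p oc od P s c d -> forall t1, letters t1 = s -> cpos t1 = c ->
    dpos t1 = d -> sweep_game memory0 (test_sweeper p) (move_sweeper oc od)
      (fun t => P (letters t) (cpos t) (dpos t)) t1.
  by move=> /H; apply.
elim=> {c d} [c d Pcd|c d pcd _ IH] t1 es ec ed.
  by apply: GameStop; rewrite es ec ed.
apply: (GameMove (t1 := t1)) => [|t2]; first by apply/test_spec; rewrite es ec ed.
have [t' [Ht' lt' ct' dt']] := move_spec oc od t1.
by move=> /Ht'->; apply: IH; rewrite ?lt' ?ct' ?dt' ?es ?ec ?ed.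
Qed.

Lemma decided2_or P1 P2 : decided2 P1 -> decided2 P2 ->
  decided2 (fun s c d => P1 s c d \/ P2 s c d).
Proof. exact: decided_or. Qed.

Definition decided1 (K : seq B -> Prop) := decided2 (fun s _ _ => K s).

Lemma decided1_ext (K K' : seq B -> Prop) : (forall s, K s <-> K' s) ->
  decided1 K -> decided1 K'.
Proof. by move=> eK; apply: decided2_ext => s _ _; apply: eK. Qed.

Lemma decided1_or (K1 K2 : seq B -> Prop) : decided1 K1 -> decided1 K2 ->
  decided1 (fun s => K1 s \/ K2 s).
Proof. exact: decided2_or. Qed.

Lemma decided1_append b C (K : seq B -> Prop) : decided1 K ->
  decided1 (fun s => exists2 v, all C v & K (s ++ b :: v)).
Proof.
move/(decided_sweep (append_sweeper b C)); apply: decided_ext => t; split.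
  move=> [t' /append_spec[v Cv ->]]; rewrite letters_append => Kt.
  by exists v.
move=> [v Cv Kv]; exists (t ++ unmarked (b :: v)); last by rewrite letters_append.
by apply/append_spec; exists v.
Qed.

Inductive append_game (b1 : B) (C1 : pred B) (b2 : B) (C2 : pred B)
    (K : seq B -> Prop) : seq B -> Prop :=
  | AppendStop s : K s -> append_game b1 C1 b2 C2 K s
  | AppendMove s u : all C1 u ->
      (forall v, all C2 v -> append_game b1 C1 b2 C2 K ((s ++ b1 :: u) ++ b2 :: v)) ->
      append_game b1 C1 b2 C2 K s.

Lemma decided1_game b1 C1 b2 C2 K : decided1 K ->
  decided1 (append_game b1 C1 b2 C2 K).
Proof.
move/(decided_game (append_sweeper b1 C1) (append_sweeper b2 C2)).
apply: decided_ext => t; split.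
  elim=> {t} [t Kt|t t1 /append_spec[u Cu ->] _ IH]; first exact: AppendStop.
  apply: AppendMove Cu _ => v Cv; rewrite -!letters_append; apply: IH.
  by apply/append_spec; exists v.
suff H s : append_game b1 C1 b2 C2 K s -> forall t1, letters t1 = s ->
    sweep_game memory0 (append_sweeper b1 C1) (append_sweeper b2 C2)
      (fun t => K (letters t)) t1.
  by move=> /H; apply.
elim=> {s} [s Ks|s u Cu _ IH] t1 es; first by apply: GameStop; rewrite es.
apply: (GameMove (t1 := t1 ++ unmarked (b1 :: u))).
  by apply/append_spec; exists u.
move=> t2 /append_spec[v Cv ->]; apply: (IH v Cv).
by rewrite !letters_append es.
Qed.

Lemma decided1_true : decided1 (fun=> True).
Proof. exact: decided_true. Qed.

Lemma decided1_false : decided1 (fun=> False).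
Proof.
have := @decided2_test (fun _ _ => false) (fun _ _ _ => True) decided1_true.
by apply: decided2_ext => s c d; split=> // -[].
Qed.

End Pointers.

(** * Pattern queries *)

Definition pattern (L : Type) := seq (L + nat).

Definition subst L (sigma : nat -> seq L) (p : pattern L) : seq L :=
  flatten [seq match x with inl b => [:: b] | inr i => sigma i end | x <- p].

Lemma subst_cat L (sigma : nat -> seq L) p1 p2 :
  subst sigma (p1 ++ p2) = subst sigma p1 ++ subst sigma p2.
Proof. by rewrite /subst map_cat flatten_cat. Qed.

Lemma subst_cons L (sigma : nat -> seq L) x p : subst sigma (x :: p) =
  match x with inl b => [:: b] | inr i => sigma i end ++ subst sigma p.
Proof. by []. Qed.

(** * Factors and prefixes of words *)

Section Words.

Variable T : eqType.
Implicit Types (x y : T) (s u v : seq T).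

Lemma onth_drop s k x : onth s k = Some x -> drop k s = x :: drop k.+1 s.
Proof. by elim: s k => [|y s IH] [|k] //= => [[->]|/IH]; rewrite ?drop0. Qed.

Lemma drop_onth s k x u : drop k s = x :: u -> onth s k = Some x /\ drop k.+1 s = u.
Proof. by elim: s k => [|y s IH] [|k] //= => [[-> ->]|/IH]; rewrite ?drop0. Qed.

Lemma onth_None s k : onth s k = None -> drop k s = [::].
Proof. by elim: s k => [|y s IH] [|k] //= /IH. Qed.

Lemma onth_size s k x : onth s k = Some x -> k < size s.
Proof. by elim: s k => [|y s IH] [|k] //= /IH. Qed.

Lemma split_uniq x u v u' v' : x \notin u -> x \notin v ->
  u ++ x :: v = u' ++ x :: v' -> v' = v.
Proof.
elim: u u' => [|y u IH] [|y' u'] //=; rewrite ?inE.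
- by move=> _ _ [->].
- by move=> _ /negP nv [_ ev]; case: nv; rewrite ev mem_cat mem_head orbT.
- by move=> /norP[/eqP nxy _] _ [exy]; case: nxy.
by move=> /norP[_ xu] xv [_]; apply: IH.
Qed.

Lemma prefix_drop u v s c : prefix (u ++ v) (drop c s) =
  prefix u (drop c s) && prefix v (drop (c + size u) s).
Proof.
rewrite addnC -drop_drop; move: (drop c s) => {}s.
elim: u s => [|x u IH] s; first by rewrite prefix0s drop0.
case: s => [|y s] //=.
by rewrite IH andbA.
Qed.

Lemma infix_dropP u s :
  (exists2 c, c <= size s & prefix u (drop c s)) <-> infix u s.
Proof.
split=> [[c _ /prefixP[v e]]|/infixP[v [v' ->]]].
  by apply/infixP; exists (take c s), v; rewrite -e cat_take_drop.
exists (size v); first by rewrite size_cat leq_addr.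
by rewrite drop_size_cat // prefix_prefix.
Qed.

Lemma infix_sep x u v v' : x \notin u ->
  infix u (v ++ x :: v') -> infix u v \/ infix u v'.
Proof.
move=> xu /infixP[s [s']]; elim: v s => [|y v IH] [|z s] /=.
- case: u xu => [|z u] /=; first by left; rewrite ?infix0s.
  by rewrite inE => /norP[/eqP nxz _] [exz]; case: nxz.
- by move=> [_ ->]; right; rewrite infix_infix.
- case: u {IH} xu => [|z u] xu e; first by left; rewrite ?infix0s.
  left; suff: prefix (z :: u) (y :: v) by apply: prefixW.
  move: e; rewrite -!cat_cons; move: (z :: u) (y :: v) xu => {}u {}v.
  elim: u v => [|a u IH] [|b v] //=; rewrite ?inE.
    by move=> /norP[/eqP nxa _] [exa]; case: nxa.
  by move=> /norP[_ xu] [-> /(IH _ xu)->]; rewrite eqxx.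
by move=> [_ /IH[] uv]; [left; rewrite uv orbT|right].
Qed.

End Words.

Section Queries.

Variables (L : finType) (M : nat).

(* Letters [inr i] delimit the values of the variables, which are written at the
   end of the word. *)
Notation B := (L + 'I_M.+1)%type.
Implicit Types (sigma : nat -> seq L) (s : seq B) (K : seq B -> Prop).

Definition marker i : B := inr (inord i).

Definition plain (z : seq L) : seq B := [seq inl x | x <- z].

Definition is_marker (x : option B) := if x is Some (inr _) then true else false.

Definition same_letter (x y : option B) :=
  if x is Some (inl a) then if y is Some (inl b) then a == b else false else false.

(** Pointer [d] is guessed at marker [i]; then both pointers advance over equal letters until [d]
    meets the next marker. *)
Definition match_var i (P : seq B -> nat -> nat -> Prop) : seq B -> nat -> nat -> Prop :=
  fun s c d => loop (fun _ _ => true) Keep Shift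
    (fun s c d => onth s d == Some (marker i) /\
       loop same_letter Shift Shift (fun s c d => is_marker (onth s d) /\ P s c d)
         s (moved Keep s c) (moved Shift s d)) s (moved Keep s c) (moved Reset s d).

Fixpoint match_pattern (p : pattern L) K : seq B -> nat -> nat -> Prop :=
  match p with
  | [::] => fun s _ _ => K s
  | inl b :: p' => fun s c d => onth s c == Some (inl b) /\
      match_pattern p' K s (moved Shift s c) (moved Keep s d)
  | inr i :: p' => match_var i (match_pattern p' K)
  end.

Lemma decided_match_pattern p K : decided1 K -> decided2 (match_pattern p K).
Proof.
move=> dK; elim: p => [|[b|i] p IH] //=.
  exact: (decided2_test (fun x _ => x == Some (inl b)) (decided2_move Shift Keep IH)).
have d1 := decided2_test (fun _ y => is_marker y) IH.
have d2 := decided2_move Keep Shift (decided2_loop same_letter Shift Shift d1).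
have d3 := decided2_test (fun _ y => y == Some (marker i)) d2.
exact: (decided2_move Keep Reset (decided2_loop (fun _ _ => true) Keep Shift d3)).
Qed.

Definition match_item (x : bool * pattern L) K : seq B -> Prop := fun s =>
  if x.1 then match_pattern x.2 K s 0 0
  else loop (fun _ _ => true) Shift Keep (match_pattern x.2 K) s 0 0.

Lemma decided_match_item x K : decided1 K -> decided1 (match_item x K).
Proof.
move=> dK; rewrite /match_item /decided1; case: x.1.
  exact: (decided2_move Reset Reset (decided_match_pattern _ dK)).
apply: (decided2_move Reset Reset (decided2_loop _ _ _ (decided_match_pattern _ dK))).
Qed.

Definition match_query (q : seq (bool * pattern L)) : seq B -> Prop :=
  foldr match_item (fun=> True) q.

Lemma decided_match_query q : decided1 (match_query q).
Proof. by elim: q => [|x q IH]; [apply: decided1_true | apply: decided_match_item]. Qed.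

Definition match_queries (qs : seq (seq (bool * pattern L))) : seq B -> Prop :=
  fun s => exists2 q, q \in qs & match_query q s.

Lemma decided_match_queries qs : decided1 (match_queries qs).
Proof.
elim: qs => [|q qs IH].
  by apply: (@decided1_ext B (fun=> False)) => [s|]; [split=> // -[] | apply: decided1_false].
apply: (@decided1_ext B (fun s => match_query q s \/ match_queries qs s)) => [s|];
  last exact: decided1_or (decided_match_query q) IH.
split.
  by case=> [mq|[q' q'qs mq]]; [exists q | exists q']; rewrite ?mem_head // inE q'qs orbT.
by case=> q'; rewrite inE => /orP[/eqP->|q'qs mq]; [left | right; exists q'].
Qed.

Definition var_letter (V : pred L) : pred B := fun x => if x is inl a then V a else false.

Lemma all_var_letter (V : pred L) v :
  all (var_letter V) v <-> exists2 z, v = plain z & all V z.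
Proof.
split=> [|[z -> /=]]; last by elim: z => //= x z IH /andP[-> /IH].
elim: v => [|x v IH] /=; first by exists [::].
by case: x => //= x /andP[Vx /IH[z -> Vz]]; exists (x :: z); rewrite /= ?Vx.
Qed.

Fixpoint write_vars (V : pred L) (l : seq nat) K : seq B -> Prop :=
  if l is i :: l' then fun s =>
    exists2 v, all (var_letter V) v & write_vars V l' K (s ++ marker i :: v)
  else K.

Lemma decided_write_vars V l K : decided1 K -> decided1 (write_vars V l K).
Proof. by move=> dK; elim: l => //= i l; apply: decided1_append. Qed.

Definition var_blocks sigma l : seq B := flatten [seq marker i :: plain (sigma i) | i <- l].

Lemma write_varsP V l K s : uniq l -> write_vars V l K s <->
  exists2 sigma, forall i, all V (sigma i) & K (s ++ var_blocks sigma l).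
Proof.
elim: l s => [|i l IH] s /=.
  by move=> _; rewrite /var_blocks /= cats0; split=> [Ks|[]//]; exists (fun=> [::]).
move=> /andP[il ul]; split.
  move=> [v /all_var_letter[z -> Vz]] /(IH _ ul)[sigma Vs Ks].
  exists (fun j => if j == i then z else sigma j) => [j|]; first by case: ifP.
  move: Ks; rewrite /var_blocks /= eqxx -catA /=; congr (K (_ ++ (_ :: _ ++ flatten _))).
  by apply/eq_in_map => j jl; case: eqP => // eji; rewrite -eji jl in il.
move=> [sigma Vs Ks]; exists (plain (sigma i)).
  by apply/all_var_letter; exists (sigma i).
by apply/IH => //; exists sigma; rewrite // -catA.
Qed.

(** The extra marker [M] closes the block of the last variable, so that every block is followed by a
    marker. *)
Definition layout sigma (body : seq L) : seq B :=
  plain body ++ var_blocks sigma (iota 0 M) ++ [:: marker M].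

Lemma marker_inj i j : i <= M -> j <= M -> marker i = marker j -> i = j.
Proof. by move=> ? ? [/(congr1 val)]; rewrite /= !inordK. Qed.

Lemma marker_blocks sigma l i : all (leq^~ M) l -> i <= M ->
  (marker i \in var_blocks sigma l) = (i \in l).
Proof.
move=> + iM; elim: l => //= j l IH /andP[jM lM].
rewrite /var_blocks /= !inE mem_cat IH //.
have -> : (marker i \in plain (sigma j)) = false by apply/negP => /mapP[].
by congr (_ || _); apply/eqP/eqP => [/marker_inj->|->].
Qed.

Lemma marker_plain i z : (marker i \in plain z) = false.
Proof. by apply/negP => /mapP[]. Qed.

Lemma layout_split sigma body i : i < M -> exists u j v,
  [/\ layout sigma body = u ++ marker i :: plain (sigma i) ++ inr j :: v,
      marker i \notin u & marker i \notin plain (sigma i) ++ inr j :: v].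
Proof.
move=> iM; have iM' := ltnW iM; have eM : iota 0 M = iota 0 i ++ i :: iota i.+1 (M - i.+1).
  by rewrite -{1}(subnKC (ltnW iM)) iotaD add0n -(subnSK iM).
pose rest := var_blocks sigma (iota i.+1 (M - i.+1)) ++ [:: marker M].
have [j [v ev]] : exists j v, rest = inr j :: v.
  rewrite /rest; case: (M - i.+1) => [|k]; first by exists (inord M), [::].
  by eexists; eexists.
have all1 : all (leq^~ M) (iota 0 i).
  by apply/allP => k; rewrite mem_iota add0n => /andP[_ /ltnW ki]; apply: leq_trans (ltnW iM).
have all2 : all (leq^~ M) (iota i.+1 (M - i.+1)).
  by apply/allP => k; rewrite mem_iota => /andP[_]; rewrite subnKC // => /ltnW.
exists (plain body ++ var_blocks sigma (iota 0 i)), j, v; rewrite -ev; split.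
- rewrite /layout eM /var_blocks map_cat flatten_cat /= /rest.
  by rewrite -!catA /= -!catA.
- rewrite mem_cat marker_plain marker_blocks ?iM' // mem_iota.
  by rewrite add0n ltnn.
rewrite mem_cat marker_plain mem_cat marker_blocks ?iM' // mem_iota ltnn inE /=.
by apply/eqP => /(marker_inj iM' (leqnn _)) e; rewrite e ltnn in iM.
Qed.

Lemma search_c P s c d : c <= size s ->
  loop (fun _ _ => true) Shift Keep P s c d <->
  exists2 c', c <= c' <= size s & P s c' d.
Proof.
move=> cs; split.
  move=> lp; elim: lp cs => {c d} [c d Pcd|c d _ _ IH] cs; first by exists c; rewrite ?leqnn.
  have [|c' /andP[le1 le2] Pc'] := IH; first exact: geq_minr.
  exists c' => //; rewrite le2 andbT; apply: leq_trans le1.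
  by rewrite leq_min leqnSn.
move=> [c' /andP[/subnKC <-]]; move: (c' - c) => k {c' cs}.
elim: k c => [|k IH] c; rewrite ?addn0; first by move=> _; apply: LoopStop.
rewrite -addSnnS => le Pk; apply: LoopMove => //=.
by rewrite (minn_idPl (leq_trans (leq_addr _ _) le)); apply: IH.
Qed.

Lemma search_d P s c d : d <= size s ->
  loop (fun _ _ => true) Keep Shift P s c d <->
  exists2 d', d <= d' <= size s & P s c d'.
Proof.
move=> ds; split.
  move=> lp; elim: lp ds => {c d} [c d Pcd|c d _ _ IH] ds; first by exists d; rewrite ?leqnn.
  have [|d' /andP[le1 le2] Pd'] := IH; first exact: geq_minr.
  exists d' => //; rewrite le2 andbT; apply: leq_trans le1.
  by rewrite leq_min leqnSn.
move=> [d' /andP[/subnKC <-]]; move: (d' - d) => k {d' ds}.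
elim: k d => [|k IH] d; rewrite ?addn0; first by move=> _; apply: LoopStop.
rewrite -addSnnS => le Pk; apply: LoopMove => //=.
by rewrite (minn_idPl (leq_trans (leq_addr _ _) le)); apply: IH.
Qed.

Lemma moved_shift s k x : onth s k = Some x -> moved Shift s k = k.+1.
Proof. by move/onth_size => ks; rewrite /= (minn_idPl ks). Qed.

(** The loop can stop only with [d] at a marker and can move only off one, so it compares exactly
    [z]. *)
Lemma lock_step P z j v s c d : drop d s = plain z ++ inr j :: v ->
  loop same_letter Shift Shift (fun s c d => is_marker (onth s d) /\ P s c d) s c d <->
  prefix (plain z) (drop c s) /\ P s (c + size z) (d + size z).
Proof.
elim: z c d => [|x z IH] c d /drop_onth[od ed].
  rewrite prefix0s !addn0 loopE od; split=> [[[]//|[]]|[_ Pcd]]; last by left.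
  by rewrite /same_letter; case: onth => [[]|].
rewrite loopE od; split=> [[[]//|[]]|[]].
  rewrite /same_letter; case oc: onth => [[y|]|] //= /eqP exy.
  rewrite -[minn c.+1 _]/(moved Shift s c) -[minn d.+1 _]/(moved Shift s d).
  rewrite (moved_shift oc) (moved_shift od) => /(IH _ _ ed).
  by rewrite (onth_drop oc) exy /= eqxx !addSnnS.
case ec: (drop c s) => [|y u] //=; move/drop_onth: (ec) => [oc ec'].
move=> /andP[/eqP exy pz] Pcd; right; split; first by rewrite oc -exy /= eqxx.
rewrite -[minn c.+1 _]/(moved Shift s c) -[minn d.+1 _]/(moved Shift s d).
rewrite (moved_shift oc) (moved_shift od); apply/(IH _ _ ed).
by rewrite ec' pz !addSnnS.
Qed.

(** The statement allows any [d] because each variable resets it; each marker occurs once, so the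
    guess of [d] finds the right block. *)
Lemma match_patternP sigma body p K c d :
  all (fun x => if x is inr i then i < M else true) p ->
  match_pattern p K (layout sigma body) c d <->
  prefix (plain (subst sigma p)) (drop c (layout sigma body)) /\ K (layout sigma body).
Proof.
set s := layout sigma body; elim: p c d => [|[b|i] p IH] c d => [_|vp|/andP[iM vp]];
  rewrite [match_pattern _ _ _ _ _]/=.
- by rewrite prefix0s; split=> // -[].
- rewrite IH // subst_cons /plain map_cat -/(plain _).
  rewrite prefix_drop /=; case oc: (onth s c) => [x|]; last first.
    rewrite (onth_None oc).
    by split=> [[]|[]].
  rewrite (onth_drop oc) /= (minn_idPl (onth_size oc)) prefix0s andbT addn1.
  split=> [[/eqP[->] [-> ?]]|[/andP[/eqP<- -> ?]]]; by rewrite eqxx.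
rewrite subst_cons /plain map_cat -/(plain _) -/(plain _).
rewrite prefix_drop size_map /match_var search_d //.
have [u [j [v [es nu nv]]]] := layout_split sigma body iM.
have at_marker d' : onth s d' = Some (marker i) ->
    drop d'.+1 s = plain (sigma i) ++ inr j :: v.
  move=> od; apply: (split_uniq nu nv (u' := take d' s)).
  by rewrite -(onth_drop od) cat_take_drop -es.
have szu : onth s (size u) = Some (marker i).
  by rewrite /s es; elim: (u).
split.
  move=> [d' _ [/eqP od]]; rewrite (moved_shift od) (lock_step _ _ (at_marker _ od)).
  by rewrite IH // => -[-> [-> ?]].
move=> [/andP[p1 p2] Ks]; exists (size u); first exact: ltnW (onth_size szu).
rewrite szu eqxx (moved_shift szu) (lock_step _ _ (at_marker _ szu)) IH //.
Qed.

End Queries.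

(** * The game of questions, answers and queries *)

Section QueryGame.

Variables (L : finType) (hash dollar : L) (C V : pred L).
Variable qs : seq (seq (bool * pattern L)).
(** The check writes the values of the variables behind the body. An unanchored pattern contains
    [hash], which no value contains, so it cannot match there. *)
Hypothesis V_hash : ~~ V hash.
Hypothesis qs_hash : forall q x, q \in qs -> x \in q -> x.1 || (inl hash \in x.2).
Implicit Types (body : seq L) (sigma : nat -> seq L).

Definition item_match sigma body (x : bool * pattern L) : bool :=
  if x.1 then prefix (subst sigma x.2) body else infix (subst sigma x.2) body.

Definition query_holds body : Prop := exists2 sigma, forall i, all V (sigma i) &
  exists2 q, q \in qs & all (item_match sigma body) q.

(** The final [hash] closes the last entry, as the opening [hash] of the next entry closes the
    others. *)
Inductive query_game : seq L -> Prop :=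
  | QueryStop body : query_holds (rcons body hash) -> query_game body
  | QueryMove body u : all C u ->
      (forall v, all V v -> query_game (body ++ hash :: u ++ dollar :: v)) ->
      query_game body.

Definition var_bound (y : L + nat) : nat := if y is inr i then i.+1 else 0.

Definition item_bound (x : bool * pattern L) : nat := \max_(y <- x.2) var_bound y.

Definition num_vars := \max_(q <- qs) \max_(x <- q) item_bound x.

Lemma num_varsP q x : q \in qs -> x \in q ->
  all (fun y => if y is inr i then i < num_vars else true) x.2.
Proof.
move=> q_qs x_q; apply/allP => -[//|i] i_x.
apply: (@leq_trans (item_bound x)); first exact: (leq_bigmax_seq (F := var_bound) (inr i)).
apply: (@leq_trans (\max_(x <- q) item_bound x)); first exact: leq_bigmax_seq.
exact: (leq_bigmax_seq (F := fun q => \max_(x <- q) item_bound x)).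
Qed.

Notation M := num_vars.
Notation B := (L + 'I_M.+1)%type.

Lemma prefix_sep (T : eqType) (x : T) u v v' : x \notin u ->
  prefix u (v ++ x :: v') = prefix u v.
Proof.
elim: u v => [|a u IH] [|b v] //=; rewrite ?inE ?prefix0s //.
  by move=> /norP[xa _]; rewrite eq_sym (negPf xa).
by move=> /norP[_ xu]; rewrite IH.
Qed.

Lemma inr_plain j (z : seq L) : (inr j : B) \notin plain M z.
Proof. by apply/mapP => -[]. Qed.

Lemma prefix_plain (u v : seq L) : prefix (plain M u) (plain M v) = prefix u v.
Proof. by elim: u v => [|x u IH] [|y v] //=; rewrite IH. Qed.

Lemma infix_plain (u v : seq L) : infix (plain M u) (plain M v) = infix u v.
Proof.
elim: v => [|y v IH]; first by case: u.
by rewrite -[RHS]/(prefix u (y :: v) || infix u v) -IH -prefix_plain.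
Qed.

(** An occurrence of a plain word cannot run across a marker, and no block contains [hash]. *)
Lemma infix_var_blocks sigma z l : (forall i, all V (sigma i)) -> hash \in z ->
  ~ infix (plain M z) (var_blocks M sigma l ++ [:: marker L M M]).
Proof.
move=> Vs hz.
have plainV v : all V v -> ~ infix (plain M z) (plain M v).
  rewrite infix_plain => /allP Vv /mem_infix/(_ _ hz)/Vv; exact/negP.
elim: l => [|i l IH].
  rewrite -[var_blocks _ _ _ ++ _]/(plain M [::] ++ marker L M M :: plain M [::]).
  by move/(infix_sep (inr_plain _ _)) => []; apply: plainV.
have -> : var_blocks M sigma (i :: l) ++ [:: marker L M M] =
    plain M [::] ++ marker L M i :: plain M (sigma i) ++ (var_blocks M sigma l ++ [:: marker L M M]).
  by rewrite /var_blocks /= -catA.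
move/(infix_sep (inr_plain _ _)) => [|]; first exact: plainV.
have [j [v ev]] : exists j v, var_blocks M sigma l ++ [:: marker L M M] = inr j :: v.
  by case: l {IH} => [|k l]; [exists (inord M), [::] | exists (inord k); eexists].
rewrite ev; move/(infix_sep (inr_plain _ _)) => [|inf]; first exact: plainV.
by apply: IH; rewrite ev /= inf orbT.
Qed.

Lemma layout_marker sigma body : exists j v,
  layout M sigma body = plain M body ++ inr j :: v.
Proof.
rewrite /layout; case: (iota 0 M) => [|k l]; first by exists (inord M), [::].
by exists (inord k); eexists.
Qed.

Lemma match_itemP sigma body x K : (forall i, all V (sigma i)) ->
  x.1 || (inl hash \in x.2) ->
  all (fun y => if y is inr i then i < M else true) x.2 ->
  match_item x K (layout M sigma body) <->
  item_match sigma body x /\ K (layout M sigma body).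
Proof.
move=> Vs x_hash x_vars; rewrite /match_item /item_match; case: ifP x_hash => _ /= x_hash.
  rewrite match_patternP // drop0; have [j [v ->]] := layout_marker sigma body.
  by rewrite prefix_sep ?inr_plain // prefix_plain.
set s := layout M sigma body.
have -> : infix (subst sigma x.2) body = infix (plain M (subst sigma x.2)) s.
  apply/idP/idP; first by rewrite -infix_plain; apply: infix_catr.
  have hz : hash \in subst sigma x.2.
    elim: x.2 x_hash => // y p IH; rewrite inE subst_cons mem_cat.
    by case/orP => [/eqP<-|/IH->]; rewrite ?mem_head ?orbT.
  have [j [v ev]] := layout_marker sigma body.
  rewrite /s ev => /(infix_sep (inr_plain _ _)); rewrite infix_plain => -[//|inf].
  case: (@infix_var_blocks sigma (subst sigma x.2) (iota 0 M) Vs hz).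
  have /eqP := ev; rewrite /layout eqseq_cat // => /andP[_ /eqP->].
  by rewrite /= inf orbT.
rewrite search_c // -infix_dropP; split.
  by move=> [c /andP[_ le]]; rewrite match_patternP // => -[pc Ks]; split=> //; exists c.
move=> [[c le pc] Ks]; exists c; rewrite ?leq0n //.
by rewrite match_patternP.
Qed.

Lemma match_queryP sigma body q : (forall i, all V (sigma i)) -> q \in qs ->
  match_query q (layout M sigma body) <-> all (item_match sigma body) q.
Proof.
move=> Vs q_qs.
have /allP : all (fun x => (x.1 || (inl hash \in x.2)) &&
    all (fun y => if y is inr i then i < M else true) x.2) q.
  by apply/allP => x xq; rewrite (qs_hash q_qs) // (num_varsP q_qs).
elim: q {q_qs} => //= x q IH Hq.
have /andP[x1 x2] := Hq x (mem_head _ _).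
rewrite match_itemP // IH; first by split=> [[-> ->]|/andP].
by move=> y yq; apply: Hq; rewrite inE yq orbT.
Qed.

(** With [pred0], the appended tail is empty and the append operation writes a single letter. *)
Definition final_check : seq B -> Prop := fun s =>
  exists2 v, all pred0 v & write_vars (M := M) V (iota 0 M)
    (fun s => exists2 v, all pred0 v & match_queries qs (s ++ marker L M M :: v))
    (s ++ inl hash :: v).

Lemma final_checkP body : final_check (plain M body) <-> query_holds (rcons body hash).
Proof.
have e sigma : (plain M body ++ [:: inl hash]) ++ var_blocks M sigma (iota 0 M) ++
    [:: marker L M M] = layout M sigma (rcons body hash).
  by rewrite /layout /plain map_rcons -cats1.
have all0 (v : seq B) : all pred0 v -> v = [::] by case: v.
split.
  move=> [v /all0-> /write_varsP]; rewrite iota_uniq => -[//|sigma Vs [u /all0->]].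
  rewrite -catA e => -[q q_qs /(match_queryP _ Vs q_qs) mq].
  by exists sigma => //; exists q.
move=> [sigma Vs [q q_qs mq]]; exists [::] => //.
apply/write_varsP; first exact: iota_uniq.
exists sigma => //; exists [::] => //; rewrite -catA e; exists q => //.
exact/match_queryP.
Qed.

Lemma decided_game_final : decided1
  (append_game (inl hash) (var_letter C) (inl dollar) (var_letter V) final_check).
Proof.
apply/decided1_game/decided1_append/decided_write_vars/decided1_append.
exact: decided_match_queries.
Qed.

Lemma append_gameP body :
  append_game (inl hash) (var_letter C) (inl dollar) (var_letter V) final_check
    (plain M body) <-> query_game body.
Proof.
split.
  move eb: (plain M body) => s gm; elim: gm body eb => {s} [s fc|s u Cu _ IH] body eb.
    by apply: QueryStop; apply/final_checkP; rewrite eb.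
  have [z ez Cz] := proj1 (all_var_letter _ _) Cu.
  apply: (QueryMove Cz) => v Vv; apply: (IH (plain M v)).
    by apply/all_var_letter; exists v.
  by rewrite -eb ez /plain map_cat /= map_cat -!catA.
elim=> {body} [body /final_checkP|body u Cu _ IH]; first exact: AppendStop.
apply: (AppendMove (u := plain M u)); first by apply/all_var_letter; exists u.
move=> v' /all_var_letter[v -> Vv].
by have := IH v Vv; rewrite /plain map_cat /= map_cat -!catA.
Qed.

Lemma query_game_atm (Sigma : finType) (iota : Sigma -> L) :
  exists M : ATM Sigma, forall w : seq Sigma,
    atm_language M w <-> query_game [seq iota b | b <- w].
Proof.
have [S [s0 [_ HS]]] := decided_game_final.
pose j b : B * (bool * bool) := (inl (iota b), (false, false)).
exists (simulator (memory0 _) s0 j) => w.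
rewrite simulatorP HS -append_gameP /letters -map_comp /plain -map_comp.
by [].
Qed.

End QueryGame.

(** * Local conditions on truth valuations *)

Section Templates.

Variable Sigma : finType.
Implicit Types (sig : nat -> seq Sigma) (p : pattern Sigma) (l : seq (seq Sigma)).

(* A key [inl (pi, l)] asks for the value, in the environment [l], of the
   subformula or subterm at position [pi]; a key [inr x] asks for f(x). *)
Definition key (T : Type) : Type := (seq bool * seq T + T)%type.

Definition key_map T T' (h : T -> T') (k : key T) : key T' :=
  match k with inl (pi, l) => inl (pi, [seq h x | x <- l]) | inr x => inr (h x) end.

Definition query := seq (key (pattern Sigma) * pattern Sigma).

Implicit Types (G : key (seq Sigma) -> seq Sigma) (q : query).

Definition violated G q : Prop :=
  exists sig, all (fun kp => G (key_map (subst sig) kp.1) == subst sig kp.2) q.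

(* In a template the environment is implicit: it is appended to that of each key,
   and the variables are numbered from the end of the environment on.  The first
   component may impose that an entry of the environment match a pattern. *)
Definition template := (option (nat * pattern Sigma) * query)%type.

Implicit Types (tq : template).

Definition key_in l (k : key (seq Sigma)) : key (seq Sigma) :=
  match k with inl (pi, x) => inl (pi, x ++ l) | inr x => inr x end.

Definition template_matches G l sig tq : bool :=
  (if tq.1 is Some (i, p) then nth [::] l i == subst sig p else true) &&
  all (fun kp => G (key_in l (key_map (subst sig) kp.1)) == subst sig kp.2) tq.2.

Definition pshift n p : pattern Sigma :=
  [seq match x with inl a => inl a | inr i => inr (n + i) end | x <- p].

(** The first [n] variables stand for the environment, except that a constrained entry is replaced
    by its shifted pattern. *)
Definition env_pattern n (o : option (nat * pattern Sigma)) : seq (pattern Sigma) :=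
  [seq if o is Some (i, p) then if j == i then pshift n p else [:: inr j]
       else [:: inr j] | j <- iota 0 n].

Definition template_query n tq : query :=
  [seq (match key_map (pshift n) kp.1 with
        | inl (pi, x) => inl (pi, x ++ env_pattern n tq.1) | inr x => inr x
        end, pshift n kp.2) | kp <- tq.2].

Lemma subst_shift sig n p : subst sig (pshift n p) = subst (fun j => sig (n + j)) p.
Proof. by elim: p => //= -[a|i] p IH; rewrite !subst_cons IH. Qed.

Lemma subst_var sig j : subst sig [:: inr j] = sig j.
Proof. by rewrite /subst /= cats0. Qed.

Lemma template_queryP G n tq : (if tq.1 is Some (i, p) then i < n else true) ->
  violated G (template_query n tq) <->
  exists l sig, size l = n /\ template_matches G l sig tq.
Proof.
case: tq => o q /= on.
have entries sig l : [seq subst sig p | p <- env_pattern n o] = l ->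
    all (fun kp => G (key_map (subst sig) kp.1) == subst sig kp.2)
      (template_query n (o, q)) =
    all (fun kp => G (key_in l (key_map (subst (fun j => sig (n + j))) kp.1)) ==
      subst (fun j => sig (n + j)) kp.2) q.
  move=> el; rewrite /template_query all_map /=; apply: eq_all => -[k p] /=.
  rewrite subst_shift; congr (G _ == _); case: k => [[pi x]|x] /=.
    rewrite map_cat el -map_comp; congr (inl (_, _ ++ _)).
    by apply: eq_map => y /=; rewrite subst_shift.
  by rewrite subst_shift.
split=> [[sig]|[l [sig [sl /andP[/= ol lq]]]]].
  pose l := [seq subst sig p | p <- env_pattern n o].
  rewrite (entries _ l) // => lq; exists l, (fun j => sig (n + j)); split.
    by rewrite !size_map size_iota.
  rewrite /template_matches lq andbT; case: o on @l {lq entries} => [[i p]|] //= li.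
  rewrite /env_pattern -map_comp (nth_map 0) ?size_iota // nth_iota //= add0n eqxx.
  by rewrite subst_shift.
pose sig' j := if j < n then nth [::] l j else sig (j - n).
have e' : (fun j => sig' (n + j)) = sig.
  apply: functional_extensionality => j; rewrite /sig' ltnNge leq_addr /=.
  by rewrite addKn.
exists sig'; rewrite (entries _ l) ?e' //.
rewrite /env_pattern -map_comp -[RHS](take_size l) sl -(map_nth_iota0 [::]) ?sl //.
apply/eq_in_map => j; rewrite mem_iota add0n => /andP[_ jn] /=.
case: o on ol {entries} => [[i p]|] /=; last by rewrite subst_var /sig' jn.
move=> li /eqP nl; case: eqP => [->|_]; last by rewrite subst_var /sig' jn.
by rewrite subst_shift e' nl.
Qed.

(* Pairs of patterns describing the pairs (x, y) such that y is not a prefix of x. *)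
Definition nonprefix_patterns : seq (pattern Sigma * pattern Sigma) :=
  [seq ([:: inr 0; inl ab.1; inr 1], [:: inr 0; inl ab.2; inr 2]) |
    ab <- enum {: Sigma * Sigma} & ab.1 != ab.2] ++
  [seq ([:: inr 0], [:: inr 0; inl a; inr 1]) | a <- enum Sigma].

Definition distinct_patterns : seq (pattern Sigma * pattern Sigma) :=
  nonprefix_patterns ++ [seq ([:: inr 0; inl a; inr 1], [:: inr 0]) | a <- enum Sigma].

(* The triples (x, y, z) such that x <> y ++ z. *)
Definition noncat_patterns : seq (pattern Sigma * (pattern Sigma * pattern Sigma)) :=
  [seq (pq.1, (pq.2, [:: inr 3])) | pq <- nonprefix_patterns] ++
  [seq (inr 3 :: pq.1, ([:: inr 3], pq.2)) | pq <- distinct_patterns].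

(** Truth is coded by being nonempty, hence one pattern per first letter, with variable [i] as the
    tail. *)
Definition truth_patterns (b : bool) (i : nat) : seq (pattern Sigma) :=
  if b then [seq [:: inl a; inr i] | a <- enum Sigma] else [:: [::]].

Definition truth (v : seq Sigma) : bool := v != [::].

Notation vals := (nth [::]).

Lemma truth_patterns_sound b i p sig :
  p \in truth_patterns b i -> truth (subst sig p) = b.
Proof.
case: b => /=; last by rewrite inE => /eqP->.
by case/mapP => a _ ->.
Qed.

Lemma truth_patterns_complete v i : exists2 x, True &
  exists2 p, p \in truth_patterns (truth v) i & forall sig, sig i = x -> subst sig p = v.
Proof.
case: v => [|a v]; first by exists [::] => //; exists [::]; rewrite ?inE.
exists v => //; exists [:: inl a; inr i]; first by apply: map_f; rewrite mem_enum.
by move=> sig <-; rewrite /subst /= cats0.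
Qed.

Lemma nonprefix_patterns_sound pq sig : pq \in nonprefix_patterns ->
  ~~ prefix (subst sig pq.2) (subst sig pq.1).
Proof.
have pre (x u v : seq Sigma) : prefix (x ++ u) (x ++ v) = prefix u v.
  by elim: x => //= a x ->; rewrite eqxx.
rewrite mem_cat => /orP[/mapP[[a b] + ->]|/mapP[a _ ->]].
  rewrite mem_filter /subst /= => /andP[ab _].
  by rewrite pre /= eq_sym (negPf ab).
by rewrite /subst /= !cats0 -{2}[sig 0]cats0 pre.
Qed.

(** [z] is the longest common prefix: after it the letters differ, or [u] has ended. *)
Lemma nonprefix_split u v : ~~ prefix v u -> exists z,
  (exists a b u' v', [/\ a != b, u = z ++ a :: u' & v = z ++ b :: v' :> seq Sigma]) \/
  (exists a v', u = z /\ v = z ++ a :: v').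
Proof.
elim: v u => [|b v IH] [|a u] //=; rewrite ?prefix0s //.
  by move=> _; exists [::]; right; exists b, v.
have [<- /= /IH[z [[x [y [u' [v' [xy -> ->]]]]]|[x [v' [-> ->]]]]]|ba _] := eqVneq b a.
- by exists (b :: z); left; exists x, y, u', v'.
- by exists (b :: z); right; exists x, v'.
by exists [::]; left; exists a, b, u, v; rewrite eq_sym.
Qed.

Lemma nonprefix_patterns_complete u v : ~~ prefix v u -> exists x0 x1 x2,
  exists2 pq, pq \in nonprefix_patterns & forall sig, sig 0 = x0 -> sig 1 = x1 ->
    sig 2 = x2 -> subst sig pq.1 = u /\ subst sig pq.2 = v.
Proof.
move=> /nonprefix_split[z [[a [b [u' [v' [ab -> ->]]]]]|[a [v' [-> ->]]]]].
  exists z, u', v', ([:: inr 0; inl a; inr 1], [:: inr 0; inl b; inr 2]).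
    rewrite mem_cat; apply/orP; left; apply/mapP; exists (a, b) => //.
    by rewrite mem_filter mem_enum ab.
  by move=> sig e0 e1 e2; rewrite /subst /= e0 e1 e2 !cats0.
exists z, v', [::], ([:: inr 0], [:: inr 0; inl a; inr 1]).
  by rewrite mem_cat; apply/orP; right; apply: map_f; rewrite mem_enum.
by move=> sig e0 e1 e2; rewrite /subst /= e0 e1 !cats0.
Qed.

Lemma distinct_patterns_sound pq sig : pq \in distinct_patterns ->
  subst sig pq.1 <> subst sig pq.2.
Proof.
rewrite mem_cat => /orP[/(nonprefix_patterns_sound sig) + e|/mapP[a _ ->]].
  by rewrite e prefix_refl.
rewrite /subst /= !cats0 => /(congr1 size); rewrite size_cat /= => e; lia.
Qed.

Lemma distinct_patterns_complete u v : u <> v -> exists x0 x1 x2,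
  exists2 pq, pq \in distinct_patterns & forall sig, sig 0 = x0 -> sig 1 = x1 ->
    sig 2 = x2 -> subst sig pq.1 = u /\ subst sig pq.2 = v.
Proof.
have [/prefixP[[|a w] ->]|] := boolP (prefix v u); first by rewrite cats0.
  move=> _; exists v, w, [::], ([:: inr 0; inl a; inr 1], [:: inr 0]).
    by rewrite mem_cat; apply/orP; right; apply: map_f; rewrite mem_enum.
  by move=> sig e0 e1 e2; rewrite /subst /= e0 e1 !cats0.
move=> /nonprefix_patterns_complete[x0 [x1 [x2 [pq pq_in H]]]] _.
by exists x0, x1, x2, pq => //; rewrite mem_cat pq_in.
Qed.

Lemma noncat_patterns_sound pqr sig : pqr \in noncat_patterns ->
  subst sig pqr.1 <> subst sig pqr.2.1 ++ subst sig pqr.2.2.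
Proof.
rewrite mem_cat => /orP[] /mapP[pq pq_in ->] /=.
  move/(nonprefix_patterns_sound sig): pq_in => + e.
  by rewrite e prefix_prefix.
rewrite subst_var subst_cons => /eqP; rewrite eqseq_cat // eqxx => /eqP.
exact: distinct_patterns_sound.
Qed.

(** Either [v] is not a prefix of [u], and variable 3 takes the arbitrary [w], or [u] is [v ++ u']
    with [u'] distinct from [w], and variable 3 takes [v]. *)
Lemma noncat_patterns_complete u v w : u <> v ++ w -> exists x0 x1 x2 x3,
  exists2 pqr, pqr \in noncat_patterns & forall sig, sig 0 = x0 -> sig 1 = x1 ->
    sig 2 = x2 -> sig 3 = x3 ->
    [/\ subst sig pqr.1 = u, subst sig pqr.2.1 = v & subst sig pqr.2.2 = w].
Proof.
have [/prefixP[u' ->]|] := boolP (prefix v u).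
  move=> uw; have {uw} : u' <> w by move=> e; apply: uw; rewrite e.
  move=> /distinct_patterns_complete[x0 [x1 [x2 [pq pq_in H]]]].
  exists x0, x1, x2, v, (inr 3 :: pq.1, ([:: inr 3], pq.2)).
    by rewrite mem_cat; apply/orP; right; apply: map_f.
  move=> sig e0 e1 e2 e3; have [e4 e5] := H _ e0 e1 e2.
  by rewrite /= subst_cons subst_var e3 e4 e5.
move=> /nonprefix_patterns_complete[x0 [x1 [x2 [pq pq_in H]]]] _.
exists x0, x1, x2, w, (pq.1, (pq.2, [:: inr 3])).
  by rewrite mem_cat; apply/orP; left; apply: (map_f (fun pq => (pq.1, (pq.2, [:: inr 3])))).
by move=> sig e0 e1 e2 e3; have [-> ->] := H _ e0 e1 e2; rewrite subst_var.
Qed.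

End Templates.

(** * Queries expressing that a truth valuation is violated *)

Section LocalConditions.

Variable Sigma : finType.
Implicit Types (sig : nat -> seq Sigma) (p : pattern Sigma) (l : seq (seq Sigma)).
Implicit Types (pi : seq bool) (S : seq (template Sigma)).

Definition at_pos pi : key (pattern Sigma) := inl (pi, [::]).

(** Variables 0, 1, 2 are the tails of the three values; 3 is left to [ext] and the keys. A
    condition on fewer keys repeats one of them. *)
Definition truth_templates (ext : query Sigma) (k0 k1 k2 : key (pattern Sigma))
    (bad : bool -> bool -> bool -> bool) : seq (template Sigma) :=
  [seq (None, ext ++ [:: (k0, ps.1); (k1, ps.2.1); (k2, ps.2.2)]) |
    ps <- flatten [seq allpairs pair (truth_patterns Sigma bs.1 0)
                         (allpairs pair (truth_patterns Sigma bs.2.1 1)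
                                        (truth_patterns Sigma bs.2.2 2))
                  | bs <- enum {: bool * (bool * bool)} & bad bs.1 bs.2.1 bs.2.2]].

Lemma truth_templatesP ext k0 k1 k2 bad tq :
  tq \in truth_templates ext k0 k1 k2 bad <-> exists b0 b1 b2 p0 p1 p2,
    [/\ bad b0 b1 b2, p0 \in truth_patterns Sigma b0 0,
        p1 \in truth_patterns Sigma b1 1, p2 \in truth_patterns Sigma b2 2 &
        tq = (None, ext ++ [:: (k0, p0); (k1, p1); (k2, p2)])].
Proof.
split.
  case/mapP => ps /flatten_mapP[[b0 [b1 b2]]]; rewrite mem_filter /= => /andP[bd _].
  case/allpairsP => -[p0 p12] /= [p0_in /allpairsP[[p1 p2] /= [p1_in p2_in ->]] ->] ->.
  by exists b0, b1, b2, p0, p1, p2.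
move=> [b0 [b1 [b2 [p0 [p1 [p2 [bd p0_in p1_in p2_in ->]]]]]]].
apply/mapP; exists (p0, (p1, p2)) => //; apply/flatten_mapP; exists (b0, (b1, b2)).
  by rewrite mem_filter mem_enum bd.
apply/allpairsP; exists (p0, (p1, p2)); split=> //.
by apply/allpairsP; exists (p1, p2).
Qed.

(** The failures are truth with distinct sides and falsity with equal sides. Variable 3 is the tail
    of the truth value because [distinct_patterns] occupies 0 to 2. *)
Definition eq_templates pi : seq (template Sigma) :=
  [seq (None, [:: (at_pos pi, tp.1); (at_pos (rcons pi false), tp.2.1);
                  (at_pos (rcons pi true), tp.2.2)]) |
    tp <- [seq (t, pq) | t <- truth_patterns Sigma true 3, pq <- distinct_patterns Sigma]] ++
  [:: (None, [:: (at_pos pi, [::]); (at_pos (rcons pi false), [:: inr 0]);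
                 (at_pos (rcons pi true), [:: inr 0])])].

(** All ways for the value to be wrong. For a letter: empty, wrong first letter, or too long. For
    [TFun], variable 3 carries the value of the argument into the key of [f]. *)
Definition term_templates n (t : term Sigma n) pi : seq (template Sigma) :=
  match t with
  | TVar i => [seq (Some (val i, pq.2), [:: (at_pos pi, pq.1)]) | pq <- distinct_patterns Sigma]
  | TEmpty => [seq (None, [:: (at_pos pi, [:: inl a; inr 0])]) | a <- enum Sigma]
  | TLetter a =>
      (None, [:: (at_pos pi, [::])]) ::
      [seq (None, [:: (at_pos pi, [:: inl b; inr 0])]) | b <- enum Sigma & b != a] ++
      [seq (None, [:: (at_pos pi, [:: inl a; inl b; inr 0])]) | b <- enum Sigma]
  | TCat t1 t2 => [seq (None, [:: (at_pos pi, pqr.1); (at_pos (rcons pi false), pqr.2.1);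
                    (at_pos (rcons pi true), pqr.2.2)]) | pqr <- noncat_patterns Sigma]
  | TFun t1 => [seq (None, [:: (at_pos pi, pq.1); (at_pos (rcons pi false), [:: inr 3]);
                    (inr [:: inr 3], pq.2)]) | pq <- distinct_patterns Sigma]
  end.

Fixpoint term_queries n (t : term Sigma n) pi : seq (query Sigma) :=
  [seq template_query n tq | tq <- term_templates t pi] ++
  match t with
  | TCat t1 t2 => term_queries t1 (rcons pi false) ++ term_queries t2 (rcons pi true)
  | TFun t1 => term_queries t1 (rcons pi false)
  | _ => [::]
  end.

Definition binary_templates (op : bool -> bool -> bool) pi :=
  truth_templates [::] (at_pos pi) (at_pos (rcons pi false)) (at_pos (rcons pi true))
    (fun b b1 b2 => b != op b1 b2).

(* [b] is the truth value that a single instance suffices to establish; the witness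
   is stored at the second child. *)
Definition quantifier_templates (b : bool) pi :=
  truth_templates [:: (at_pos (rcons pi true), [:: inr 3])] (at_pos pi)
    (inl (rcons pi false, [:: [:: inr 3]])) (at_pos pi)
    (fun b0 b1 _ => (b0 == b) && (b1 == ~~ b)) ++
  truth_templates [::] (at_pos pi) (inl (rcons pi false, [:: [:: inr 3]])) (at_pos pi)
    (fun b0 b1 _ => (b0 == ~~ b) && (b1 == b)).

(** Substring atoms contribute nothing, since [no_infix] eliminates them beforehand. *)
Fixpoint formula_queries n (phi : formula Sigma n) pi : seq (query Sigma) :=
  match phi with
  | FFalse n => [seq template_query n tq |
      tq <- truth_templates [::] (at_pos pi) (at_pos pi) (at_pos pi) (fun b _ _ => b)]
  | FEq n t1 t2 => [seq template_query n tq | tq <- eq_templates pi] ++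
      term_queries t1 (rcons pi false) ++ term_queries t2 (rcons pi true)
  | FSubstring _ _ _ => [::]
  | FNot n p => [seq template_query n tq |
      tq <- truth_templates [::] (at_pos pi) (at_pos (rcons pi false)) (at_pos pi)
              (fun b b1 _ => b == b1)] ++ formula_queries p (rcons pi false)
  | FAnd n p q => [seq template_query n tq | tq <- binary_templates andb pi] ++
      formula_queries p (rcons pi false) ++ formula_queries q (rcons pi true)
  | FOr n p q => [seq template_query n tq | tq <- binary_templates orb pi] ++
      formula_queries p (rcons pi false) ++ formula_queries q (rcons pi true)
  | FImp n p q => [seq template_query n tq | tq <- binary_templates implb pi] ++
      formula_queries p (rcons pi false) ++ formula_queries q (rcons pi true)
  | FForall n p => [seq template_query n tq | tq <- quantifier_templates false pi] ++
      formula_queries p (rcons pi false)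
  | FExists n p => [seq template_query n tq | tq <- quantifier_templates true pi] ++
      formula_queries p (rcons pi false)
  end.

Section Valuation.

Variable G : key (seq Sigma) -> seq Sigma.

Notation val pi l := (G (inl (pi, l))).

Fixpoint term_ok n (t : term Sigma n) pi : Prop :=
  match t with
  | TVar i => forall l, size l = n -> val pi l = nth [::] l i
  | TEmpty => forall l, size l = n -> val pi l = [::]
  | TLetter a => forall l, size l = n -> val pi l = [:: a]
  | TCat t1 t2 =>
      (forall l, size l = n -> val pi l = val (rcons pi false) l ++ val (rcons pi true) l) /\
      term_ok t1 (rcons pi false) /\ term_ok t2 (rcons pi true)
  | TFun t1 => (forall l, size l = n -> val pi l = G (inr (val (rcons pi false) l))) /\
      term_ok t1 (rcons pi false)
  end.

Definition binary_ok (op : bool -> bool -> bool) pi n : Prop :=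
  forall l, size l = n ->
    truth (val pi l) = op (truth (val (rcons pi false) l)) (truth (val (rcons pi true) l)).

Definition quantifier_ok (b : bool) pi n : Prop := forall l, size l = n ->
  (truth (val pi l) = b -> truth (val (rcons pi false) (val (rcons pi true) l :: l)) = b) /\
  (truth (val pi l) = ~~ b -> forall x, truth (val (rcons pi false) (x :: l)) = ~~ b).

Fixpoint formula_ok n (phi : formula Sigma n) pi : Prop :=
  match phi with
  | FFalse n => forall l, size l = n -> truth (val pi l) = false
  | FEq n t1 t2 =>
      (forall l, size l = n ->
        truth (val pi l) = (val (rcons pi false) l == val (rcons pi true) l)) /\
      term_ok t1 (rcons pi false) /\ term_ok t2 (rcons pi true)
  | FSubstring _ _ _ => True
  | FNot n p =>
      (forall l, size l = n -> truth (val pi l) = ~~ truth (val (rcons pi false) l)) /\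
      formula_ok p (rcons pi false)
  | FAnd n p q => binary_ok andb pi n /\
      formula_ok p (rcons pi false) /\ formula_ok q (rcons pi true)
  | FOr n p q => binary_ok orb pi n /\
      formula_ok p (rcons pi false) /\ formula_ok q (rcons pi true)
  | FImp n p q => binary_ok implb pi n /\
      formula_ok p (rcons pi false) /\ formula_ok q (rcons pi true)
  | FForall n p => quantifier_ok false pi n /\ formula_ok p (rcons pi false)
  | FExists n p => quantifier_ok true pi n /\ formula_ok p (rcons pi false)
  end.

Definition unviolated (qs : seq (query Sigma)) : Prop :=
  forall q, q \in qs -> ~ violated G q.

Lemma unviolated_cat qs1 qs2 :
  unviolated (qs1 ++ qs2) <-> unviolated qs1 /\ unviolated qs2.
Proof.
split=> [H|[H1 H2] q]; last by rewrite mem_cat => /orP[/H1|/H2].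
by split=> q q_in; apply: H; rewrite mem_cat q_in ?orbT.
Qed.

Definition avoids l S : Prop :=
  forall sig tq, tq \in S -> ~~ template_matches G l sig tq.

Lemma avoids_cat l S1 S2 : avoids l (S1 ++ S2) <-> avoids l S1 /\ avoids l S2.
Proof.
split=> [H|[H1 H2] sig tq]; last by rewrite mem_cat => /orP[/H1|/H2].
by split=> sig tq tq_in; apply: H; rewrite mem_cat tq_in ?orbT.
Qed.

Lemma unviolated_templates n S (cond : seq (seq Sigma) -> Prop) :
  all (fun tq : template Sigma => if tq.1 is Some (i, p) then i < n else true) S ->
  (forall l, size l = n -> avoids l S <-> cond l) ->
  unviolated [seq template_query n tq | tq <- S] <-> forall l, size l = n -> cond l.
Proof.
move=> /allP Sn Scond; split=> [H l ln|H q /mapP[tq tqS ->]].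
  apply/Scond => // sig tq tqS; apply/negP => m.
  apply: (H (template_query n tq)); first exact: map_f.
  by apply/template_queryP; [exact: Sn | exists l, sig].
move=> /template_queryP -/(_ (Sn _ tqS))[l [sig [ln m]]].
by have /Scond/(_ sig _ tqS) := H l ln; rewrite m => /(_ ln).
Qed.

(** Keys and [ext] depend on the substitution only through variable 3, so the tails of the truth
    values can be chosen freely and only [x] remains quantified. *)
Lemma avoids_truth l ext k0 k1 k2 bad kk0 kk1 kk2 (extb : pred (seq Sigma)) :
  (forall sig, key_in l (key_map (subst sig) k0) = kk0 (sig 3)) ->
  (forall sig, key_in l (key_map (subst sig) k1) = kk1 (sig 3)) ->
  (forall sig, key_in l (key_map (subst sig) k2) = kk2 (sig 3)) ->
  (forall sig, all (fun kp => G (key_in l (key_map (subst sig) kp.1)) == subst sig kp.2) ext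
     = extb (sig 3)) ->
  avoids l (truth_templates ext k0 k1 k2 bad) <->
  forall x, extb x -> ~~ bad (truth (G (kk0 x))) (truth (G (kk1 x))) (truth (G (kk2 x))).
Proof.
move=> e0 e1 e2 ee; split=> [H x ex|H sig tq].
  apply/negP => bd.
  have [x0 _ [p0 p0_in P0]] := truth_patterns_complete (G (kk0 x)) 0.
  have [x1 _ [p1 p1_in P1]] := truth_patterns_complete (G (kk1 x)) 1.
  have [x2 _ [p2 p2_in P2]] := truth_patterns_complete (G (kk2 x)) 2.
  pose sig := nth [::] [:: x0; x1; x2; x].
  have := H sig (None, ext ++ [:: (k0, p0); (k1, p1); (k2, p2)]).
  rewrite /template_matches /= all_cat ee ex /= e0 e1 e2 P0 // P1 // P2 // !eqxx.
  suff -> : (None, ext ++ [:: (k0, p0); (k1, p1); (k2, p2)]) \in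
    truth_templates ext k0 k1 k2 bad by move/(_ isT).
  apply/truth_templatesP.
  by exists (truth (G (kk0 x))), (truth (G (kk1 x))), (truth (G (kk2 x))), p0, p1, p2.
move=> /truth_templatesP[b0 [b1 [b2 [p0 [p1 [p2 [bd p0_in p1_in p2_in ->]]]]]]].
apply/negP; rewrite /template_matches /= all_cat ee /= e0 e1 e2.
move=> /andP[/H + /and4P[/eqP E0 /eqP E1 /eqP E2 _]].
by rewrite E0 E1 E2 !(truth_patterns_sound _ p0_in, truth_patterns_sound _ p1_in,
  truth_patterns_sound _ p2_in) bd.
Qed.

Lemma avoids_map (T : eqType) (s : seq T) (h : T -> template Sigma) l :
  avoids l [seq h x | x <- s] <->
  forall sig x, x \in s -> ~~ template_matches G l sig (h x).
Proof.
split=> [H sig x xs|H sig tq /mapP[x xs ->]]; last exact: H.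
by apply: H; apply: map_f.
Qed.

Lemma avoids_eq l pi : avoids l (eq_templates pi) <->
  truth (val pi l) = (val (rcons pi false) l == val (rcons pi true) l).
Proof.
set v := G _; set v1 := G _; set v2 := G _.
rewrite /eq_templates avoids_cat avoids_map; split=> [[H1 H2]|H].
  case: eqP => [e12|n12].
    case tv: (truth v) => //; have := H2 (fun=> v1) _ (mem_head _ _).
    rewrite /template_matches /= -/v -/v1 -/v2 -e12 subst_var eqxx.
    by move: tv; rewrite /truth => /negPn ->.
  case tv: (truth v) => //.
  have [xt _ [t]] := truth_patterns_complete v 3; rewrite tv => t_in Ht.
  have [x0 [x1 [x2 [pq pq_in Hpq]]]] := distinct_patterns_complete n12.
  pose sig := nth [::] [:: x0; x1; x2; xt].
  have tpq : (t, pq) \in [seq (t, pq) | t <- truth_patterns Sigma true 3,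
      pq <- distinct_patterns Sigma] by apply/allpairsP; exists (t, pq).
  have [e1 e2] := Hpq sig erefl erefl erefl.
  have := H1 sig _ tpq; rewrite /template_matches /= -/v -/v1 -/v2.
  by rewrite e1 e2 (Ht sig erefl) !eqxx.
split=> [sig x /allpairsP[[t pq] /= [t_in pq_in ->]]|sig tq].
  apply/negP; rewrite /template_matches /= -/v -/v1 -/v2 => /and4P[/eqP e /eqP e1 /eqP e2 _].
  move: H; rewrite e (@truth_patterns_sound _ true 3 _ _ t_in) => /esym/eqP; rewrite e1 e2.
  exact: distinct_patterns_sound.
rewrite inE => /eqP->; apply/negP; rewrite /template_matches /= -/v -/v1 -/v2 !subst_var.
by move=> /and4P[/eqP e /eqP e1 /eqP e2 _]; move: H; rewrite e e1 e2 eqxx.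
Qed.

Lemma avoids_term n (t : term Sigma n) pi l : size l = n ->
  avoids l (term_templates t pi) <-> val pi l =
    match t with
    | TVar i => nth [::] l i
    | TEmpty => [::]
    | TLetter a => [:: a]
    | TCat _ _ => val (rcons pi false) l ++ val (rcons pi true) l
    | TFun _ => G (inr (val (rcons pi false) l))
    end.
Proof.
move=> ln; set v := G (inl (pi, _)); case: t => [i||a|t1 t2|t1] /=.
- rewrite avoids_map; split=> [H|H sig pq pq_in].
    apply: NNPP => /distinct_patterns_complete[x0 [x1 [x2 [pq pq_in Hpq]]]].
    pose sig := nth [::] [:: x0; x1; x2].
    have [e1 e2] := Hpq sig erefl erefl erefl.
    by have := H sig _ pq_in; rewrite /template_matches /= -/v e1 e2 !eqxx.
  apply/negP; rewrite /template_matches /= -/v => /and3P[/eqP e1 /eqP e2 _].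
  by apply: (distinct_patterns_sound (sig := sig) pq_in); rewrite -e1 -e2.
- rewrite avoids_map; split=> [H|H sig a _]; last first.
    by rewrite /template_matches /= -/v H.
  case ev: v => [//|a u]; have := H (fun=> u) a; rewrite mem_enum => /(_ isT).
  by rewrite /template_matches /= -/v ev subst_cons subst_var /= eqxx.
- rewrite -cat1s !avoids_cat !avoids_map; split=> [[H1 [H2 H3]]|H].
    case ev: v => [|b u].
      by have := H1 (fun=> [::]) _ (mem_head _ _); rewrite /template_matches /= -/v ev.
    have [eba|nba] := eqVneq b a; last first.
      have := H2 (fun=> u) b; rewrite mem_filter nba mem_enum => /(_ isT).
      by rewrite /template_matches /= -/v ev subst_cons subst_var /= eqxx.
    case: u ev => [|c u] ev; first by rewrite eba.
    have := H3 (fun=> u) c; rewrite mem_enum => /(_ isT).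
    by rewrite /template_matches /= -/v ev 2!subst_cons subst_var /= eba eqxx.
  split; last split.
  + by move=> sig tq; rewrite inE => /eqP->; rewrite /template_matches /= -/v H.
  + move=> sig b; rewrite mem_filter => /andP[nba _].
    rewrite /template_matches /= -/v H subst_cons /=; apply/negP => /andP[/eqP[e _] _].
    by rewrite e eqxx in nba.
  + move=> sig b _; rewrite /template_matches /= -/v H !subst_cons /=.
    by apply/negP => /andP[/eqP[]].
- rewrite avoids_map; split=> [H|H sig pqr pqr_in].
    apply: NNPP => /noncat_patterns_complete[x0 [x1 [x2 [x3 [pqr pqr_in Hpqr]]]]].
    pose sig := nth [::] [:: x0; x1; x2; x3].
    have [e1 e2 e3] := Hpqr sig erefl erefl erefl erefl.
    by have := H sig _ pqr_in; rewrite /template_matches /= -/v e1 e2 e3 !eqxx.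
  apply/negP; rewrite /template_matches /= -/v => /and4P[/eqP e1 /eqP e2 /eqP e3 _].
  by apply: (noncat_patterns_sound (sig := sig) pqr_in); rewrite -e1 -e2 -e3.
rewrite avoids_map; split=> [H|H sig pq pq_in].
  apply: NNPP => /distinct_patterns_complete[x0 [x1 [x2 [pq pq_in Hpq]]]].
  pose sig := nth [::] [:: x0; x1; x2; val (rcons pi false) l].
  have [e1 e2] := Hpq sig erefl erefl erefl.
  have := H sig _ pq_in; rewrite /template_matches /= -/v !subst_var e1 e2.
  by rewrite !eqxx.
apply/negP; rewrite /template_matches /= -/v !subst_var => /and4P[/eqP e1 /eqP e2 /eqP e3 _].
by apply: (distinct_patterns_sound (sig := sig) pq_in); rewrite -e1 -e3 H e2.
Qed.

Lemma term_queriesP n (t : term Sigma n) pi :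
  unviolated (term_queries t pi) <-> term_ok t pi.
Proof.
have valid (t1 : term Sigma n) pi1 : all (fun tq : template Sigma =>
    if tq.1 is Some (i, p) then i < n else true) (term_templates t1 pi1).
  case: t1 => [i||a|t1 t2|t1] /=; try by rewrite all_map; apply/allP.
    by rewrite all_map; apply/allP => pq _ /=.
  by rewrite all_cat !all_map; apply/andP; split; apply/allP.
have node (t1 : term Sigma n) pi1 := unviolated_templates (valid t1 pi1)
  (fun l ln => avoids_term t1 pi1 ln).
elim: t pi => [i||a|t1 IH1 t2 IH2|t1 IH1] pi; rewrite unviolated_cat.
- by rewrite node; split=> [[] //|]; split.
- by rewrite node; split=> [[] //|]; split.
- by rewrite node; split=> [[] //|]; split.
- by rewrite node unviolated_cat IH1 IH2.
by rewrite node IH1.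
Qed.

Lemma truth_templates_valid n ext k0 k1 k2 bad : all (fun tq : template Sigma =>
  if tq.1 is Some (i, p) then i < n else true) (truth_templates ext k0 k1 k2 bad).
Proof. by rewrite all_map; apply/allP. Qed.

Lemma avoids_truth3 l pi0 pi1 pi2 bad :
  avoids l (truth_templates [::] (at_pos pi0) (at_pos pi1) (at_pos pi2) bad) <->
  ~~ bad (truth (val pi0 l)) (truth (val pi1 l)) (truth (val pi2 l)).
Proof.
rewrite (@avoids_truth _ _ _ _ _ _ (fun=> inl (pi0, l)) (fun=> inl (pi1, l))
  (fun=> inl (pi2, l)) predT) //.
by split=> [/(_ [::] isT)|].
Qed.

Lemma avoids_quantifier b pi l : avoids l (quantifier_templates b pi) <->
  (truth (val pi l) = b -> truth (val (rcons pi false) (val (rcons pi true) l :: l)) = b) /\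
  (truth (val pi l) = ~~ b -> forall x, truth (val (rcons pi false) (x :: l)) = ~~ b).
Proof.
have child sig : key_in l (key_map (subst sig) (inl (rcons pi false, [:: [:: inr 3]]))) =
    inl (rcons pi false, sig 3 :: l) by rewrite /= subst_var.
rewrite /quantifier_templates avoids_cat.
rewrite (@avoids_truth _ _ _ _ _ _ (fun=> inl (pi, l))
  (fun x => inl (rcons pi false, x :: l)) (fun=> inl (pi, l))
  (fun x => val (rcons pi true) l == x)) //; last first.
  by move=> sig; rewrite /= subst_var andbT.
rewrite (@avoids_truth _ _ _ _ _ _ (fun=> inl (pi, l))
  (fun x => inl (rcons pi false, x :: l)) (fun=> inl (pi, l)) predT) //.
split=> [[H1 H2]|[H1 H2]]; split.
- move=> e; have := H1 _ (eqxx _); rewrite e eqxx /=.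
  by case: (truth _) (b) => [] [].
- move=> e x; have := H2 x isT; rewrite e eqxx /=.
  by case: (truth _) (b) => [] [].
- move=> x /eqP <-; apply/negP => /andP[/eqP/H1 -> /eqP]; by case: (b).
- move=> x _; apply/negP => /andP[/eqP/H2 -> /eqP]; by case: (b).
Qed.

Lemma formula_queriesP n (phi : formula Sigma n) pi :
  unviolated (formula_queries phi pi) <-> formula_ok phi pi.
Proof.
have eq_truth (b b' : bool) : ~~ (b != b') <-> b = b'.
  by rewrite negbK; split=> [/eqP|->].
have binary n1 op pi1 : unviolated [seq template_query n1 tq | tq <- binary_templates op pi1]
    <-> binary_ok op pi1 n1.
  apply: unviolated_templates => [|l _]; first exact: truth_templates_valid.
  by rewrite avoids_truth3 eq_truth.
have quant n1 b pi1 : unviolated [seq template_query n1 tq | tq <- quantifier_templates b pi1]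
    <-> quantifier_ok b pi1 n1.
  apply: unviolated_templates => [|l _]; last exact: avoids_quantifier.
  by rewrite all_cat !truth_templates_valid.
elim: phi pi => {n} [n|n t1 t2|n t1 t2|n p IH|n p IHp q IHq|n p IHp q IHq|n p IHp q IHq
  |n p IH|n p IH] pi.
- apply: unviolated_templates => [|l _]; first exact: truth_templates_valid.
  by rewrite avoids_truth3; split=> [/negbTE|->].
- rewrite /formula_queries !unviolated_cat !term_queriesP.
  apply: and_iff_compat_r; apply: unviolated_templates => [|l _]; last exact: avoids_eq.
  by rewrite all_cat all_map andbT; apply/allP.
- by [].
- rewrite /formula_queries -/formula_queries unviolated_cat IH.
  apply: and_iff_compat_r; apply: unviolated_templates => [|l _].
    exact: truth_templates_valid.
  by rewrite avoids_truth3; case: (truth _) (truth _) => [] []; split.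
- by rewrite /formula_queries -/formula_queries !unviolated_cat IHp IHq binary.
- by rewrite /formula_queries -/formula_queries !unviolated_cat IHp IHq binary.
- by rewrite /formula_queries -/formula_queries !unviolated_cat IHp IHq binary.
- by rewrite /formula_queries -/formula_queries !unviolated_cat IH quant.
- by rewrite /formula_queries -/formula_queries !unviolated_cat IH quant.
Qed.

Lemma nth_extend n x l : (fun i : 'I_n.+1 => nth [::] (x :: l) i) =
  extend x (fun i : 'I_n => nth [::] l i).
Proof.
apply: functional_extensionality => i; case: (unliftP ord0 i) => [j|] ->.
  by rewrite extendS.
by rewrite extend0.
Qed.

Lemma term_ok_eval n (t : term Sigma n) pi l : term_ok t pi -> size l = n ->
  val pi l = eval (fun x => G (inr x)) (fun i => nth [::] l i) t.
Proof.
move=> + ln; elim: t pi => [i||a|t1 IH1 t2 IH2|t1 IH1] pi /= => [->|->|->| |] //.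
  by move=> [-> // [/IH1-> /IH2->]].
by move=> [-> // /IH1->].
Qed.

Fixpoint infix_free n (phi : formula Sigma n) : bool :=
  match phi with
  | FFalse _ | FEq _ _ _ => true
  | FSubstring _ _ _ => false
  | FNot _ p | FForall _ p | FExists _ p => infix_free p
  | FAnd _ p q | FOr _ p q | FImp _ p q => infix_free p && infix_free q
  end.

(** Induction on the formula: the word stored at the second child of a quantifier refutes a false
    [FForall] and witnesses a true [FExists]. *)
Lemma formula_ok_holds n (phi : formula Sigma n) pi l : infix_free phi ->
  formula_ok phi pi -> size l = n ->
  truth (val pi l) <-> holds (fun x => G (inr x)) phi (fun i => nth [::] l i).
Proof.
elim: phi pi l => {n} [n|n t1 t2|n t1 t2|n p IH|n p IHp q IHq|n p IHp q IHq|n p IHp q IHq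
  |n p IH|n p IH] pi l.
- by move=> _ ok ln; rewrite ok //=.
- move=> _ [ok [ok1 ok2]] ln; rewrite ok //=.
  by rewrite !(term_ok_eval ok1, term_ok_eval ok2) //; split=> [/eqP|->].
- by [].
- move=> inf [ok okp] ln; rewrite ok //= -(IH _ _ inf okp ln).
  by split=> /negP.
- move=> /andP[i1 i2] [ok [okp okq]] ln; rewrite ok //=.
  rewrite -(IHp _ _ i1 okp ln) -(IHq _ _ i2 okq ln); by split=> /andP.
- move=> /andP[i1 i2] [ok [okp okq]] ln; rewrite ok //=.
  rewrite -(IHp _ _ i1 okp ln) -(IHq _ _ i2 okq ln); by split=> /orP.
- move=> /andP[i1 i2] [ok [okp okq]] ln; rewrite ok //=.
  rewrite -(IHp _ _ i1 okp ln) -(IHq _ _ i2 okq ln); by split=> /implyP.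
- move=> inf [ok okp] ln /=; have [ok1 ok2] := ok l ln; split.
    move=> tv x; rewrite -nth_extend; apply/(IH _ _ inf okp); first by rewrite /= ln.
    by rewrite ok2.
  move=> H; case tv: (truth _) => //; have := ok1 tv.
  suff -> : truth (val (rcons pi false) (val (rcons pi true) l :: l)) by [].
  by apply/(IH _ _ inf okp); rewrite ?nth_extend //= ln.
move=> inf [ok okp] ln /=; have [ok1 ok2] := ok l ln; split.
  move=> /ok1 tv; exists (val (rcons pi true) l); rewrite -nth_extend.
  by apply/(IH _ _ inf okp); first by rewrite /= ln.
move=> [x]; rewrite -nth_extend => /(IH _ (x :: l) inf okp) tv.
have {}tv : truth (val (rcons pi false) (x :: l)) by apply: tv; rewrite /= ln.
by case tv': (truth _) => //; have := ok2 tv' x; rewrite tv.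
Qed.

End Valuation.

(** * The valuation induced by a function *)

Section Canonical.

Variables (a : Sigma) (f : seq Sigma -> seq Sigma).

Definition env_of n l : 'I_n -> seq Sigma := fun i => nth [::] l i.

Definition decide (P : Prop) : bool :=
  if excluded_middle_informative P then true else false.

Lemma decideP P : reflect P (decide P).
Proof. by rewrite /decide; case: excluded_middle_informative; constructor. Qed.

Definition witness (P : seq Sigma -> Prop) : seq Sigma :=
  epsilon (inhabits [::]) P.

Fixpoint term_val n (t : term Sigma n) pi l : seq Sigma :=
  match pi with
  | [::] => eval f (@env_of n l) t
  | b :: pi' => match t with
    | TCat t1 t2 => term_val (if b then t2 else t1) pi' l
    | TFun t1 => term_val t1 pi' l
    | _ => [::]
    end
  end.

Definition truth_val (P : Prop) : seq Sigma := if decide P then [:: a] else [::].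

(** The second child of a quantifier holds a counterexample or a witness, arbitrary if there is
    none; positions outside the formula get the empty word. *)
Fixpoint formula_val n (phi : formula Sigma n) pi l : seq Sigma :=
  match pi with
  | [::] => truth_val (holds f phi (@env_of n l))
  | b :: pi' => match phi with
    | FFalse _ | FSubstring _ _ _ => [::]
    | FEq _ t1 t2 => term_val (if b then t2 else t1) pi' l
    | FNot _ p => formula_val p pi' l
    | FAnd _ p q | FOr _ p q | FImp _ p q => formula_val (if b then q else p) pi' l
    | FForall n p =>
        if b then witness (fun x => ~ holds f p (extend x (@env_of n l)))
        else formula_val p pi' l
    | FExists n p =>
        if b then witness (fun x => holds f p (extend x (@env_of n l)))
        else formula_val p pi' l
    end
  end.

Lemma truth_valE P : truth (truth_val P) = decide P.
Proof. by rewrite /truth_val; case: ifP. Qed.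

Lemma formula_val_nil n (phi : formula Sigma n) l :
  formula_val phi [::] l = truth_val (holds f phi (@env_of n l)).
Proof. by case: phi. Qed.

Variable G : key (seq Sigma) -> seq Sigma.
Hypothesis G_fun : forall x, G (inr x) = f x.

Lemma term_val_ok n (t : term Sigma n) pi :
  (forall pi' l, G (inl (pi ++ pi', l)) = term_val t pi' l) -> term_ok G t pi.
Proof.
elim: t pi => [i||b|t1 IH1 t2 IH2|t1 IH1] pi H /=.
- by move=> l _; have := H [::] l; rewrite cats0.
- by move=> l _; have := H [::] l; rewrite cats0.
- by move=> l _; have := H [::] l; rewrite cats0.
- split; last by split; [apply: IH1|apply: IH2] => pi' l; rewrite cat_rcons H.
  move=> l _; rewrite -[rcons pi false]cats0 -[rcons pi true]cats0 !cat_rcons !H.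
  by have := H [::] l; rewrite cats0; case: (t1) (t2) => [?||?|? ?|?] [?||?|? ?|?].
split; last by apply: IH1 => pi' l; rewrite cat_rcons H.
move=> l _; rewrite G_fun -[rcons pi false]cats0 !cat_rcons !H.
by have := H [::] l; rewrite cats0; case: (t1).
Qed.

Lemma formula_val_ok n (phi : formula Sigma n) pi :
  (forall pi' l, G (inl (pi ++ pi', l)) = formula_val phi pi' l) -> formula_ok G phi pi.
Proof.
have tnil n1 (t : term Sigma n1) l : term_val t [::] l = eval f (@env_of n1 l) t by case: t.
have fnil := formula_val_nil.
have decide_eq P (b : bool) : (P <-> b) -> decide P = b.
  by move=> Pb; apply/decideP/idP => /Pb.
have decideE P : decide P <-> P by split=> /decideP.
have witnessP (P : seq Sigma -> Prop) : (exists x, P x) -> P (witness P).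
  exact: epsilon_spec.
have env_cons n1 x l : @env_of n1.+1 (x :: l) = extend x (@env_of n1 l) := nth_extend n1 x l.
have root (V : seq bool -> seq (seq Sigma) -> seq Sigma) pi1 :
    (forall pi' l, G (inl (pi1 ++ pi', l)) = V pi' l) ->
    (forall l, G (inl (pi1, l)) = V [::] l) /\
    (forall b l, G (inl (rcons pi1 b, l)) = V [:: b] l).
  by move=> H; split=> [l|b l]; rewrite -H ?cats0 ?cats1.
elim: phi pi => {n} [n|n t1 t2|n t1 t2|n p IH|n p IHp q IHq|n p IHp q IHq|n p IHp q IHq
  |n p IH|n p IH] pi H; have [H0 H1] := root _ _ H.
- by move=> l _; rewrite H0 fnil truth_valE; apply/decideP.
- split; last by split; apply: term_val_ok => pi' l; rewrite cat_rcons H.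
  move=> l _; rewrite H0 !H1 fnil /= !tnil truth_valE.
  by apply: decide_eq; split=> /eqP.
- by [].
- split; last by apply: IH => pi' l; rewrite cat_rcons H.
  move=> l _; rewrite H0 H1 !fnil /= fnil !truth_valE.
  apply: decide_eq; split=> [np|/negP np /decideP //].
  by apply/negP => /decideP.
- split; last by split; [apply: IHp|apply: IHq] => pi' l; rewrite cat_rcons H.
  move=> l _; rewrite H0 !H1 !fnil /= !fnil !truth_valE.
  by apply: decide_eq; split=> [[/decideP -> /decideP ->]|/andP[/decideP ? /decideP ?]].
- split; last by split; [apply: IHp|apply: IHq] => pi' l; rewrite cat_rcons H.
  move=> l _; rewrite H0 !H1 !fnil /= !fnil !truth_valE.
  apply: decide_eq; split=> [[/decideP -> //|/decideP ->]|/orP[] /decideP ?].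
  + by rewrite orbT.
  + by left.
  + by right.
- split; last by split; [apply: IHp|apply: IHq] => pi' l; rewrite cat_rcons H.
  move=> l _; rewrite H0 !H1 !fnil /= !fnil !truth_valE.
  apply: decide_eq; split=> [pq|/implyP pq /decideP /pq /decideP //].
  by apply/implyP => /decideP /pq /decideP.
- split; last by apply: IH => pi' l; rewrite cat_rcons H.
  move=> l _; rewrite H0 !H1 !fnil /= !truth_valE; split=> [/decideP nall|/decideP all_p x].
    rewrite fnil truth_valE env_cons; apply/decideP.
    apply: (witnessP (fun x => ~ holds f p (extend x (@env_of n l)))).
    exact: not_all_ex_not.
  by rewrite H1 /= fnil truth_valE env_cons; apply/decideP.
- split; last by apply: IH => pi' l; rewrite cat_rcons H.
  move=> l _; rewrite H0 !H1 !fnil /= !truth_valE; split=> [/decideP ex|/decideP nex x].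
    rewrite fnil truth_valE env_cons; apply/decideP.
    exact: (witnessP (fun x => holds f p (extend x (@env_of n l)))).
  rewrite H1 /= fnil truth_valE env_cons; apply/decideP => px; apply: nex.
  by exists x.
Qed.

End Canonical.

End LocalConditions.

(** * Formulas to machines *)

Section InfixElimination.

Variable Sigma : finType.

Fixpoint no_infix n (phi : formula Sigma n) : formula Sigma n :=
  match phi with
  | FFalse n => FFalse
  | FEq n t1 t2 => FEq t1 t2
  | FSubstring n t1 t2 => FExists (FExists (FEq (tshift (tshift t2))
      (TCat (tshift (t0 Sigma n)) (TCat (tshift (tshift t1)) (t0 Sigma n.+1)))))
  | FNot n p => FNot (no_infix p)
  | FAnd n p q => FAnd (no_infix p) (no_infix q)
  | FOr n p q => FOr (no_infix p) (no_infix q)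
  | FImp n p q => FImp (no_infix p) (no_infix q)
  | FForall n p => FForall (no_infix p)
  | FExists n p => FExists (no_infix p)
  end.

Lemma no_infix_free n (phi : formula Sigma n) : infix_free (no_infix phi).
Proof. by elim: phi => //= {}n p -> q ->. Qed.

Lemma holds_no_infix f n (phi : formula Sigma n) e :
  holds f (no_infix phi) e <-> holds f phi e.
Proof.
elim: phi e => {n} [n|n t1 t2|n t1 t2|n p IH|n p IHp q IHq|n p IHp q IHq|n p IHp q IHq
  |n p IH|n p IH] e //=.
- split=> [[x [y]]|/infixP[x [y e2]]].
    rewrite !(eval_tshift, extendS, extend0) => ->; exact: infix_infix.
  by exists x, y; rewrite !(eval_tshift, extendS, extend0).
- by rewrite IH.
- by rewrite IHp IHq.
- by rewrite IHp IHq.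
- by rewrite IHp IHq.
- by split=> H x; apply/IH.
- by split=> -[x /IH H]; exists x.
Qed.

End InfixElimination.

(** * Records of plays as words *)

Section Log.

Variable Sigma : finType.

Notation L := (Sigma + bool * bool * bool)%type.

Definition dir_letter (b : bool) : L := inr (false, false, b).
Definition bang : L := inr (false, true, false).
Definition comma : L := inr (false, true, true).
Definition fun_letter : L := inr (true, false, false).
Definition dollar : L := inr (true, true, false).
Definition hash : L := inr (true, true, true).

Definition word_letter : pred L := fun x => if x is inl _ then true else false.
Definition key_letter : pred L := fun x => (x != hash) && (x != dollar).

Definition emb (z : seq Sigma) : seq L := [seq inl x | x <- z].

Definition unemb (s : seq L) : seq Sigma :=
  pmap (fun x => if x is inl a then Some a else None) s.

Lemma embK : cancel emb unemb.
Proof. by elim=> //= x z ->. Qed.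

Lemma emb_unemb s : all word_letter s -> emb (unemb s) = s.
Proof. by elim: s => //= -[a|x] s IH //= /IH ->. Qed.

Lemma all_emb z : all word_letter (emb z).
Proof. by elim: z. Qed.

Lemma inr_emb x z : (inr x \in emb z) = false.
Proof. by apply/negP => /mapP[]. Qed.

Definition key_word (k : key (seq Sigma)) : seq L :=
  match k with
  | inl (pi, l) =>
      [seq dir_letter b | b <- pi] ++ bang :: flatten [seq rcons (emb x) comma | x <- l]
  | inr x => fun_letter :: emb x
  end.

(** Read from the right, the comma ending an entry opens an empty word, to which the letters before
    it are prepended. *)
Definition env_parse (s : seq L) : seq (seq Sigma) :=
  foldr (fun x l => match x with
    | inl a => if l is z :: l' then (a :: z) :: l' else l
    | inr (_, _, _) => [::] :: l
    end) [::] s.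

(** Defined on all words, so that a strategy following [G] has an answer even to a question that is
    no key. *)
Definition key_parse (s : seq L) : key (seq Sigma) :=
  if s is inr (true, false, false) :: s' then inr (unemb s')
  else inl ([seq if x is inr (_, _, b) then b else false | x <- take (index bang s) s],
            env_parse (drop (index bang s).+1 s)).

Lemma key_wordK : cancel key_word key_parse.
Proof.
case=> [[pi l]|x]; last by rewrite /= embK.
have env : env_parse (flatten [seq rcons (emb x) comma | x <- l]) = l.
  elim: l => //= x l IH; rewrite cat_rcons; elim: x => [|a x IHx] /=; first by rewrite IH.
  by rewrite -/(emb x) IHx.
have idx : index bang (key_word (inl (pi, l))) = size pi.
  by rewrite /key_word; elim: pi => //= b pi ->.
rewrite /key_parse idx /= take_size_cat ?size_map // -cat_rcons.
rewrite drop_size_cat ?size_rcons ?size_map // env -map_comp map_id_in //.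
by case: pi {idx}.
Qed.

Lemma key_word_letters k : all key_letter (key_word k).
Proof.
have emb_letters x : all key_letter (emb x) by elim: x.
case: k => [[pi l]|x] /=; last by rewrite emb_letters.
rewrite all_cat /=; apply/andP; split; first by elim: pi.
by elim: l => //= x l IH; rewrite all_cat all_rcons emb_letters IH.
Qed.

Definition pemb (p : pattern Sigma) : pattern L :=
  [seq match x with inl a => inl (inl a) | inr i => inr i end | x <- p].

Definition key_pattern (k : key (pattern Sigma)) : pattern L :=
  match k with
  | inl (pi, l) => [seq inl (dir_letter b) | b <- pi] ++
      inl bang :: flatten [seq rcons (pemb x) (inl comma) | x <- l]
  | inr x => inl fun_letter :: pemb x
  end.

Lemma subst_pemb sig p : subst (fun i => emb (sig i)) (pemb p) = emb (subst sig p).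
Proof.
elim: p => //= -[a|i] p IH; rewrite !subst_cons IH //.
by rewrite /emb map_cat.
Qed.

Lemma subst_key_pattern sig k :
  subst (fun i => emb (sig i)) (key_pattern k) = key_word (key_map (subst sig) k).
Proof.
case: k => [[pi l]|x] /=; last by rewrite subst_cons subst_pemb.
rewrite subst_cat subst_cons; congr (_ ++ _ :: _); first by elim: pi => //= b pi <-.
elim: l => //= x l <-; rewrite subst_cat -cats1 subst_cat subst_pemb.
by rewrite -cats1 -catA.
Qed.

(** The closing [hash] forces the value pattern to match the whole value and not just a prefix of
    it. *)
Definition entry_pattern (kp : key (pattern Sigma) * pattern Sigma) : bool * pattern L :=
  (false, inl hash :: key_pattern kp.1 ++ inl dollar :: pemb kp.2 ++ [:: inl hash]).

Definition entry (x : seq L * seq Sigma) : seq L := hash :: x.1 ++ dollar :: emb x.2.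

Lemma subst_entry sig kp : subst (fun i => emb (sig i)) (entry_pattern kp).2 =
  rcons (entry (key_word (key_map (subst sig) kp.1), subst sig kp.2)) hash.
Proof.
rewrite /entry_pattern subst_cons subst_cat subst_cons subst_cat subst_key_pattern.
by rewrite subst_pemb -cats1 /entry /= -catA.
Qed.

Definition log_word (w : seq Sigma) (h : seq (seq L * seq Sigma)) : seq L :=
  emb w ++ flatten [seq entry x | x <- h].

Lemma split_first (T : eqType) (x : T) u v u' v' : x \notin u -> x \notin u' ->
  u ++ x :: v = u' ++ x :: v' -> u = u' /\ v = v'.
Proof.
elim: u u' => [|y u IH] [|y' u'] //=; rewrite ?inE.
- by move=> _ _ [->].
- by move=> _ /norP[/eqP nxy _] [exy]; case: nxy.
- by move=> /norP[/eqP nxy _] _ [exy]; case: nxy.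
by move=> /norP[_ xu] /norP[_ xu'] [-> /(IH _ xu xu')[-> ->]].
Qed.

Lemma split_later (T : eqType) (x : T) u v u' v' : x \notin u ->
  u ++ x :: v = u' ++ x :: v' -> v = v' \/ exists u2, v = u2 ++ x :: v'.
Proof.
elim: u u' => [|y u IH] [|y' u'] //=; rewrite ?inE.
- by move=> _ [->]; left.
- by move=> _ [_ ->]; right; exists u'.
- by move=> /norP[/eqP nxy _] [exy]; case: nxy.
by move=> /norP[_ xu] [_ /(IH _ xu)].
Qed.

Lemma log_end h : exists s, rcons (flatten [seq entry x | x <- h]) hash = hash :: s.
Proof. by case: h => [|x h]; [exists [::] | rewrite /entry /=; eexists]. Qed.

Lemma key_letters_hash k : all key_letter k -> hash \notin k.
Proof. by move=> /allP kC; apply/negP => /kC. Qed.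

Lemma key_letters_dollar k : all key_letter k -> dollar \notin k.
Proof. by move=> /allP kC; apply/negP => /kC. Qed.

(** Since [hash] occurs only at the ends of entries, an occurrence covers exactly one entry. The
    [hash]-free [s] absorbs the rest of an entry already passed in the induction. *)
Lemma infix_log s h x : hash \notin s -> all key_letter x.1 ->
  all (fun y => all key_letter y.1) h ->
  infix (rcons (entry x) hash) (s ++ rcons (flatten [seq entry y | y <- h]) hash) =
  (x \in h).
Proof.
move=> + xC; elim: h s => [|y h IH] s hs.
  move=> _; rewrite in_nil; apply/negP => /infixP[p [q e]].
  have := congr1 (count_mem hash) e.
  rewrite -!cats1 !count_cat (count_memPn hs) /= ?eqxx; lia.
move=> /andP[yC hC]; rewrite inE.
have -> : flatten [seq entry z | z <- y :: h] = entry y ++ flatten [seq entry z | z <- h] by [].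
rewrite rcons_cat.
have [r er] := log_end h.
have hash_y : hash \notin y.1 ++ dollar :: emb y.2.
  by rewrite mem_cat inE inr_emb (negPf (key_letters_hash yC)).
have eh : entry y ++ rcons (flatten [seq entry z | z <- h]) hash =
    hash :: (y.1 ++ dollar :: emb y.2) ++ rcons (flatten [seq entry z | z <- h]) hash by [].
apply/infixP/orP.
  move=> [p [q]]; rewrite eh => /esym e.
  have {}e : p ++ hash :: (x.1 ++ dollar :: emb x.2) ++ hash :: q =
    s ++ hash :: (y.1 ++ dollar :: emb y.2) ++ rcons (flatten [seq entry z | z <- h]) hash.
    by rewrite -e cat_rcons.
  have [|[u2 e2]] := split_later hs (esym e).
    rewrite er => /split_first[]; rewrite ?hash_y //.
      by rewrite mem_cat inE inr_emb (negPf (key_letters_hash xC)).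
    move/split_first => []; rewrite ?key_letters_dollar // => ey1 ey2 _; left.
    apply/eqP; rewrite [x]surjective_pairing [y]surjective_pairing.
    by rewrite ey1 (can_inj embK ey2).
  right; rewrite -(IH _ hash_y hC) e2; apply/infixP; exists u2, q.
  by rewrite cat_rcons.
case=> [/eqP->|xh].
  by exists s, r; rewrite eh er cat_rcons.
have := IH _ hash_y hC; rewrite xh => /infixP[p [q e]].
exists (s ++ hash :: p), q; rewrite eh e.
by rewrite -catA.
Qed.

End Log.

(** * The game for a formula and its winner *)

Section FormulaToMachine.

Variables (Sigma : finType) (a : Sigma) (phi : formula Sigma 1).
Hypothesis phi_free : infix_free phi.

Notation L := (Sigma + bool * bool * bool)%type.
Notation log := (seq (seq L * seq Sigma)).

(* The refuter of [phi] must not answer that [phi] holds of the input word. *)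
Definition root_query (b : Sigma) : seq (bool * pattern L) :=
  [:: (true, [:: inr 0; inl (hash Sigma)]);
      entry_pattern (inl ([::], [:: [:: inr 0]]), [:: inl b; inr 1])].

Definition formula_game_queries : seq (seq (bool * pattern L)) :=
  [seq root_query b | b <- enum Sigma] ++
  [seq [seq entry_pattern kp | kp <- q] | q <- formula_queries phi [::]].

Definition root_key (w : seq Sigma) : key (seq Sigma) := inl ([::], [:: w]).

Lemma query_holds_log (w : seq Sigma) (h : log) :
  all (fun x => all (@key_letter Sigma) x.1) h ->
  query_holds (@word_letter Sigma) formula_game_queries (rcons (log_word w h) (hash _)) <->
  (exists b v, (key_word (root_key w), b :: v) \in h) \/
  (exists q sig, q \in formula_queries phi [::] /\
    all (fun kp => (key_word (key_map (subst sig) kp.1), subst sig kp.2) \in h) q).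
Proof.
move=> hC.
have entryP sig kp : item_match (fun i => emb (sig i)) (rcons (log_word w h) (hash _))
    (entry_pattern kp) = ((key_word (key_map (subst sig) kp.1), subst sig kp.2) \in h).
  rewrite -[LHS]/(infix (subst _ (entry_pattern kp).2) _) subst_entry.
  rewrite rcons_cat infix_log //; first by rewrite inr_emb.
  exact: key_word_letters.
(* The anchored item binds variable 0 to the input word, which ends at the first [hash]. *)
have rootP z : prefix (rcons (emb z) (hash _)) (rcons (log_word w h) (hash _)) = (z == w).
  rewrite rcons_cat; have [r ->] := log_end h.
  apply/prefixP/eqP => [[q]|->]; last by exists r; rewrite cat_rcons.
  by rewrite cat_rcons => /split_first[]; rewrite ?inr_emb // => /(can_inj (@embK _))->.
split.
  move=> [sigma sV [q]].
  have [sig ->] : exists sig, sigma = fun i => emb (sig i).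
    exists (fun i => unemb (sigma i)); apply: functional_extensionality => i.
    by rewrite emb_unemb.
  rewrite mem_cat => /orP[]/mapP[x x_in ->].
    rewrite /= !entryP /= andbT => /andP[]; rewrite /item_match /= subst_cons.
    rewrite -[subst _ [:: inl _]]/[:: hash _] cats1 rootP => /eqP ew.
    by rewrite subst_var ew subst_cons subst_var => inh; left; exists x, (sig 1).
  rewrite all_map => xh; right; exists x, sig; split=> //.
  by apply: sub_all xh => kp /=; rewrite entryP.
case=> [[b [v bv]]|[q [sig [q_in qh]]]].
  exists (fun i => emb (nth [::] [:: w; v] i)) => [i|]; first exact: all_emb.
  exists (root_query b).
    by rewrite mem_cat; apply/orP; left; apply: map_f; rewrite mem_enum.
  rewrite /= entryP /= !subst_var /= /item_match /=.
  rewrite subst_cons -[subst _ [:: inl _]]/[:: hash _] cats1 rootP eqxx /= andbT.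
  by rewrite subst_cons subst_var.
exists (fun i => emb (sig i)) => [i|]; first exact: all_emb.
exists [seq entry_pattern kp | kp <- q].
  by rewrite mem_cat; apply/orP; right; apply: map_f.
by rewrite all_map; apply: sub_all qh => kp /=; rewrite entryP.
Qed.

Notation game := (query_game (hash Sigma) (dollar Sigma) (@key_letter Sigma)
  (@word_letter Sigma) formula_game_queries).

Lemma log_word_rcons w (h : log) u v :
  log_word w (rcons h (u, v)) = log_word w h ++ hash _ :: u ++ dollar _ :: emb v.
Proof.
by rewrite /log_word map_rcons -cats1 flatten_cat catA /= cats0.
Qed.

Lemma env1 (w : seq Sigma) : (fun=> w) = (fun i : 'I_1 => nth [::] [:: w] i).
Proof. by apply: functional_extensionality => i; rewrite ord1. Qed.

Lemma game_sound w f : game (emb w) -> holds f phi (fun=> w).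
Proof.
move=> gm; apply: NNPP => nphi.
pose G (k : key (seq Sigma)) := match k with
  | inl (pi, l) => formula_val a f phi pi l | inr x => f x end.
have /formula_queriesP G_ok : formula_ok G phi [::] by apply: (@formula_val_ok _ a f G).
have G_root : G (root_key w) = [::].
  rewrite /G /root_key formula_val_nil /truth_val; case: decideP => // H.
  by case: nphi; rewrite env1.
(* Invariant: every recorded answer is the value of [G] at the parsed key. Stopping then contradicts
   [G_root] or [G_ok]. *)
suff H s : game s -> forall h : log, s = log_word w h ->
    all (fun x => all (@key_letter Sigma) x.1) h ->
    all (fun x => x.2 == G (key_parse x.1)) h -> False.
  by apply: (H _ gm [::]); rewrite /log_word ?cats0.
elim=> {s} [s + h es hC /allP hG|s u uC _ IH h es hC hG].
  rewrite es => /(query_holds_log w hC)[[b [v /hG]]|[q [sig [q_in /allP qh]]]].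
    by rewrite -[is_true _]/(is_true (b :: v == G (key_parse (key_word (root_key w))))) key_wordK G_root.
  apply: (G_ok q q_in); exists sig; apply/allP => kp /qh/hG /=.
  by rewrite key_wordK eq_sym.
apply: (IH (emb (G (key_parse u))) (all_emb _) (rcons h (u, G (key_parse u)))).
- by rewrite log_word_rcons es.
- by rewrite all_rcons uC.
- by rewrite all_rcons eqxx.
Qed.

Lemma game_complete w : (forall f, holds f phi (fun=> w)) -> game (emb w).
Proof.
move=> all_f; apply: NNPP => ngm.
pose answers (h : log) u v := ~ game (log_word w (rcons h (u, v))).
pose pick h u := epsilon (inhabits [::]) (answers h u).
(* If every answer led to a won position, [QueryMove] would make the present one won. *)
have pickP h u : ~ game (log_word w h) -> all (@key_letter Sigma) u -> answers h u (pick h u).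
  move=> nh uC; apply: epsilon_spec; apply: NNPP => H; apply: nh.
  apply: (QueryMove uC) => v' /emb_unemb <-; apply: NNPP => nv.
  by apply: H; exists (unemb v'); rewrite /answers log_word_rcons.
pose key_at n : seq L := if unpickle n is Some k then
  if all (@key_letter Sigma) k then k else [::] else [::].
have key_atC n : all (@key_letter Sigma) (key_at n).
  by rewrite /key_at; case: unpickle => // k; case: ifP.
pose hist := fix hist n : log :=
  if n is n'.+1 then rcons (hist n') (key_at n', pick (hist n') (key_at n')) else [::].
have histN n : ~ game (log_word w (hist n)).
  elim: n => [|n IH] /=; last exact: pickP.
  by rewrite /log_word cats0.
have histC n : all (fun x => all (@key_letter Sigma) x.1) (hist n).
  by elim: n => //= n IH; rewrite all_rcons key_atC.
(* The answer at stage [pickle u], where [key_at] asks for [u]. The default question of [key_at] may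
   recur, but answers at other stages are ignored. *)
pose ans u := pick (hist (pickle u)) u.
have ans_in u m : all (@key_letter Sigma) u -> pickle u < m -> (u, ans u) \in hist m.
  move=> uC; elim: m => // m IH; rewrite ltnS leq_eqVlt /= mem_rcons inE.
  case/orP => [/eqP <-|/IH->]; last by rewrite orbT.
  by rewrite /key_at pickleK uC eqxx.
pose G k := ans (key_word k).
have G_ok : formula_ok G phi [::].
  apply/formula_queriesP => q q_in [sig /allP qG].
  (* A stage by which all the finitely many keys of the instance have been asked. *)
  pose m := \max_(kp <- q) (pickle (key_word (key_map (subst sig) kp.1))).+1.
  apply: (histN m); apply: QueryStop; apply/query_holds_log => //; right.
  exists q, sig; split=> //; apply/allP => kp kp_in; rewrite -(eqP (qG _ kp_in)).
  apply: ans_in; first exact: key_word_letters.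
  exact: (leq_bigmax_seq (F := fun kp : key (pattern Sigma) * pattern Sigma =>
    (pickle (key_word (key_map (subst sig) kp.1))).+1) kp kp_in isT).
have root_true : truth (G (root_key w)).
  apply: (proj2 (@formula_ok_holds _ G 1 phi [::] [:: w] phi_free G_ok erefl)).
  rewrite -(env1 w); exact: all_f.
have [b [v ev]] : exists b v, G (root_key w) = b :: v.
  by move: root_true; rewrite /truth; case: (G _) => // b v _; exists b, v.
apply: (histN (pickle (key_word (root_key w))).+1); apply: QueryStop.
apply/(query_holds_log w (histC _)); left; exists b, v; case: _ / ev.
by apply: ans_in; [exact: key_word_letters | exact: ltnSn].
Qed.

End FormulaToMachine.

Lemma inductive_atm (Sigma : finType) (a : Sigma) (L : language Sigma) :
  inductive_language L ->
  exists M : ATM Sigma, forall w : seq Sigma, L w <-> atm_language M w.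
Proof.
move=> [phi Lphi]; pose psi := no_infix phi.
have no_hash : ~~ word_letter (hash Sigma) by [].
have marked q x : q \in formula_game_queries psi -> x \in q ->
    x.1 || (inl (hash Sigma) \in x.2).
  rewrite mem_cat => /orP[]/mapP[y _ ->].
    by rewrite !inE => /orP[]/eqP->; rewrite //= inE eqxx.
  by case/mapP => kp _ ->; rewrite /= inE eqxx.
have [M HM] := query_game_atm (dollar Sigma) (@key_letter Sigma) no_hash marked (fun b => inl b).
exists M => w; rewrite HM Lphi; split=> [H|gm f].
  by apply: game_complete => [|f]; [apply: no_infix_free | apply/holds_no_infix].
by apply/holds_no_infix; apply: (game_sound a) gm.
Qed.

(** Without transitions a universal start is accepted vacuously and an existential one is stuck,
    hence rejected. *)
Definition const_atm (Sigma : finType) (b : bool) : ATM Sigma :=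
  @MkATM Sigma unit unit (if b then inr tt else inl tt) (option Sigma) id (@inj_id _)
    (fun=> false).

Lemma const_atmP (Sigma : finType) b w : atm_language (const_atm Sigma b) w <-> b.
Proof.
have no_yield c c' : ~ @yield Sigma (const_atm Sigma b) c c' by case.
rewrite /atm_language; case: b no_yield => no_yield.
  by split=> // _; apply/accepted_U => // c' /no_yield.
by split=> // /accepted_E [] // c' /no_yield.
Qed.

Theorem theorem3p4 (Sigma : finType) (L : language Sigma) :
  inductive_language L <->
  exists M : ATM Sigma, forall w : seq Sigma, L w <-> atm_language M w.
Proof.
(* Unary numbers and nonempty truth values need a letter. Over the empty alphabet the empty word is
   the only word, so [L] is constant. *)
case: (pickP (@predT Sigma)) => [a _|Sigma0].
  split=> [|[M LM]]; first exact: (inductive_atm a).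
  have [phi Hphi] := atm_inductive a M.
  by exists phi => w; rewrite LM.
have words (w : seq Sigma) : w = [::] by case: w => // b; have := Sigma0 b.
have const : exists b : bool, forall w, L w <-> b.
  case: (classic (L [::])) => L0; [exists true | exists false] => w; by rewrite (words w).
case: const => b Lb; split=> _.
  by exists (const_atm Sigma b) => w; rewrite const_atmP.
exists (FBool Sigma 1 b) => w; rewrite Lb; split=> [b1 f|/(_ id) /holds_bool //].
exact/holds_bool.
Qed.
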